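(* Let $p_{\inf}$ and $p_{\sup}$ denote the infimum respectively supremum of $$J(y(\cdot))=\int_\Omega L(x,y(x),\mathcal D y(x))\,dx+\int_{\partial\Omega}L_\partial(x,y(x),\mathcal D y(x))\,d\sigma(x)$$ over all solutions $y(\cdot)$ of the boundary value problem $$F(x,y(x),\mathcal D y(x))+\sum_{i\le j}B_{i,j}(x,y(x))\frac{\partial^2 y}{\partial x_i\partial x_j}=0\ \text{ in }\Omega^{\mathsf o},\qquad G(x,y(x),\mathcal D y(x))=0\ \text{ on }\partial\Omega,$$ and let $\hat p_{\inf}$ and $\hat p_{\sup}$ denote the infimum respectively supremum of the infinite-dimensional linear program (LP) over measures defined in the context. Then $$\hat p_{\inf}\le p_{\inf},\qquad \hat p_{\sup}\ge p_{\sup}.$$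
   Context: **Domain.** $\Omega=\{x\in\mathbb R^n\mid g^\Omega_i(x)\ge 0,\ i=1,\dots,n^\Omega\}$ is a compact basic semialgebraic set ($g_i^\Omega$ polynomials), equal to the closure of its interior $\Omega^{\mathsf o}$, with (locally) Lipschitz boundary $\partial\Omega$. $\sigma$ is the surface measure on $\partial\Omega$ and $\eta=(\eta_1,\dots,\eta_n)$ the outward unit normal, so that $\int_{\partial\Omega}h\,\eta_m\,d\sigma=\int_\Omega\frac{\partial h}{\partial x_m}\,dx$ for all $h\in W^{1,\infty}(\Omega^{\mathsf o})$, $m=1,\dots,n$. $\partial\Omega=\bigcup_{i=1}^{n_{\mathrm b}}\partial\Omega_i$ with each $\partial\Omega_i$ basic semialgebraic and smooth, pairwise disjoint up to $\sigma$-null sets. **Data.** $F:\mathbb R^n\times\mathbb R^{n_y}\times\mathbb R^{n_y\times n}\to\mathbb R^{n_F}$ is a polynomial map; $B_{i,j}:\mathbb R^n\times\mathbb R^{n_y}\to\mathbb R^{n_F\times n_y}$ ($1\le i\le j\le n$) have polynomial entries; $G$ (with values in $\mathbb R^{n_G}$) and $L_\partial$ (real-valued) are functions of $(x,y,z)$ coinciding with polynomials for $x$ in each piece $\partial\Omega_i$; $L$ is a real polynomial in $(x,y,z)$. $\mathcal D y$ is the weak Jacobian, $(\mathcal D y)_{l,m}=\partial y_l/\partial x_m$. **Solutions.** $\mathbf Y\subset\mathbb R^{n_y}$, $\mathbf Z\subset\mathbb R^{n_y\times n}$ are given Borel sets. Let $k=1$ if all $B_{i,j}=0$ and $k=2$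 otherwise. A solution is $y(\cdot)\in W^{k,\infty}(\Omega^{\mathsf o};\mathbf Y)\cap C(\Omega;\mathbf Y)$ satisfying the equation Lebesgue-a.e. in $\Omega^{\mathsf o}$ and the boundary condition $\sigma$-a.e. on $\partial\Omega$; it is a standing assumption that solutions satisfy $y(x)\in\mathbf Y$, $\mathcal D y(x)\in\mathbf Z$ (Lebesgue-a.e. in $\Omega$ and $\sigma$-a.e. on $\partial\Omega$). When $k=2$, $\mathcal D y$ on $\partial\Omega$ is the trace; when $k=1$, $\mathcal D y|_{\partial\Omega}$ denotes a fixed bounded $\sigma$-measurable function belonging to the solution and used in all boundary expressions. **The LP.** $\mathcal M(A)_+$ is the set of nonnegative Borel measures supported in $A$. The decision variables are $\mu\in\mathcal M(\Omega\times\mathbf Y\times\mathbf Z)_+$ and $\mu_{\partial_i}\in\mathcal M(\partial\Omega_i\times\mathbf Y\times\mathbf Z)_+$, $i=1,\dots,n_{\mathrm b}$ (all integrals below being required to converge absolutely); write $\mu_\partial=\sum_i\mu_{\partial_i}$, where integrals of $G$ and $L_\partial$ against $\mu_{\partial_i}$ use the polynomial valid on $\partial\Omega_i$. The objective (minimized or maximized) is $$\int_{\Omega\times\mathbf Y\times\mathbf Z}L\,d\mu+\sum_{i=1}^{n_{\mathrm b}}\int_{\partial\Omega_i\times\mathbf Y\times\mathbf Z}L_\partial\,d\mu_{\partial_i},$$ subject to, for all $\phi\in C^\infty(\Omega\times\mathbf Y)$ (restrictions of smooth functions on $\mathbb R^n\times\mathbb R^{n_y}$): (a) for all $m\in\{1,\dots,n\}$: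 $\int[\frac{\partial\phi}{\partial x_m}+\sum_{l=1}^{n_y}\frac{\partial\phi}{\partial y_l}z_{l,m}]\,d\mu-\int\phi(x,y)\eta_m(x)\,d\mu_\partial=0$; (b) $\int\phi F\,d\mu-\sum_{i\le j}\int\phi[\frac{\partial B_{i,j}}{\partial x_j}+\sum_{l}\frac{\partial B_{i,j}}{\partial y_l}z_{l,j}]z_{\bullet,i}\,d\mu-\sum_{i\le j}\int[\frac{\partial\phi}{\partial x_j}+\sum_l\frac{\partial\phi}{\partial y_l}z_{l,j}]B_{i,j}z_{\bullet,i}\,d\mu+\sum_{i\le j}\int B_{i,j}\phi\, z_{\bullet,i}\eta_j\,d\mu_\partial=0$, where $z_{\bullet,i}$ is the $i$-th column of $z\in\mathbb R^{n_y\times n}$; (c) $\int\phi(x,y)G(x,y,z)\,d\mu_\partial=0$; and (d) for all $\psi\in C^\infty(\Omega)$ and all $i$: $\int_{\partial\Omega_i\times\mathbf Y\times\mathbf Z}\psi(x)\,d\mu_{\partial_i}(x,y,z)=\int_{\partial\Omega_i}\psi\,d\sigma$. Conventions: $\inf\emptyset=+\infty$, $\sup\emptyset=-\infty$. *)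

(* Defs.v *)
From HB Require Import structures.
From mathcomp Require Import all_boot all_order all_algebra.
From mathcomp Require Import all_classical all_reals all_analysis.
From mathcomp Require mpoly.
Set Implicit Arguments.
Unset Strict Implicit.
Unset Printing Implicit Defensive.
Import Order.TTheory GRing.Theory Num.Theory.
Import numFieldNormedType.Exports.
Local Open Scope classical_set_scope.
Local Open Scope ring_scope.

(* R^n is 'rV[R]_n; matrix spaces carry their Borel sigma-algebra. *)
HB.instance Definition _ (R : realType) (m n : nat) :=
  @isMeasurable.Build default_measure_display 'M[R]_(m, n)
    <<s open >> (@sigma_algebra0 _ setT open) (@sigma_algebraC _ open)
    (@sigma_algebra_bigcup _ setT open).

Section lebesgue_n.
Context {R : realType}.

Definition rcons0 n (p : 'rV[R]_n * R) : 'rV[R]_n.+1 :=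
  row_mx (p.2%:M : 'rV[R]_1) p.1.

Lemma open_rat_ball n (U : set 'rV[R]_n) : open U ->
  U = \bigcup_(c in [set c : 'rV[rat]_n * rat |
        ball (map_mx ratr c.1 : 'rV[R]_n) (ratr c.2) `<=` U])
      ball (map_mx ratr c.1 : 'rV[R]_n) (ratr c.2).
Proof.
move=> oU; apply/seteqP; split=> [x Ux|x [c cU]]; last exact: cU.
have /nbhs_ballP[e /= e0 eU] : nbhs x U by exact: open_nbhs_nbhs.
have [r /andP[r0 re]] : exists r : rat, (0 < (ratr r : R)) && (ratr r < e / 2).
  have /rat_in_itvoo[r] : 0 < e / 2 by rewrite divr_gt0.
  by rewrite in_itv => ?; exists r.
have Q (i : 'I_n) : {q : rat | `|x ord0 i - (ratr q : R)| < ratr r}.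
  apply: cid.
  have /rat_in_itvoo[q] : x ord0 i - ratr r < x ord0 i + ratr r by rewrite ltrBlDr -addrA ltrDl addr_gt0.
  rewrite in_itv /= => /andP[q1 q2]; exists q.
  rewrite ltr_norml; apply/andP; split.
    by rewrite ltrBrDr addrC ltrBlDr.
  by rewrite ltrBlDr addrC -ltrBlDr.
pose c : 'rV[rat]_n := \row_i projT1 (Q i).
exists (c, r) => /=.
  move=> z [_ cz]; apply: eU; split => // i j.
  have := cz i j; rewrite (ord1 i) !mxE /ball /= => h.
  have h2 := projT2 (Q j) => /=.
  rewrite -(subrK (ratr (projT1 (Q j))) (x ord0 j)) -addrA.
  apply: le_lt_trans (ler_normD _ _) _.
  rewrite [e]splitr; apply: ltrD; [exact: lt_trans h2 re|exact: lt_trans h re].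
split; first by [].
move=> i j; rewrite (ord1 i) !mxE /ball /= distrC.
exact: projT2 (Q j).
Qed.

Lemma rcons0_measurable n : measurable_fun setT (@rcons0 n).
Proof.
apply: (measurability (@open 'rV[R]_n.+1)) => // _ [U oU <-].
rewrite setTI (open_rat_ball oU) preimage_bigcup bigcup_mkcond.
apply: countable_bigcupT_measurable => [//|[q r]]; case: ifPn => // _.
have -> : @rcons0 n @^-1` ball (map_mx ratr q : 'rV[R]_n.+1) (ratr r) =
    ball (rsubmx (map_mx ratr q : 'rV[R]_(1 + n))) (ratr r) `*`
    ball (ratr (q ord0 ord0) : R) (ratr r).
  apply/seteqP; split=> -[x t] /=.
    move=> [r0 b]; split; last first.
      have := b ord0 ord0; rewrite /rcons0 !mxE.
      by case: splitP => // k _; rewrite (ord1 k) !mxE eqxx.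
    split=> // i j; have := b i (rshift 1 j).
    rewrite /rcons0 !mxE; case: splitP => [k /=|k /eqP]; first by rewrite (ord1 k).
    by rewrite eqn_add2l => /eqP /val_inj <-.
  move=> [[r0 b] c]; split=> // i j; rewrite /rcons0 (ord1 i) !mxE.
  case: splitP => k jk.
    by rewrite (ord1 k) mxE eqxx (_ : j = ord0)//; apply/val_inj; rewrite [LHS]jk (ord1 k).
  have := b ord0 k; rewrite !mxE (_ : rshift 1 k = j)//.
  exact/val_inj/esym.
apply: measurableX.
  by apply: sub_sigma_algebra; exact: ball_open.
by rewrite ball_itv; exact: measurable_itv.
Qed.

Definition push d d' (T1 : measurableType d) (T2 : measurableType d')
    (m : {measure set T1 -> \bar R}) (f : T1 -> T2)
    (mf : measurable_fun setT f) : {measure set T2 -> \bar R} :=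
  measure_function_pushforward__canonical__measure_function_Measure m mf.

(* Lebesgue measure on R^n, as the n-fold product of lebesgue_measure. *)
Fixpoint leb n : {measure set 'rV[R]_n -> \bar R} :=
  if n is k.+1 then
    push (leb k \x lebesgue_measure)%E (@rcons0_measurable k)
  else \d_(0 : 'rV[R]_0).

End lebesgue_n.

Section euclidean.
Context {R : realType} {n : nat}.
Implicit Types (x y v : 'rV[R]_n) (A C : set 'rV[R]_n).

(* The library norm of 'rV[R]_n is the sup norm; [enorm] is the Euclidean one. *)
Definition dotp x y : R := \sum_i x ord0 i * y ord0 i.
Definition enorm x : R := Num.sqrt (dotp x x).

Definition bvec (m : 'I_n) : 'rV[R]_n := delta_mx ord0 m.

Definition boundary A : set 'rV[R]_n := closure A `\` A°.

Definition ediam C : \bar R :=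
  ereal_sup [set (enorm (p.1 - p.2))%:E | p in C `*` C].

(* Volume of the Euclidean unit ball of R^d. *)
Definition ball_volume (d : nat) : \bar R :=
  leb d [set u : 'rV[R]_d | \sum_i u ord0 i ^+ 2 <= 1].

(* The empty set is treated apart because its diameter is -oo and because of
   d = 0, where every nonempty set has weight 1. *)
Definition hausdorff_weight (d : nat) C : \bar R :=
  if C == set0 then 0%E
  else (ball_volume d * (ediam C * (2^-1)%:E) ^+ d)%E.

Definition hausdorff_pre (d : nat) (delta : R) A : \bar R :=
  ereal_inf [set (\sum_(0 <= k <oo) hausdorff_weight d (C k))%E
    | C in [set C : nat -> set 'rV[R]_n |
        A `<=` \bigcup_k C k /\ forall k, (ediam (C k) <= delta%:E)%E]].

(* d-dimensional Hausdorff outer measure, normalised so as to agree with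
   Lebesgue measure on R^d. *)
Definition hausdorff (d : nat) A : \bar R :=
  ereal_sup [set hausdorff_pre d delta A | delta in [set e : R | 0 < e]].

End euclidean.

Section smooth_functions.
Context {R : realType} {V : normedModType R}.

Definition iter_derive (f : V -> R^o) (s : seq V) : V -> R^o :=
  foldr (fun v g => fun x => 'D_v g x) f s.

(* C^infty on V: all iterated directional derivatives exist and are
   (Frechet) differentiable, hence continuous. *)
Definition smooth (f : V -> R) : Prop :=
  forall (s : seq V) (x : V), differentiable (iter_derive f s) x.

End smooth_functions.

Section polynomials.
Context {R : realType}.

(* A polynomial function on T in the coordinates [c : T -> R^N]. *)
Definition poly_in N (T : Type) (c : T -> 'rV[R]_N) (f : T -> R) : Prop :=
  exists p : mpoly.mpoly N R, forall t, f t = mpoly.meval (c t ord0) p.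

(* Equations are allowed too, being pairs of opposite inequalities. *)
Definition basic_semialgebraic n (A : set 'rV[R]_n) : Prop :=
  exists (N : nat) (g : 'I_N -> mpoly.mpoly n R),
    A = [set x | forall i, 0 <= mpoly.meval (x ord0) (g i)].

End polynomials.

Section domains.
Context {R : realType} {n : nat}.
Implicit Types (x e : 'rV[R]_n) (A : set 'rV[R]_n).

(* Near each of its boundary points A is the epigraph, in direction e, of a
   Lipschitz function of the component of x orthogonal to e. *)
Definition lipschitz_boundary A : Prop :=
  forall p, boundary A p ->
    exists (e : 'rV[R]_n) (gamma : 'rV[R]_n -> R^o) (r : R),
      [/\ enorm e = 1, 0 < r, lipschitz gamma
        & forall x, enorm (x - p) < r ->
            (A x <-> gamma (x - dotp x e *: e) <= dotp x e)].

(* [nu] is the unit vector at [x] for which the half-space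
   {z | (z - x).nu <= 0} is tangent to A at x. *)
Definition outward_unit_normal A x (nu : 'rV[R]_n) : Prop :=
  enorm nu = 1 /\
  forall eps : R, 0 < eps -> exists2 r : R, 0 < r &
    forall z, enorm (z - x) < r ->
      (dotp (z - x) nu < - eps * enorm (z - x) -> A z) /\
      (eps * enorm (z - x) < dotp (z - x) nu -> ~ A z).

(* A is contained, locally around each of its points, in a smooth embedded
   hypersurface {g = 0}, grad g <> 0.  Hence faces with edges and corners,
   such as those of a cube, are smooth. *)
Definition smooth_piece A : Prop :=
  forall p, A p -> exists (g : 'rV[R]_n -> R) (m : 'I_n) (r : R),
    [/\ smooth g, 'D_(bvec m) (g : _ -> R^o) p != 0, 0 < r
      & forall x, A x -> enorm (x - p) < r -> g x = 0].

End domains.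

Section sobolev.
Context {R : realType} {n : nat}.
Implicit Types (U : set 'rV[R]_n) (u g : 'rV[R]_n -> R).

Definition Linfty U u : Prop :=
  measurable_fun U u /\
  exists M : R, {ae leb n, forall x, U x -> `|u x| <= M}.

Definition test_function U (phi : 'rV[R]_n -> R) : Prop :=
  smooth phi /\ exists K : set 'rV[R]_n,
    [/\ compact K, K `<=` U & forall x, ~ K x -> phi x = 0].

Definition weak_partial U (m : 'I_n) u g : Prop :=
  forall phi, test_function U phi ->
    \int[leb n]_(x in U) (u x * 'D_(bvec m) (phi : _ -> R^o) x) =
    - \int[leb n]_(x in U) (g x * phi x).

(* u belongs to W^{1,oo}(U) and has the weak gradient du. *)
Definition W1infty U u (du : 'I_n -> 'rV[R]_n -> R) : Prop :=
  Linfty U u /\ forall m, Linfty U (du m) /\ weak_partial U m u (du m).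

End sobolev.

Record geometry (R : realType) (n nb : nat) := Geometry {
  Omega : set 'rV[R]_n;
  piece : 'I_nb -> set 'rV[R]_n;
  sigma : {finite_measure set 'rV[R]_n -> \bar R};
  eta : 'rV[R]_n -> 'rV[R]_n }.

Section geometry_axioms.
Context {R : realType} {n nb : nat} (D : geometry R n nb).
Local Notation Om := (Omega D).
Local Notation dOm := (boundary (Omega D)).

(* v is (a representative of) the boundary trace of u in W^{1,oo}(Om°): on a
   Lipschitz domain u has a representative w continuous up to the boundary. *)
Definition is_trace (u v : 'rV[R]_n -> R) : Prop :=
  exists w : 'rV[R]_n -> R,
    [/\ {within Om, continuous w},
        {ae leb n, forall x, Om° x -> u x = w x}
      & {ae sigma D, forall x, dOm x -> v x = w x}].

Record geometry_ok : Prop := GeometryOk {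
  Omega_semialgebraic : basic_semialgebraic Om;
  Omega_compact : compact Om;
  Omega_regular : closure Om° = Om;
  Omega_lipschitz : lipschitz_boundary Om;
  sigma_surface : forall A, measurable A ->
    sigma D A = hausdorff n.-1 (A `&` dOm);
  eta_measurable : measurable_fun dOm (eta D);
  eta_normal : {ae sigma D, forall x, dOm x -> outward_unit_normal Om x (eta D x)};
  gauss_green : forall (h : 'rV[R]_n -> R) (dh : 'I_n -> 'rV[R]_n -> R),
    {within Om, continuous h} -> W1infty Om° h dh ->
    forall m : 'I_n,
      \int[sigma D]_(x in dOm) (h x * eta D x ord0 m) =
      \int[leb n]_(x in Om) dh m x;
  piece_cover : dOm = \bigcup_i piece D i;
  piece_semialgebraic : forall i, basic_semialgebraic (piece D i);
  piece_smooth : forall i, smooth_piece (piece D i);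
  piece_disjoint : forall i j, i != j ->
    sigma D (piece D i `&` piece D j) = 0%E }.

End geometry_axioms.

(* [bcGp i] and [objLdp i] are the polynomials with which bcG and objLd coincide
   over the i-th boundary piece. *)
Record bvp (R : realType) (n ny nF nG nb : nat) := Bvp {
  pdeF : 'rV[R]_n * 'rV[R]_ny * 'M[R]_(ny, n) -> 'cV[R]_nF;
  pdeB : 'I_n -> 'I_n -> 'rV[R]_n * 'rV[R]_ny -> 'M[R]_(nF, ny);
  bcG : 'rV[R]_n * 'rV[R]_ny * 'M[R]_(ny, n) -> 'cV[R]_nG;
  bcGp : 'I_nb -> 'rV[R]_n * 'rV[R]_ny * 'M[R]_(ny, n) -> 'cV[R]_nG;
  objL : 'rV[R]_n * 'rV[R]_ny * 'M[R]_(ny, n) -> R;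
  objLd : 'rV[R]_n * 'rV[R]_ny * 'M[R]_(ny, n) -> R;
  objLdp : 'I_nb -> 'rV[R]_n * 'rV[R]_ny * 'M[R]_(ny, n) -> R;
  Yset : set 'rV[R]_ny;
  Zset : set 'M[R]_(ny, n) }.

Section problem.
Context {R : realType} {n ny nF nG nb : nat}.
Context (D : geometry R n nb) (P : bvp R n ny nF nG nb).
Local Notation Om := (Omega D).
Local Notation dOm := (boundary (Omega D)).
Local Notation XY := ('rV[R]_n * 'rV[R]_ny)%type.
Local Notation XYZ := ('rV[R]_n * 'rV[R]_ny * 'M[R]_(ny, n))%type.

Definition xyz_coord (t : XYZ) : 'rV[R]_(n + ny + ny * n) :=
  row_mx (row_mx t.1.1 t.1.2) (mxvec t.2).
Definition xy_coord (w : XY) : 'rV[R]_(n + ny) := row_mx w.1 w.2.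

Record bvp_ok : Prop := BvpOk {
  F_poly : forall a, poly_in xyz_coord (fun t => pdeF P t a ord0);
  B_poly : forall (i j : 'I_n) a b, (i <= j)%N ->
    poly_in xy_coord (fun w => pdeB P i j w a b);
  L_poly : poly_in xyz_coord (objL P);
  Gp_poly : forall i b, poly_in xyz_coord (fun t => bcGp P i t b ord0);
  Ldp_poly : forall i, poly_in xyz_coord (objLdp P i);
  G_piecewise : forall i, {ae sigma D, forall x, piece D i x ->
    forall y z, bcG P (x, y, z) = bcGp P i (x, y, z)};
  Ld_piecewise : forall i, {ae sigma D, forall x, piece D i x ->
    forall y z, objLd P (x, y, z) = objLdp P i (x, y, z)};
  Y_borel : measurable (Yset P);
  Z_borel : measurable (Zset P) }.

(** Solutions of the boundary value problem. *)

(* The case k = 2. *)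
Definition second_order : Prop :=
  exists (i j : 'I_n) (w : XY), (i <= j)%N /\ pdeB P i j w != 0.

(* [dy] is the weak Jacobian of y on the interior of Omega; its values on the
   boundary are the trace of the Jacobian if k = 2, and a bounded measurable
   function which is part of the solution if k = 1.  [d2y i j] is the second
   partial derivative of y in x_i and x_j; when k = 1 it is unconstrained, but
   then it is multiplied by pdeB P i j = 0.  Elements of L^oo are given by Borel
   representatives. *)
Record is_solution (y : 'rV[R]_n -> 'rV[R]_ny) (dy : 'rV[R]_n -> 'M[R]_(ny, n)) :
    Prop := IsSolution {
  sol_continuous : {within Om, continuous y};
  sol_W1 : forall l, W1infty Om° (fun x => y x ord0 l) (fun m x => dy x l m);
  sol_bd_measurable : measurable_fun dOm dy;
  sol_bd_bounded : exists M : R, forall x, dOm x -> `|dy x| <= M;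
  sol_bd_trace : second_order -> forall l m,
    is_trace D (fun x => dy x l m) (fun x => dy x l m);
  sol_equation : exists d2y : 'I_n -> 'I_n -> 'rV[R]_n -> 'cV[R]_ny,
    (second_order -> forall l i,
       W1infty Om° (fun x => dy x l i) (fun j x => d2y i j x l ord0)) /\
    {ae leb n, forall x, Om° x ->
       pdeF P (x, y x, dy x) +
         \sum_(i < n) \sum_(j < n | (i <= j)%N)
           pdeB P i j (x, y x) *m d2y i j x = 0};
  sol_boundary : {ae sigma D, forall x, dOm x -> bcG P (x, y x, dy x) = 0};
  sol_Y : forall x, Om x -> Yset P (y x);
  sol_Z : {ae leb n, forall x, Om x -> Zset P (dy x)};
  sol_bd_Z : {ae sigma D, forall x, dOm x -> Zset P (dy x)} }.

Definition cost (y : 'rV[R]_n -> 'rV[R]_ny) (dy : 'rV[R]_n -> 'M[R]_(ny, n)) : R :=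
  \int[leb n]_(x in Om) objL P (x, y x, dy x) +
  \int[sigma D]_(x in dOm) objLd P (x, y x, dy x).

Definition cost_values : set \bar R :=
  [set (cost s.1 s.2)%:E
    | s in [set s : ('rV[R]_n -> 'rV[R]_ny) * ('rV[R]_n -> 'M[R]_(ny, n)) |
        is_solution s.1 s.2]].

(* ereal_inf set0 = +oo and ereal_sup set0 = -oo. *)
Definition p_inf : \bar R := ereal_inf cost_values.
Definition p_sup : \bar R := ereal_sup cost_values.

(** The linear program over measures. *)

(* The total derivative of f(x, y(x)) in x_m, as a function of z = Dy(x). *)
Definition total_derive (W : normedModType R) (f : XY -> W) (m : 'I_n)
    (t : XYZ) : W :=
  'D_(bvec m, 0 : 'rV[R]_ny) f t.1 +
  \sum_(l < ny) t.2 l m *: 'D_(0 : 'rV[R]_n, bvec l) f t.1.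

Definition S0 : set XYZ := Om `*` Yset P `*` Zset P.
Definition Sd (k : 'I_nb) : set XYZ := piece D k `*` Yset P `*` Zset P.

Local Notation abs_conv mu S f := (mu.-integrable S (EFin \o f)).

(* Integrands of (a), (b), (c) for the test function phi. *)
Section integrands.
Variable phi : XY -> R.
Definition int_a m (t : XYZ) : R := total_derive (phi : _ -> R^o) m t.
Definition int_a_bd m (t : XYZ) : R := phi t.1 * eta D t.1.1 ord0 m.
Definition int_b_F (a : 'I_nF) (t : XYZ) : R := phi t.1 * pdeF P t a ord0.
Definition int_b_dB a i j (t : XYZ) : R :=
  phi t.1 * (total_derive (pdeB P i j) j t *m col i t.2) a ord0.
Definition int_b_dphi a i j (t : XYZ) : R :=
  total_derive (phi : _ -> R^o) j t * (pdeB P i j t.1 *m col i t.2) a ord0.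
Definition int_b_bd a i j (t : XYZ) : R :=
  (pdeB P i j t.1 *m col i t.2) a ord0 * phi t.1 * eta D t.1.1 ord0 j.
Definition int_c (k : 'I_nb) (b : 'I_nG) (t : XYZ) : R :=
  phi t.1 * bcGp P k t b ord0.
End integrands.

Section lp.
Variables (mu : {measure set XYZ -> \bar R})
  (mud : 'I_nb -> {measure set XYZ -> \bar R}).

Record lp_convergent : Prop := LpConvergent {
  conv_a : forall phi m, smooth phi -> abs_conv mu S0 (int_a phi m);
  conv_a_bd : forall phi m k, smooth phi ->
    abs_conv (mud k) (Sd k) (int_a_bd phi m);
  conv_b_F : forall phi a, smooth phi -> abs_conv mu S0 (int_b_F phi a);
  conv_b_dB : forall phi a (i j : 'I_n), smooth phi -> (i <= j)%N ->
    abs_conv mu S0 (int_b_dB phi a i j);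
  conv_b_dphi : forall phi a (i j : 'I_n), smooth phi -> (i <= j)%N ->
    abs_conv mu S0 (int_b_dphi phi a i j);
  conv_b_bd : forall phi a (i j : 'I_n) k, smooth phi -> (i <= j)%N ->
    abs_conv (mud k) (Sd k) (int_b_bd phi a i j);
  conv_c : forall phi k b, smooth phi ->
    abs_conv (mud k) (Sd k) (int_c phi k b);
  conv_d : forall (psi : 'rV[R]_n -> R) k, smooth psi ->
    abs_conv (mud k) (Sd k) (fun t : XYZ => psi t.1.1);
  conv_L : abs_conv mu S0 (objL P);
  conv_Ld : forall k, abs_conv (mud k) (Sd k) (objLdp P k) }.

Record lp_feasible : Prop := LpFeasible {
  mu_supported : mu (~` S0) = 0%E;
  mud_supported : forall k, mud k (~` Sd k) = 0%E;
  lp_conv : lp_convergent;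
  lp_a : forall phi (m : 'I_n), smooth phi ->
    \int[mu]_(t in S0) int_a phi m t
    - \sum_k \int[mud k]_(t in Sd k) int_a_bd phi m t = 0;
  lp_b : forall phi (a : 'I_nF), smooth phi ->
    \int[mu]_(t in S0) int_b_F phi a t
    - \sum_(i < n) \sum_(j < n | (i <= j)%N)
        \int[mu]_(t in S0) int_b_dB phi a i j t
    - \sum_(i < n) \sum_(j < n | (i <= j)%N)
        \int[mu]_(t in S0) int_b_dphi phi a i j t
    + \sum_(i < n) \sum_(j < n | (i <= j)%N)
        \sum_k \int[mud k]_(t in Sd k) int_b_bd phi a i j t = 0;
  lp_c : forall phi (b : 'I_nG), smooth phi ->
    \sum_k \int[mud k]_(t in Sd k) int_c phi k b t = 0;
  lp_d : forall (psi : 'rV[R]_n -> R) k, smooth psi ->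
    \int[mud k]_(t in Sd k) psi t.1.1 =
    \int[sigma D]_(x in piece D k) psi x }.

Definition lp_objective : R :=
  \int[mu]_(t in S0) objL P t + \sum_k \int[mud k]_(t in Sd k) objLdp P k t.

End lp.

Definition lp_values : set \bar R :=
  [set v | exists (mu : {measure set XYZ -> \bar R})
      (mud : 'I_nb -> {measure set XYZ -> \bar R}),
    lp_feasible mu mud /\ v = (lp_objective mu mud)%:E].

Definition lp_inf : \bar R := ereal_inf lp_values.
Definition lp_sup : \bar R := ereal_sup lp_values.

End problem.

(* Main.v *)
(* A solution y of the boundary value problem yields a feasible point of the LP
   with the same objective value: the occupation measures, that is the
   push-forwards of Lebesgue measure on Omega and of sigma on each boundary piece
   under x |-> (x, y x, Dy x).  Constraint (a) is the Gauss-Green formula for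
   phi (x, y x), and (b) is the equation integrated against phi (x, y x) after
   integrating phi * B_ij (x, y x) * dy/dx_i by parts in x_j.  Both rest on the
   chain rule for the weak gradient of Phi (x, u x) with Phi of class C^1 and u
   in W^{1,oo}, which is proved by mollifying u. *)
Require Import Defs.
From HB Require Import structures.
From mathcomp Require Import all_boot all_order all_algebra.
From mathcomp Require Import ring lra.
From mathcomp Require Import all_classical all_reals all_analysis.
From mathcomp Require Import measurable_realfun.
From mathcomp Require mpoly.
Set Implicit Arguments.
Unset Strict Implicit.
Unset Printing Implicit Defensive.
Import Order.TTheory GRing.Theory Num.Theory.
Import numFieldNormedType.Exports.
Local Open Scope classical_set_scope.
Local Open Scope ring_scope.

(** * Matrix-valued maps *)

(** The difficulty is low regularity. The gradient of [u] is only essentially bounded, so its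
    mollifications converge weakly, not pointwise. They occur only multiplied by factors continuous
    in [(x, u x)], and the mollifier, being self-adjoint, can be moved onto these factors. The chain
    rule itself is interior: a test function is supported in a compact [K] inside the open set, and
    radii smaller than the distance from [K] to the complement suffice.

    The boundary is met through [gauss_green]. It also shows that the boundary is Lebesgue null,
    which is needed because the linear program integrates over Omega, while the equation and the
    weak derivatives live on its interior.

    For (b), Gauss-Green asks for a function continuous up to the boundary, whereas the [i]-th
    column of the Jacobian is only a class modulo null sets. It is replaced by the continuous
    representative behind its trace and joined to [y] into one vector-valued function. *)

Section matrix_topology.
Context {R : realType}.

Lemma cvg_mx (T : Type) (F : set_system T) (FF : Filter F) m n (f : T -> 'M[R]_(m, n))
    (a : 'M[R]_(m, n)) :
  (forall i j, (fun x => f x i j) @ F --> (a i j : R)) -> f @ F --> a.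
Proof.
move=> fa; apply/cvgrPdist_lt => /= e e0.
near=> x.
rewrite /Num.Def.normr/= mx_normrE; apply: bigmax_lt => //= i _.
rewrite !mxE/=.
move: i; near: x; apply: filter_forall => /= i.
by have /cvgrPdist_lt := fa i.1 i.2; apply.
Unshelve. all: by end_near. Qed.

Lemma continuous_mx (T : topologicalType) m n (f : T -> 'M[R]_(m, n)) :
  (forall i j, continuous (fun x => f x i j : R)) -> continuous f.
Proof. by move=> fc x; apply: cvg_mx => i j; exact: fc. Qed.

Lemma continuous_pair (T U V : topologicalType) (f : T -> U) (g : T -> V) x :
  {for x, continuous f} -> {for x, continuous g} ->
  {for x, continuous (fun t => (f t, g t))}.
Proof. by move=> cf cg; apply: cvg_pair. Qed.

Lemma mx_coord_le m n (x : 'M[R]_(m, n)) i j : `|x i j| <= `|x|.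
Proof.
rewrite [leRHS]/Num.Def.normr/= mx_normrE.
exact: (le_bigmax _ (fun ij : 'I_m * 'I_n => `|x ij.1 ij.2|) (i, j)).
Qed.

Lemma mx_norm_le m n (x : 'M[R]_(m, n)) (r : R) : 0 <= r ->
  (forall i j, `|x i j| <= r) -> `|x| <= r.
Proof.
move=> r0 h; rewrite [leLHS]/Num.Def.normr/= mx_normrE.
by apply: bigmax_le => //= -[i j] _; exact: h.
Qed.

Lemma continuous_within_open (V W : topologicalType) (A U : set V) (f : V -> W) :
  open U -> U `<=` A -> {within A, continuous f} ->
  forall x, U x -> {for x, continuous f}.
Proof.
move=> oU UA fc x Ux.
have : {within U, continuous f} by exact: continuous_subspaceW fc.
by rewrite continuous_open_subspace // => /(_ x); rewrite inE; apply.
Qed.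

End matrix_topology.

Section matrix_measurable.
Context {R : realType}.

Lemma open_measurable_mx m n (U : set 'M[R]_(m, n)) : open U -> measurable U.
Proof. by move=> oU; exact: sub_sigma_algebra. Qed.

Lemma closed_measurable_mx m n (U : set 'M[R]_(m, n)) : closed U -> measurable U.
Proof.
move=> cU; rewrite -(setCK U); apply: measurableC; apply: open_measurable_mx.
exact: closed_openC.
Qed.

Lemma continuous_measurable_mx m n p q (f : 'M[R]_(m, n) -> 'M[R]_(p, q)) :
  continuous f -> measurable_fun setT f.
Proof.
move=> fc; apply: (measurability (@open 'M[R]_(p, q))) => // _ [U oU <-].
by rewrite setTI; apply: open_measurable_mx; move/continuousP: fc; apply.
Qed.

Lemma measurable_fun_open d (T : measurableType d) (D : set T) (f : T -> R) :
  (forall U, open U -> measurable (D `&` f @^-1` U)) -> measurable_fun D f.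
Proof.
move=> h; apply: (measurability _ (RGenOpens.measurableE R)).
by move=> _ [_ [a [b ->] <-]]; apply: h; exact: interval_open.
Qed.

Lemma continuous_measurable_mxR m n (f : 'M[R]_(m, n) -> R) :
  continuous f -> measurable_fun setT f.
Proof.
move=> fc; apply: measurable_fun_open => U oU.
by rewrite setTI; apply: open_measurable_mx; move/continuousP: fc; apply.
Qed.

Lemma within_continuous_measurable_mxR m n (A : set 'M[R]_(m, n)) (f : 'M[R]_(m, n) -> R) :
  measurable A -> {within A, continuous f} -> measurable_fun A f.
Proof.
move=> mA /continuousP fc; apply: measurable_fun_open => U oU.
have /open_subspaceP[V oV VD] := fc _ oU.
by rewrite setIC -VD; apply: measurableI => //; exact: open_measurable_mx.
Qed.

Lemma measurable_coord m n i j : measurable_fun setT (fun x : 'M[R]_(m, n) => x i j).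
Proof. by apply: continuous_measurable_mxR; exact: coord_continuous. Qed.

(** Rational sup-norm balls form a countable base, and the preimage of such a ball is a finite
    intersection of preimages under the coordinates. *)
Lemma measurable_fun_row d (T : measurableType d) n (D : set T) (f : T -> 'rV[R]_n) :
  (forall j, measurable_fun D (fun x => f x ord0 j)) -> measurable_fun D f.
Proof.
move=> mf mD; apply: (measurability (@open 'rV[R]_n)) => // _ [U oU <-].
rewrite (open_rat_ball oU) preimage_bigcup setI_bigcupr bigcup_mkcond.
apply: countable_bigcupT_measurable => [//|[q r]]; case: ifPn => // _ /=.
(* A matrix ball carries the clause that its radius is positive. For [n = 0] the coordinate
   conditions are void, so this clause alone makes balls of nonpositive radius empty. *)
have [r0|r0] := ltP 0 (ratr r : R); last first.
  rewrite (_ : _ `&` _ = set0)//; apply/seteqP; split=> // x [_ [r1 _]].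
  by move: r0; rewrite leNgt r1.
have -> : D `&` f @^-1` ball (map_mx ratr q : 'rV[R]_n) (ratr r) =
    D `&` \bigcap_(j in [set: 'I_n])
      (D `&` (fun x => f x ord0 j) @^-1` ball (ratr (q ord0 j) : R) (ratr r)).
  apply/seteqP; split=> x [Dx h]; split=> //.
    by move=> j _; split=> //; case: h => _ /(_ ord0 j); rewrite mxE.
  by split=> // i j; rewrite (ord1 i) mxE; have [] := h j Logic.I.
apply: measurableI => //; apply: fin_bigcap_measurable => // j _.
by apply: mf => //; rewrite ball_itv; exact: measurable_itv.
Qed.

Lemma continuous_vec_mx m n : continuous (@vec_mx R m n).
Proof.
apply: continuous_mx => i j x.
rewrite (_ : (fun _ => _) = (fun x : 'rV[R]_(m * n) => x ord0 (mxvec_index i j))).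
  exact: coord_continuous.
by apply/funext => y; rewrite mxE.
Qed.

Lemma measurable_fun_mx d (T : measurableType d) m n (D : set T) (f : T -> 'M[R]_(m, n)) :
  (forall i j, measurable_fun D (fun x => f x i j)) -> measurable_fun D f.
Proof.
move=> mf; rewrite (_ : f = vec_mx \o (mxvec \o f)); last first.
  by apply/funext => x /=; rewrite mxvecK.
apply: measurableT_comp; first by apply: continuous_measurable_mx; exact: continuous_vec_mx.
apply: measurable_fun_row => j; case/mxvec_indexP: j => i j /=.
by under eq_fun do rewrite mxvecE; exact: mf.
Qed.

Section xyz.
Context {n ny : nat}.
Local Notation XY := ('rV[R]_n * 'rV[R]_ny)%type.
Local Notation XYZ := ('rV[R]_n * 'rV[R]_ny * 'M[R]_(ny, n))%type.

Let inv (v : 'rV[R]_(n + ny + ny * n)) : XYZ :=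
  (lsubmx (lsubmx v), rsubmx (lsubmx v), vec_mx (rsubmx v)).

(** The domain carries the product of three Borel sigma-algebras, so openness of preimages does not
    directly give measurability. Factoring [f] through [xyz_coord] reduces the claim to row vectors,
    whose sigma-algebra is the Borel one. *)
Lemma continuous_measurable_xyz (f : XYZ -> R) :
  continuous f -> measurable_fun setT f.
Proof.
move=> fc; have -> : f = (f \o inv) \o xyz_coord.
  by apply/funext => -[[x y] z] /=; rewrite /inv /xyz_coord /= !(row_mxKl, row_mxKr) mxvecK.
apply: measurableT_comp.
  apply: continuous_measurable_mxR => v; apply: (@continuous_comp _ _ _ inv f); last exact: fc.
  have cl p q : continuous (@lsubmx R 1 p q) by move=> w; exact: continuous_lsubmx.
  have cr p q : continuous (@rsubmx R 1 p q) by move=> w; exact: continuous_rsubmx.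
  apply: (@continuous_pair _ _ _ (fun v => (lsubmx (lsubmx v), rsubmx (lsubmx v)))); last first.
    apply: (@continuous_comp _ _ _ rsubmx vec_mx); [exact: cr|exact: continuous_vec_mx].
  apply: continuous_pair.
    by apply: (@continuous_comp _ _ _ lsubmx lsubmx); exact: cl.
  by apply: (@continuous_comp _ _ _ lsubmx rsubmx); [exact: cl|exact: cr].
apply: measurable_fun_row => j; rewrite /xyz_coord.
have mx1 m p i k : measurable_fun setT (fun x : 'M[R]_(m, p) => x i k) by exact: measurable_coord.
case: (split_ordP j) => k ->; under eq_fun do rewrite ?(row_mxEl, row_mxEr).
  case: (split_ordP k) => l ->; under eq_fun do rewrite ?(row_mxEl, row_mxEr).
    apply: (measurableT_comp (mx1 _ _ _ _)).
    exact: (measurableT_comp measurable_fst measurable_fst).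
  apply: (measurableT_comp (mx1 _ _ _ _)).
  exact: (measurableT_comp measurable_snd measurable_fst).
case/mxvec_indexP: k => a b; under eq_fun do rewrite mxvecE.
by apply: (measurableT_comp (mx1 _ _ _ _)).
Qed.

End xyz.

End matrix_measurable.

Lemma measurable_fun_pair_on d1 d2 d3 (T : measurableType d1) (T1 : measurableType d2)
    (T2 : measurableType d3) (A : set T) (f : T -> T1) (g : T -> T2) :
  measurable A -> measurable_fun A f -> measurable_fun A g ->
  measurable_fun A (fun x => (f x, g x)).
Proof.
move=> mA mf mg; apply/(measurable_restrictT _ mA).
have -> : (fun x => (f x, g x)) \_ A = fun x => ((f \_ A) x, (g \_ A) x).
  by apply/funext => x; rewrite !patchE; case: ifP.
by apply: measurable_fun_pair; exact/(measurable_restrictT _ mA).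
Qed.

(** * Integration *)

Section almost_equal_integral.
Context {R : realType} d (T : measurableType d) (m : {measure set T -> \bar R}).
Import HBNNSimple.

(** Stated for arbitrary functions because the boundary cost [objLd] is only known to agree almost
    everywhere with polynomials and may fail to be measurable. *)
Lemma ge0_integral_eq_off_null (f g : T -> \bar R) (N : set T) : measurable N -> m N = 0%E ->
  (forall x, 0 <= f x)%E -> (forall x, 0 <= g x)%E -> (forall x, ~ N x -> f x = g x) ->
  (\int[m]_x f x = \int[m]_x g x)%E.
Proof.
move=> mN N0; suff L (u v : T -> \bar R) : (forall x, 0 <= u x)%E -> (forall x, 0 <= v x)%E ->
    (forall x, ~ N x -> u x = v x) -> (\int[m]_x u x <= \int[m]_x v x)%E.
  move=> f0 g0 fg; apply/eqP; rewrite eq_le; apply/andP; split; first exact: L.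
  by apply: L => // x /fg.
move=> u0 v0 uv; rewrite !ge0_integralTE//=; apply: ge_ereal_sup => _ [h hu <-].
have mTN : measurable ([set: T] `\` N) by exact: measurableD.
have -> : sintegral m h = sintegral m (proj_nnsfun h mTN).
  rewrite -mrestrict -integral_nnsfun// -(ge0_negligible_integral mN)//.
  - by rewrite integral_nnsfun// patch_setT.
  - exact/measurable_EFinP.
  - by move=> x _; rewrite lee_fin.
apply: ereal_sup_ubound; exists (proj_nnsfun h mTN) => //= x.
rewrite mindicE; case: (boolP (x \in _)) => [|_]; last by rewrite mulr0.
by rewrite inE mulr1 => -[_ Nx]; rewrite -uv.
Qed.

(* Integrals of arbitrary functions are suprema over simple functions, which may be
   restricted to the complement of the null set. *)
Lemma ae_eq_Rintegral (A : set T) (f g : T -> R) :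
  {ae m, forall x, A x -> f x = g x} -> \int[m]_(x in A) f x = \int[m]_(x in A) g x.
Proof.
move=> [N [mN N0 hN]]; have fg x : ~ N x -> ((fun x => (f x)%:E) \_ A) x = ((fun x => (g x)%:E) \_ A) x.
  move=> Nx; rewrite !patchE; case: ifPn => // /set_mem Ax /=; congr EFin.
  by apply: contrapT => h; apply: Nx; apply: hN => /= /(_ Ax).
congr fine; rewrite integral_mkcond [RHS]integral_mkcond integralE [RHS]integralE.
by congr (_ - _)%E; apply: (ge0_integral_eq_off_null mN N0) => // x Nx; rewrite ?funeposE ?funenegE fg.
Qed.

End almost_equal_integral.

Section integral_sum.
Context {R : realType} d (T : measurableType d) (m : {measure set T -> \bar R}) (A : set T)
  (mA : measurable A).

Lemma Rintegral_sum (I : Type) (s : seq I) (Q : pred I) (F : I -> T -> R) :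
  (forall i, Q i -> m.-integrable A (EFin \o F i)) ->
  m.-integrable A (EFin \o (fun x => \sum_(i <- s | Q i) F i x)) /\
  \int[m]_(x in A) (\sum_(i <- s | Q i) F i x) = \sum_(i <- s | Q i) \int[m]_(x in A) F i x.
Proof.
move=> iF; elim: s => [|i s [IH1 IH2]].
  rewrite big_nil (_ : (fun x => _) = fun=> 0); last by apply/funext => x; rewrite big_nil.
  by split; [exact: integrable0|rewrite /Rintegral integral0].
rewrite big_cons (_ : (fun x => _) = fun x => if Q i then F i x + \sum_(i <- s | Q i) F i x
    else \sum_(i <- s | Q i) F i x); last by apply/funext => x; rewrite big_cons.
case: (boolP (Q i)) => [Qi|_ //]; split; first exact: (integrableD mA (iF i Qi) IH1).
by rewrite RintegralD ?IH2//; exact: iF.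
Qed.

End integral_sum.

(** * Translation invariance of Lebesgue measure *)

Section lebesgue_translation.
Context {R : realType}.
Local Open Scope ereal_scope.

(** The image of Lebesgue measure under the shift gives every half-open interval its length, hence
    equals Lebesgue measure by uniqueness. *)
Lemma ge0_integral_lebesgue_shift (c : R) (f : R -> \bar R) :
  measurable_fun setT f -> (forall x, 0 <= f x) ->
  \int[lebesgue_measure]_x f (x + c)%R = \int[lebesgue_measure]_x f x.
Proof.
move=> mf f0.
have ms : measurable_fun setT (fun x : R => (x + c)%R).
  by apply: continuous_measurable_fun => x; apply: cvgD; [exact: cvg_id|exact: cvg_cst].
pose nu : {measure set (measurableTypeR R) -> \bar R} :=
    @push R _ _ (measurableTypeR R) (measurableTypeR R) lebesgue_measure _ ms.
have E A : measurable A -> lebesgue_measure A = nu A.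
  apply: lebesgue_measure_unique => _ [[a b] _ <-] /=.
  rewrite /nu /push /= /pushforward.
  have -> : (fun x : R => (x + c)%R) @^-1` `]a, b] = `](a - c)%R, (b - c)%R]%classic.
    by apply/seteqP; split=> x /=; rewrite !in_itv /= ltrBlDr lerBrDr.
  rewrite !lebesgue_measure_itv /= !lte_fin ltrBlDr subrK.
  case: ifPn => // _.
  by rewrite -!EFinD opprB addrA subrK.
rewrite [RHS](eq_measure_integral nu); last by move=> A mA _; exact: E.
by rewrite [RHS]ge0_integral_pushforward.
Qed.

End lebesgue_translation.

Lemma continuous_addr {R : realType} (V : normedModType R) (w : V) :
  continuous (fun x => x + w).
Proof. by move=> x; apply: cvgD; [exact: cvg_id|exact: cvg_cst]. Qed.

Section leb_cube.
Context {R : realType}.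

(** For nonnegative [r] this is the closed ball of the sup norm. The coordinatewise form makes its
    preimage under [rcons0] a product, as the recursive definition of [leb] requires. *)
Definition cube n (r : R) : set 'rV[R]_n := [set x | forall i, `|x ord0 i| <= r].

Lemma cube_measurable n r : measurable (@cube n r).
Proof.
have -> : @cube n r = \bigcap_(i in [set: 'I_n]) ((fun x : 'rV[R]_n => x ord0 i) @^-1` `[- r, r]).
  apply/seteqP; split=> x /= h i; first by move=> _ /=; rewrite in_itv/= -ler_norml.
  by have := h i Logic.I; rewrite /= in_itv/= -ler_norml.
apply: fin_bigcap_measurable => // i _; rewrite -[X in measurable X]setTI.
by apply: measurable_coord.
Qed.

Lemma cubeP n r x : (0 <= r)%R -> cube r x <-> `|x : 'rV[R]_n| <= r.
Proof.
move=> r0; split=> [h|h i]; last exact: (le_trans (mx_coord_le _ _ _)).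
by apply: mx_norm_le => // i j; rewrite (ord1 i).
Qed.

Lemma rcons0_rshift n (p : 'rV[R]_n * R) (i : 'I_n) :
  rcons0 p ord0 (rshift 1 i) = p.1 ord0 i.
Proof. exact: row_mxEr. Qed.

Lemma rcons0_lshift n (p : 'rV[R]_n * R) (i : 'I_1) :
  rcons0 p ord0 (lshift n i) = p.2.
Proof. by rewrite (ord1 i); apply: etrans (row_mxEl _ _ _ _) _; rewrite mxE. Qed.

Lemma leb_cube n r : (0 <= r)%R -> leb n (@cube n r) = (((r *+ 2) ^+ n)%:E).
Proof.
move=> r0; elim: n => [|n IH].
  by rewrite /= /cube diracE mem_set// => -[].
have -> : leb n.+1 (@cube n.+1 r) = (leb n \x lebesgue_measure)%E (@rcons0 R n @^-1` @cube n.+1 r) by [].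
have -> : @rcons0 R n @^-1` @cube n.+1 r = @cube n r `*` `[- r, r].
  apply/seteqP; split=> -[x t] /=.
    move=> h; split.
      move=> i; have := h (rshift 1 i).
      by rewrite rcons0_rshift.
    have := h (lshift n (ord0 : 'I_1)).
    by rewrite rcons0_lshift in_itv/= ler_norml.
  rewrite in_itv/= -ler_norml => -[h1 h2] i.
  case: (@split_ordP 1 n i) => k ->; first by rewrite rcons0_lshift.
  by rewrite rcons0_rshift; exact: h1.
rewrite product_measure1E//; last exact: cube_measurable.
rewrite [X in (X * _)%E]IH [X in (_ * X)%E]lebesgue_measure_itv /= lte_fin.
have [lt|ge] := ltP (- r) r.
  by rewrite opprK -EFinM exprSr mulr2n.
have -> : r = 0%R by apply/eqP; rewrite eq_le r0 andbT; move: ge; lra.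
by rewrite mule0 mul0rn expr0n.
Qed.

Lemma leb_sigma_finite n : sigma_finite setT (leb n : set 'rV[R]_n -> \bar R).
Proof.
exists (fun i => @cube n i%:R).
  apply/seteqP; split=> // x _; exists (Num.truncn `|x|).+1 => //=.
  by apply/cubeP => //; exact/ltW/truncnS_gt.
move=> i; split; first exact: cube_measurable.
by rewrite leb_cube// ltry.
Qed.

(* An alias of leb that can carry the sigma-finite structure required by Fubini. *)
Definition lebf n : set 'rV[R]_n -> \bar R := leb n.
HB.instance Definition _ n := Measure.on (@lebf n).
HB.instance Definition _ n :=
  Measure_isSigmaFinite.Build _ _ _ (@lebf n) (@leb_sigma_finite n).

Local Open Scope ereal_scope.

(** Induction on [n]: Tonelli separates the first coordinate, where invariance on the line applies,
    and the induction hypothesis treats the remaining ones. *)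
Lemma ge0_integral_leb_shift n (v : 'rV[R]_n) (f : 'rV[R]_n -> \bar R) :
  measurable_fun setT f -> (forall x, 0 <= f x) ->
  \int[leb n]_x f (x + v)%R = \int[leb n]_x f x.
Proof.
elim: n v f => [|n IH] v f mf f0.
  by apply: eq_integral => x _; rewrite (thinmx0 v) addr0.
have ms (w : 'rV[R]_n.+1) : measurable_fun setT (fun x : 'rV[R]_n.+1 => (x + w)%R).
  by apply: continuous_measurable_mx; exact: continuous_addr.
have E (g : 'rV[R]_n.+1 -> \bar R) : measurable_fun setT g -> (forall x, 0 <= g x) ->
   \int[leb n.+1]_x g x =
   \int[leb n]_p \int[lebesgue_measure]_t g (rcons0 (p, t)).
  move=> mg g0.
  rewrite [LHS]ge0_integral_pushforward//; last exact: rcons0_measurable.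
  apply: (@fubini_tonelli1 _ _ _ _ _ (@lebf n) lebesgue_measure (g \o @rcons0 R n)).
    by apply: measurableT_comp => //; exact: rcons0_measurable.
  by move=> x; exact: g0.
rewrite (E f mf f0) (E (fun x => f (x + v)%R)) => [||x]; [|exact: (measurableT_comp mf (ms v))|exact: f0].
pose v0 := v ord0 (lshift n (ord0 : 'I_1)); pose v1 : 'rV[R]_n := @rsubmx R 1 1 n v.
have vE p t : (rcons0 (p, t) + v)%R = rcons0 ((p + v1)%R, (t + v0)%R).
  apply/rowP => i; rewrite mxE.
  case: (@split_ordP 1 n i) => k ->; first by rewrite !rcons0_lshift (ord1 k).
  by rewrite !rcons0_rshift !mxE.
under eq_integral do under eq_integral do rewrite vE.
under eq_integral => p _.
  rewrite (@ge0_integral_lebesgue_shift _ v0 (fun t => f (rcons0 ((p + v1)%R, t)))).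
  2: { apply: measurableT_comp => //; apply: measurableT_comp; first exact: rcons0_measurable.
       exact: measurable_pair1. }
  2: by [].
  over.
rewrite (IH v1 (fun p => \int[lebesgue_measure]_t f (rcons0 (p, t))))//.
  apply: (@measurable_fun_fubini_tonelli_F _ _ _ _ _ lebesgue_measure (f \o @rcons0 R n)).
    by apply: measurableT_comp => //; exact: rcons0_measurable.
  by move=> x; exact: f0.
by move=> x; apply: integral_ge0 => t _; exact: f0.
Qed.

Lemma integral_leb_shift n (v : 'rV[R]_n) (f : 'rV[R]_n -> \bar R) :
  measurable_fun setT f ->
  \int[leb n]_x f (x + v)%R = \int[leb n]_x f x.
Proof.
move=> mf; rewrite [LHS]integralE [RHS]integralE.
have mp : measurable_fun setT (f^\+) by exact: measurable_funepos.
have mn : measurable_fun setT (f^\-) by exact: measurable_funeneg.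
have <- := ge0_integral_leb_shift v mp (funepos_ge0 f).
have <- := ge0_integral_leb_shift v mn (funeneg_ge0 f).
by have -> : (fun x => f (x + v)%R) = f \o (fun x => x + v)%R by []; rewrite funepos_comp funeneg_comp.
Qed.

End leb_cube.

(** * Smooth bumps and mollification *)

Section flat_functions.
Context {R : realType}.

(** The classical function exp(-1/t), extended by zero. The powers of 1/t are built in so that the
    linear span of the family is closed under differentiation. *)
Definition flat (k : nat) (t : R) : R := if 0 < t then t^-1 ^+ k * expR (- t^-1) else 0.

Lemma flat_ge0 k t : 0 <= flat k t.
Proof.
rewrite /flat; case: ifPn => // t0.
by rewrite mulr_ge0 ?expR_ge0// exprn_ge0// invr_ge0 ltW.
Qed.

Lemma flat_gt0 t : 0 < t -> 0 < flat 0 t.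
Proof. by move=> t0; rewrite /flat t0 mulr_gt0 ?expR_gt0// exprn_gt0// invr_gt0. Qed.

Lemma flat_le0 k t : t <= 0 -> flat k t = 0.
Proof. by move=> t0; rewrite /flat ltNge t0. Qed.

(** The term of degree [k + 2] of the exponential series at 1/t bounds exp(1/t) from below and beats
    the factor 1/t^k by two powers of [t]. A quadratic bound is what differentiability at 0
    needs. *)
Lemma flat_le_sqr k t : flat k t <= (k.+2)`!%:R * t ^+ 2.
Proof.
rewrite /flat; case: ifPn => t0; last by rewrite mulr_ge0// sqr_ge0.
have s0 : 0 < t^-1 by rewrite invr_gt0.
rewrite expRN ler_pdivrMr ?expR_gt0//.
apply: (@le_trans _ _ (k.+2`!%:R * t ^+ 2 * (t^-1 ^+ k.+2 / k.+2`!%:R))).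
  have f0 : k.+2`!%:R != 0 :> R by rewrite pnatr_eq0 -lt0n fact_gt0.
  have tn0 : t != 0 by rewrite gt_eqF.
  rewrite !exprS; set X := t^-1 ^+ k; set F := _%:R.
  rewrite (_ : _ * (_ / F) = X)//; field.
  by rewrite tn0 /F f0.
apply: ler_wpM2l; first by rewrite mulr_ge0 ?sqr_ge0.
apply: le_trans (expR_ge1Dxn k.+1 (ltW s0)).
by rewrite lerDr.
Qed.

Lemma is_derive_flat k (t : R) :
  is_derive t 1 (flat k : R -> R) (- k%:R * flat k.+1 t + flat k.+2 t).
Proof.
have [t0|t0|->] := ltgtP t 0.
- rewrite !flat_le0 ?ltW// mulr0 addr0.
  apply: (@near_eq_is_derive _ _ _ (cst 0)).
  near=> x; rewrite /flat ltNge (_ : x <= 0)//.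
  by apply: ltW; near: x; exact: lt_nbhsl.
- have tn0 : t != 0 by rewrite gt_eqF.
  have dV : is_derive t 1 (fun x : R => x^-1) (- (t ^- 2)).
    apply: is_derive_eq; first exact: (@is_deriveV _ id).
    by rewrite /GRing.scale/= mulr1.
  have dX : is_derive t 1 ((fun x : R => x^-1) ^+ k) (- k%:R * t^-1 ^+ k.+1).
    apply: is_derive_eq; rewrite /GRing.scale/=; case: k => [|k].
      by rewrite !mul0r oppr0 mul0r.
    by rewrite -exprVn expr2 [k.+1.-1]/= 2!exprS; ring.
  have dN : is_derive t 1 (fun x : R => - x^-1) (t^-1 ^+ 2).
    by apply: is_derive_eq; rewrite opprK exprVn.
  have dE : is_derive t 1 (expR \o (fun x : R => - x^-1)) (t^-1 ^+ 2 * expR (- t^-1)).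
    apply: is_derive_eq.
    by rewrite mulrC.
  apply: (@near_eq_is_derive _ _ _ (((fun x : R => x^-1) ^+ k) * (expR \o (fun x : R => - x^-1)))).
    near=> x; rewrite /flat ifT//; last by near: x; exact: lt_nbhsr.
    by rewrite fctE exprfctE.
  apply: is_derive_eq.
  by rewrite /GRing.scale/= exprfctE /flat t0 !exprS; ring.
- rewrite !flat_le0// mulr0 addr0.
  have E0 : h^-1 *: (flat k (h *: 1 + 0) - flat k 0) @[h --> 0^'] --> (0 : R).
    apply/cvgr0Pnorm_lt => e e0; near=> h.
    have hn0 : h != 0 by near: h; exact: nbhs_dnbhs_neq.
    rewrite [flat k 0]flat_le0// subr0 addr0 /GRing.scale/= mulr1 normrM (ger0_norm (flat_ge0 _ _)).
    apply: (@le_lt_trans _ _ (`|h|^-1 * (k.+2`!%:R * `|h| ^+ 2))).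
      by rewrite normfV ler_wpM2l ?invr_ge0// real_normK ?num_real// flat_le_sqr.
    rewrite expr2 mulrCA mulKf ?normr_eq0// mulrC -ltr_pdivlMr ?ltr0n ?fact_gt0//.
    near: h; apply: dnbhs0_lt; rewrite divr_gt0// ltr0n fact_gt0//.
  apply: DeriveDef; [by apply/cvg_ex; exists 0|exact/cvg_lim].
Unshelve. all: by end_near. Qed.

End flat_functions.

Section bumps.
Context {R : realType} {n : nat}.
Local Notation V := 'rV[R]_n.

(* This class is closed under directional derivatives, so its members are smooth. *)
Inductive flat_fun : (V -> R) -> Prop :=
| flat_fun_cst c : flat_fun (fun=> c)
| flat_fun_flat k s c i : flat_fun (fun x => flat k (c + s * x ord0 i))
| flat_funD f g : flat_fun f -> flat_fun g -> flat_fun (fun x => f x + g x)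
| flat_funM f g : flat_fun f -> flat_fun g -> flat_fun (fun x => f x * g x).

Lemma flat_fun_ext g f : f =1 g -> flat_fun g -> flat_fun f.
Proof. by move=> /funext ->. Qed.

Lemma is_derive_flat_affine k s c (i : 'I_n) (x v : V) :
  differentiable (fun x : V => flat k (c + s * x ord0 i) : R^o) x /\
  'D_v (fun x : V => flat k (c + s * x ord0 i) : R^o) x =
    (- k%:R * flat k.+1 (c + s * x ord0 i) + flat k.+2 (c + s * x ord0 i)) * (s * v ord0 i).
Proof.
pose a := fun x : V => (c + s * x ord0 i : R).
have da : differentiable a x.
  apply: differentiableD; first exact: differentiable_cst.
  apply: (@differentiableM _ _ (cst s) (fun x : V => x ord0 i)).
    exact: differentiable_cst.
  exact: differentiable_coord.
have Da : 'D_v a x = s * v ord0 i.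
  apply/cvg_lim => //; apply: cvg_near_cst; near=> h.
  rewrite /= /a !mxE /GRing.scale/=.
  have hn0 : h != 0 by near: h; exact: nbhs_dnbhs_neq.
  rewrite opprD addrACA subrr add0r -mulrBr addrK.
  by rewrite mulrCA mulKf.
have df : differentiable (flat k : R -> R^o) (a x).
  by apply/derivable1_diffP; case: (is_derive_flat k (a x)).
split; first exact: (@differentiable_comp _ _ _ _ a (flat k : R -> R^o)).
rewrite deriveE; last exact: (@differentiable_comp _ _ _ _ a (flat k : R -> R^o)).
rewrite (@diff_comp _ _ _ _ a (flat k : R -> R^o))//=.
have -> : 'd a x v = s * v ord0 i by rewrite -deriveE.
have [_] := is_derive_flat k (a x); rewrite deriveE// => E.
rewrite -[X in 'd _ _ X](_ : (s * v ord0 i) *: (1 : R^o) = _); last exact: mulr1.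
by rewrite linearZ/= E /GRing.scale/= mulrC.
Unshelve. all: by end_near. Qed.

Lemma flat_fun_derive f : flat_fun f ->
  (forall x, differentiable (f : V -> R^o) x) /\
  forall v, flat_fun (fun x => 'D_v (f : V -> R^o) x).
Proof.
elim=> {f} [c|k s c i|f g ff [df Df] fg [dg Dg]|f g ff [df Df] fg [dg Dg]].
- split=> [x|v]; first exact: differentiable_cst.
  have -> : (fun x => 'D_v (fun=> c : R^o) x) = (fun=> 0 : R).
    by apply/funext => x; exact: derive_cst.
  exact: flat_fun_cst.
- split=> [x|v]; first exact: (is_derive_flat_affine k s c i x 0).1.
  apply: flat_fun_ext (fun x => (is_derive_flat_affine k s c i x v).2) _.
  have F j : flat_fun (fun x => flat j (c + s * x ord0 i)) by exact: flat_fun_flat.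
  have C r : flat_fun (fun=> r) by exact: flat_fun_cst.
  exact: (flat_funM (flat_funD (flat_funM (C _) (F _)) (F _)) (C _)).
- split=> [x|v]; first exact: differentiableD.
  apply: flat_fun_ext (flat_funD (Df v) (Dg v)) => x.
  by apply: deriveD; exact: diff_derivable.
- split=> [x|v]; first exact: differentiableM.
  apply: flat_fun_ext (flat_funD (flat_funM ff (Dg v)) (flat_funM fg (Df v))) => x.
  by apply: deriveM; exact: diff_derivable.
Qed.

Lemma flat_fun_smooth f : flat_fun f -> smooth f.
Proof.
move=> ff s x.
have : flat_fun (iter_derive f s).
  by elim: s => [|v s IH]//=; exact: (flat_fun_derive IH).2.
by move/flat_fun_derive => [].
Qed.

(** As a product over coordinates it is positive exactly where every coordinate of [x - z] is
    smaller than [e] in absolute value. It is left unnormalised; [moll] divides by its integral. *)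
Definition flat_bump (e : R) (z x : V) : R :=
  \prod_(i < n) (flat 0 (e - (x ord0 i - z ord0 i)) * flat 0 (e + (x ord0 i - z ord0 i))).

Lemma bump_flat_fun e z : flat_fun (flat_bump e z).
Proof.
rewrite /flat_bump; elim: (index_enum _) => [|i s IH].
  by under eq_fun do rewrite big_nil; exact: flat_fun_cst.
under eq_fun do rewrite big_cons; apply: (flat_funM (f := fun x => flat _ _ * _)) IH; apply: flat_funM.
  apply: flat_fun_ext (flat_fun_flat 0 (-1) (e + z ord0 i) i) => x.
  by congr flat; ring.
apply: flat_fun_ext (flat_fun_flat 0 1 (e - z ord0 i) i) => x.
by congr flat; ring.
Qed.

Lemma bump_smooth e z : smooth (flat_bump e z).
Proof. exact/flat_fun_smooth/bump_flat_fun. Qed.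

Lemma bump_ge0 e z x : 0 <= flat_bump e z x.
Proof. by apply: prodr_ge0 => i _; rewrite mulr_ge0// flat_ge0. Qed.

Lemma bump_translate e z x : flat_bump e z x = flat_bump e 0 (x - z).
Proof. by apply: eq_bigr => i _; rewrite !mxE subr0. Qed.

(** Exchanging [z] and [x] swaps the two factors in each coordinate. This symmetry makes
    mollification self-adjoint. *)
Lemma bump_sym e z x : flat_bump e z x = flat_bump e x z.
Proof.
apply: eq_bigr => i _; rewrite mulrC -(opprB (x ord0 i)) opprK.
by [].
Qed.

Lemma bump_eq0 e z x : ~ cube e (x - z) -> flat_bump e z x = 0.
Proof.
move=> /existsNP[i] /negP; rewrite !mxE -ltNge => h.
rewrite /flat_bump (bigD1 i)//= (_ : _ * flat _ _ = 0) ?mul0r//.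
move: h; rewrite ltr_normr => /orP[h|h].
  by rewrite flat_le0 ?mul0r//; lra.
by rewrite [X in _ * X]flat_le0 ?mulr0//; lra.
Qed.

(** On the half-size cube both arguments of [flat 0] are at least [e / 2], and [flat 0] is
    increasing on the positive reals. The bound yields a positive total mass. *)
Lemma bump_ge (e : R) z x : 0 < e -> cube (e / 2) (x - z) ->
  (flat 0 (e / 2) ^+ 2) ^+ n <= flat_bump e z x.
Proof.
move=> e0 h; rewrite /flat_bump -[in leLHS](card_ord n) -prodr_const.
have mono (s t : R) : 0 < s -> s <= t -> flat 0 s <= flat 0 t.
  move=> s0 st; rewrite /flat s0 (lt_le_trans s0 st) !expr0 !mul1r ler_expR lerN2.
  by rewrite lef_pV2// posrE// (lt_le_trans s0 st).
apply: ler_prod => i _; rewrite sqr_ge0/= expr2.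
have := h i; rewrite !mxE ler_norml => /andP[h1 h2].
by apply: ler_pM => //; rewrite ?flat_ge0//; apply: mono; lra.
Qed.

End bumps.

Section lines.
Context {R : realType} {V W : normedModType R}.

(** Both difference quotients are the same function of [h]. Passing to one real variable makes
    differentiation under the integral sign available for directional derivatives. *)
Lemma is_derive_line (f : V -> W) (x v : V) (l : R) (df : W) :
  is_derive (x + l *: v) v f df <-> is_derive l 1 (fun s : R => f (x + s *: v)) df.
Proof.
have E : (fun h : R => h^-1 *: ((f \o shift (x + l *: v)) (h *: v) - f (x + l *: v))) =
   (fun h : R => h^-1 *: (((fun s : R => f (x + s *: v)) \o shift l) (h *: (1 : R)) - f (x + l *: v))).
  apply/funext => h /=; congr (_ *: (f _ - _)).
  have -> : h *: (1 : R) = h by exact: mulr1.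
  by rewrite scalerDl addrCA.
split=> -[d1 d2]; apply: DeriveDef.
- by move: d1; rewrite /derivable E.
- by rewrite -d2 /derive E.
- by rewrite /derivable E.
- by rewrite -d2 /derive E.
Qed.

End lines.

(** * Bounded functions of bounded support and their integrals *)

Section bounded_functions.
Context {R : realType} {n : nat}.
Local Notation V := 'rV[R]_n.
Implicit Types f g : V -> R.

(** The class in which mollification is carried out: it is stable under sums, products and
    mollification, and its members are integrable. *)
Definition bfun f := measurable_fun setT f /\
  exists M r : R, [/\ 0 <= M, 0 <= r, forall x, `|f x| <= M & forall x, ~ cube r x -> f x = 0].

Lemma integrable_cube f (M r : R) : 0 <= r -> measurable_fun setT f ->
  (forall x, `|f x| <= M) -> (forall x, ~ cube r x -> f x = 0) ->
  (leb n).-integrable setT (EFin \o f).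
Proof.
move=> r0 mf fM fr.
have -> : EFin \o f = (EFin \o f) \_ (cube r).
  apply/funext => x; rewrite patchE; case: ifPn => // /negP xr /=.
  by rewrite fr// => /mem_set.
have mc : measurable (@cube R n r) by exact: cube_measurable.
apply/(integrable_mkcond _ mc); apply: measurable_bounded_integrable => //.
- by rewrite [X in (X < _)%E]leb_cube// ltry.
- exact: measurable_funTS.
- exists M; split; first exact: num_real.
  by move=> N MN x _ /=; exact: le_trans (fM x) (ltW MN).
Qed.

Lemma bfun_integrable f : bfun f -> (leb n).-integrable setT (EFin \o f).
Proof. by move=> [mf [M [r [M0 r0 fM fr]]]]; exact: (integrable_cube r0 mf fM fr). Qed.

Lemma cube_le (r s : R) (x : V) : r <= s -> cube r x -> cube s x.
Proof. by move=> rs rx i; exact: le_trans (rx i) rs. Qed.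

Lemma bfunD f g : bfun f -> bfun g -> bfun (fun x => f x + g x).
Proof.
move=> [mf [M [r [M0 r0 fM fr]]]] [mg [N [s [N0 s0 gN gs]]]].
split; first exact: measurable_funD.
exists (M + N), (Num.max r s); split.
- exact: addr_ge0.
- by rewrite le_max r0.
- by move=> x; apply: le_trans (ler_normD _ _) _; exact: lerD.
- move=> x h; rewrite fr ?gs ?addr0//; apply: contra_not h; apply: cube_le; rewrite le_max lexx ?orbT//.
Qed.

Lemma bfunMl f g : bfun f -> measurable_fun setT g ->
  (exists N : R, forall x, `|g x| <= N) -> bfun (fun x => g x * f x).
Proof.
move=> [mf [M [r [M0 r0 fM fr]]]] mg [N gN].
split; first exact: measurable_funM.
have N0 : 0 <= N by exact: le_trans (gN 0).
exists (N * M), r; split => //.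
- exact: mulr_ge0.
- by move=> x; rewrite normrM; exact: ler_pM.
- by move=> x h; rewrite fr ?mulr0.
Qed.

Lemma bfunM f g : bfun f -> bfun g -> bfun (fun x => g x * f x).
Proof.
move=> bf [mg [N [s [N0 s0 gN gs]]]]; apply: bfunMl => //.
by exists N.
Qed.

Lemma bfun_sum (I : Type) (s : seq I) (F : I -> V -> R) :
  (forall i, bfun (F i)) -> bfun (fun x => \sum_(i <- s) F i x).
Proof.
move=> bF; elim: s => [|i s IH].
  under eq_fun do rewrite big_nil; split; first exact: measurable_cst.
  by exists 0, 0; split => // x; rewrite normr0.
by under eq_fun do rewrite big_cons; exact: bfunD.
Qed.

Lemma Rintegral_bfun_sum (I : Type) (s : seq I) (F : I -> V -> R) :
  (forall i, bfun (F i)) ->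
  \int[leb n]_x (\sum_(i <- s) F i x) = \sum_(i <- s) \int[leb n]_x F i x.
Proof.
move=> bF.
by apply: (@Rintegral_sum _ _ _ (leb n) setT measurableT _ s xpredT F _).2 => i _; exact: bfun_integrable.
Qed.

Lemma bounded_convergence (f_ : nat -> V -> R) f (M r : R) : 0 <= M -> 0 <= r ->
  (forall k, measurable_fun setT (f_ k)) ->
  (forall k x, `|f_ k x| <= M) -> (forall k x, ~ cube r x -> f_ k x = 0) ->
  (forall x, f_ k x @[k --> \oo] --> f x) ->
  \int[leb n]_x f_ k x @[k --> \oo] --> \int[leb n]_x f x.
Proof.
move=> M0 r0 mf fM fr fc.
have mcst : measurable_fun setT (fun x : V => M * \1_(cube r) x).
  by apply: measurable_funM => //; apply: measurable_indic; exact: cube_measurable.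
have int_ k : (leb n).-integrable setT (EFin \o f_ k) by exact: (integrable_cube r0 (mf k) (fM k) (fr k)).
have mfl : measurable_fun setT f.
  by apply: (@measurable_fun_cvg _ _ _ setT f_) => // x _; exact: fc.
have flM x : `|f x| <= M.
  have c : `|f_ k x| @[k --> \oo] --> `|f x| by exact: cvg_norm.
  rewrite -(cvg_lim _ c)//.
  by apply: limr_le; [exact: (cvgP _ c)|exact: nearW].
have flr x : ~ cube r x -> f x = 0.
  move=> xr; rewrite -(cvg_lim _ (fc x))//.
  by under eq_fun do rewrite fr//; exact: lim_cst.
have intf : (leb n).-integrable setT (EFin \o f) by exact: (integrable_cube r0 mfl flM flr).
apply: fine_cvg; rewrite fineK; last exact: integrable_fin_num.
apply: (@dominated_cvg _ _ _ _ _ _ _ _ (fun x => (M * \1_(cube r) x)%:E)) => //.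
- by move=> k; apply/measurable_EFinP.
- by move=> x _; apply: cvg_EFin; [exact: nearW|exact: fc].
- apply: (@integrable_cube _ M r) => // x.
    by rewrite indicE; case: (_ \in _); rewrite /= ?mulr1 ?mulr0 ?normr0 ?ger0_norm.
  by move=> xr; rewrite indicE memNset// mulr0.
- move=> k x _ /=; rewrite lee_fin.
  have [xr|xr] := pselect (cube r x); first by rewrite indicE mem_set// mulr1.
  by rewrite fr// normr0 mulr_ge0.
Qed.

Lemma Rintegral_leb_shift (v : V) f : measurable_fun setT f ->
  \int[leb n]_x f (x + v) = \int[leb n]_x f x.
Proof.
by move=> mf; congr fine; apply: (@integral_leb_shift _ _ v (EFin \o f)); exact/measurable_EFinP.
Qed.

(** By translation invariance the integral of [f (x + l *: v)] does not depend on [l];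
    differentiating under the integral at [l = 0] gives the claim. Applied to a product, this is
    integration by parts. *)
Lemma Rintegral_directional_derive (f df : V -> R) (v : V) (M r : R) :
  bfun f -> (forall x, is_derive x v (f : V -> R^o) (df x)) ->
  (forall x, `|df x| <= M) -> 0 <= r -> (forall x, ~ cube r x -> df x = 0) ->
  \int[leb n]_x df x = 0.
Proof.
move=> bf fdf dfM r0 dfr.
have [mf [B [s [B0 s0 fB fs]]]] := bf.
have M0 : 0 <= M by exact: le_trans (dfM 0).
pose F (l : R) (x : V) := f (x + l *: v).
have dF (l : R) (x : V) : is_derive l 1 (F ^~ x : R -> R^o) (df (x + l *: v)).
  exact/(is_derive_line (f : V -> R^o)).
have pF (l : R) (x : V) : partial1of2 F l x = df (x + l *: v).
  by rewrite partial1of2E; case: (dF l x).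
have mcst t : measurable_fun setT (fun x : V => M * \1_(cube t) x).
  by apply: measurable_funM => //; apply: measurable_indic; exact: cube_measurable.
have mF l : measurable_fun setT (F l).
  apply: measurableT_comp => //; apply: continuous_measurable_mx; exact: continuous_addr.
(* For |l| < 1 the shifted supports stay in one cube enlarged by the norm of [v], which gives a
   dominating function independent of [l]. *)
have cubeD (l : R) (x : V) (t : R) : - 1 < l < 1 -> cube t (x + l *: v) -> cube (t + `|v|) x.
  move=> l1 h i; have := h i; rewrite !mxE => {}h.
  rewrite -(addrK (l * v ord0 i) (x ord0 i)).
  apply: le_trans (ler_normB _ _) _; apply: lerD => //.
  rewrite normrM; apply: le_trans (mx_coord_le v ord0 i).
  by rewrite ler_piMl// ltW// ltr_norml.
have := @cvg_differentiation_under_integral R _ _ (leb n) F setT measurableT 0 (-1) 1 _ _ _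
  (fun x => M * \1_(cube (r + `|v|)) x) _ _ _.
have /[swap]/[apply] : `]-1, 1[%classic (0 : R) by rewrite /= in_itv/= ltr01 ltrN10.
have /[swap]/[apply] : forall x, `]-1, 1[%classic x -> (leb n).-integrable setT (EFin \o F x).
  move=> l; rewrite /= in_itv/= => l1.
  apply: (@integrable_cube _ B (s + `|v|)) => //; [exact: addr_ge0|by move=> x; exact: fB|].
  by move=> x h; rewrite /F fs//; apply: contra_not h; exact: cubeD.
have /[swap]/[apply] : forall (l : R) (x : V), `]-1, 1[%classic l -> setT x -> derivable (F ^~ x) l 1.
  by move=> l x _ _; case: (dF l x).
have /[swap]/[apply] : forall x : V, 0 <= M * \1_(cube (r + `|v|)) x.
  by move=> x; rewrite mulr_ge0.
have /[swap]/[apply] : (leb n).-integrable setT (EFin \o (fun x : V => M * \1_(cube (r + `|v|)) x)).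
  apply: (@integrable_cube _ M (r + `|v|)) => //; first exact: addr_ge0.
    by move=> x; rewrite indicE; case: (_ \in _); rewrite /= ?mulr1 ?mulr0 ?normr0 ?ger0_norm.
  by move=> x xr; rewrite indicE memNset// mulr0.
have /[swap]/[apply] : forall (l : R) (x : V), `]-1, 1[%classic l -> setT x ->
    `|partial1of2 F l x| <= M * \1_(cube (r + `|v|)) x.
  move=> l x; rewrite /= in_itv/= => l1 _; rewrite pF.
  have [xr|xr] := pselect (cube (r + `|v|) x); first by rewrite indicE mem_set// mulr1.
  by rewrite dfr ?normr0 ?mulr_ge0//; apply: contra_not xr; exact: cubeD.
have -> : \int[leb n]_x partial1of2 F 0 x = \int[leb n]_x df x.
  by apply: eq_Rintegral => x _; rewrite pF scale0r addr0.
(* The difference quotients of the parameter integral are identically zero, so their limit is zero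
   as well. *)
move=> c; rewrite -(cvg_lim _ c)//; apply/cvg_lim => //; apply: cvg_near_cst; near=> h.
by rewrite /F !Rintegral_leb_shift// subrr scaler0.
Unshelve. all: by end_near. Qed.

End bounded_functions.

Section product_integrals.
Context {R : realType} {n : nat}.
Local Notation V := 'rV[R]_n.

Variables (k : V * V -> R) (M s r : R).
Hypotheses (mk : measurable_fun setT k) (s0 : 0 <= s) (r0 : 0 <= r)
  (kM : forall w, `|k w| <= M)
  (k0 : forall z x, ~ (cube s z /\ cube r x) -> k (z, x) = 0).

Let mc t : measurable (@cube R n t). Proof. exact: cube_measurable. Qed.

Lemma integrable_cube2 : (@lebf R n \x @lebf R n)%E.-integrable setT (EFin \o k).
Proof.
have -> : EFin \o k = (EFin \o k) \_ (cube s `*` cube r).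
  apply/funext => -[z x]; rewrite patchE; case: ifPn => // /negP zx /=.
  by rewrite k0// => /mem_set.
have mm : measurable (@cube R n s `*` @cube R n r) by exact: measurableX.
apply/(integrable_mkcond _ mm); apply: measurable_bounded_integrable => //.
- rewrite /= product_measure1E//.
  by rewrite [X in (X * _)%E]leb_cube// [X in (_ * X)%E]leb_cube// -EFinM ltry.
- exact: measurable_funTS.
- exists M; split; first exact: num_real.
  by move=> N MN x _ /=; exact: le_trans (kM x) (ltW MN).
Qed.

Let int1 z : (leb n).-integrable setT (fun x : V => (k (z, x))%:E).
Proof.
apply: (@integrable_cube _ _ _ M r) => //.
  exact: (measurableT_comp mk (measurable_pair1 _)).
by move=> x xr; apply: k0 => -[].
Qed.

Let int2 x : (leb n).-integrable setT (fun z : V => (k (z, x))%:E).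
Proof.
apply: (@integrable_cube _ _ _ M s) => //.
  exact: (measurableT_comp mk (measurable_pair2 _)).
by move=> z zr; apply: k0 => -[].
Qed.

Lemma measurable_Rintegral2 : measurable_fun setT (fun z => \int[leb n]_x k (z, x)).
Proof. exact: measurableT_comp (measurable_fubini_F integrable_cube2). Qed.

Lemma Rintegral_exchange :
  \int[leb n]_z \int[leb n]_x k (z, x) = \int[leb n]_x \int[leb n]_z k (z, x).
Proof.
have := Fubini integrable_cube2; rewrite /Rintegral => E; congr fine.
transitivity (\int[lebf (n := n)]_x \int[lebf (n:=n)]_y (EFin \o k) (x, y))%E.
  by apply: eq_integral => z _; rewrite fineK//; exact: (integrable_fin_num _ (int1 z)).
rewrite E; apply: eq_integral => x _; rewrite fineK//; exact: (integrable_fin_num _ (int2 x)).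
Qed.

End product_integrals.

(** * Mollification: bounds, adjointness, convergence *)

Section mollifier.
Context {R : realType} {n : nat}.
Local Notation V := 'rV[R]_n.
Implicit Types (f g : V -> R) (e : R).

Lemma cube_compact r : compact (@cube R n r).
Proof.
have -> : @cube R n r = [set v : 'rV[R]_n | forall i, `[- r, r]%classic (v ord0 i)].
  by apply/seteqP; split=> x /= h i; have := h i; rewrite /= in_itv/= -ler_norml.
by apply: (@rV_compact _ n (fun=> `[- r, r]%classic)) => _; exact: segment_compact.
Qed.

Lemma continuous_bounded (T : topologicalType) (K : set T) (f : T -> R) :
  compact K -> {within K, continuous f} -> exists M : R, forall x, K x -> `|f x| <= M.
Proof.
move=> cK cf; have : compact (f @` K) by exact: continuous_compact.
move=> /compact_bounded[M [_ h]]; exists (M + 1) => x Kx.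
by apply: h; [rewrite ltrDl|exists x].
Qed.

Lemma bfun_continuous f r : 0 <= r -> continuous f -> (forall x, ~ cube r x -> f x = 0) -> bfun f.
Proof.
move=> r0 cf fr; split; first exact: continuous_measurable_mxR.
have [M h] := continuous_bounded (@cube_compact r) (continuous_subspaceT cf).
exists `|M|, r; split => // x; have [xr|xr] := pselect (cube r x).
  exact: le_trans (h _ xr) (ler_norm _).
by rewrite fr// normr0.
Qed.

Lemma flat_fun_continuous f : flat_fun f -> continuous f.
Proof. by move=> /flat_fun_derive[df _] x; exact: differentiable_continuous. Qed.

Lemma cube_shift e (z x : V) : cube e (x - z) -> cube (e + `|z|) x.
Proof.
move=> h i; have := h i; rewrite !mxE => {}h.
rewrite -(subrK (z ord0 i) (x ord0 i)); apply: le_trans (ler_normD _ _) _.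
by apply: lerD => //; exact: mx_coord_le.
Qed.

Lemma bump_bfun e z : 0 <= e -> bfun (flat_bump e z : V -> R).
Proof.
move=> e0; apply: (@bfun_continuous _ (e + `|z|)); first exact: addr_ge0.
  exact/flat_fun_continuous/bump_flat_fun.
by move=> x h; apply: bump_eq0; apply: contra_not h; exact: cube_shift.
Qed.

Definition bump_mass e : R := \int[leb n]_x flat_bump e 0 x.

Lemma bump_massE e z : 0 <= e -> \int[leb n]_x flat_bump e z x = bump_mass e.
Proof.
move=> e0; rewrite /bump_mass -[RHS](Rintegral_leb_shift (- z)).
  by apply: eq_Rintegral => x _; rewrite bump_translate.
by have [] := bump_bfun 0 e0.
Qed.

Lemma bump_mass_gt0 e : 0 < e -> 0 < bump_mass e.
Proof.
move=> e0; set c := (flat 0 (e / 2) ^+ 2) ^+ n.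
have c0 : 0 < c by rewrite !exprn_gt0// flat_gt0// divr_gt0.
have e20 : 0 <= e / 2 by rewrite ltW// divr_gt0.
have mc : measurable (@cube R n (e / 2)) by exact: cube_measurable.
apply: (@lt_le_trans _ _ (c * (e / 2 *+ 2) ^+ n)).
  by rewrite mulr_gt0// exprn_gt0// mulrn_wgt0// divr_gt0.
have -> : c * (e / 2 *+ 2) ^+ n = \int[leb n]_(x in cube (e / 2)) c.
  by rewrite Rintegral_cst// [X in fine X]leb_cube.
rewrite Rintegral_mkcond; apply: le_Rintegral => //.
- apply: (@integrable_cube _ _ _ c (e / 2)) => //.
  + by apply/(measurable_restrictT _ mc); exact: measurable_cst.
  + by move=> x; rewrite patchE; case: ifP => _; rewrite ?normr0 ?gtr0_norm// ltW.
  + by move=> x xr; rewrite patchE memNset.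
- by apply: bfun_integrable; apply: bump_bfun; exact: ltW.
- move=> x _; rewrite patchE; case: ifPn => [|_]; last exact: bump_ge0.
  by rewrite inE => xe; apply: bump_ge => //; rewrite subr0.
Qed.

Definition moll e f (z : V) : R := (bump_mass e)^-1 * \int[leb n]_x (f x * flat_bump e z x).

Lemma moll_const e c z : 0 < e -> (bump_mass e)^-1 * \int[leb n]_x (c * flat_bump e z x) = c.
Proof.
move=> e0; rewrite RintegralZl//; last first.
  by apply: bfun_integrable; apply: bump_bfun; exact: ltW.
by rewrite bump_massE ?ltW// mulrCA mulVf ?mulr1// gt_eqF// bump_mass_gt0.
Qed.

Lemma bfunM_bump e f z : 0 < e -> bfun f -> bfun (fun x => f x * flat_bump e z x).
Proof. by move=> e0 bf; apply: bfunM => //; apply: bump_bfun; exact: ltW. Qed.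

(** Mollification averages with nonnegative weights of total mass one over the cube about [z], and
    the constants [c] and [eta] are their own averages. The case [c = 0] gives the sup bound, the
    case [c = f z] convergence at points of continuity. *)
Lemma moll_dist e f z c eta : 0 < e -> bfun f ->
  (forall x, cube e (x - z) -> `|f x - c| <= eta) -> `|moll e f z - c| <= eta.
Proof.
move=> e0 bf h.
have c0 := bump_mass_gt0 e0.
have bc a : bfun (fun x : V => a * flat_bump e z x).
  apply: bfunMl; first by apply: bump_bfun; exact: ltW.
    exact: measurable_cst.
  by exists `|a|.
rewrite -[X in _ - X](moll_const c z e0) /moll -mulrBr.
rewrite -RintegralB//; [|by apply: bfun_integrable; exact: bfunM_bump|exact: bfun_integrable].
rewrite normrM gtr0_norm ?invr_gt0//.
rewrite -[leRHS](moll_const eta z e0); apply: ler_wpM2l; first by rewrite invr_ge0 ltW.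
have bd : bfun (fun x => f x * flat_bump e z x - c * flat_bump e z x).
  under eq_fun do rewrite -mulNr; apply: bfunD => //; exact: bfunM_bump.
apply: le_trans (le_normr_Rintegral _ _) _ => //; first exact: bfun_integrable.
apply: le_Rintegral => //.
- by have := integrable_norm (bfun_integrable bd); apply: eq_integrable => // x _.
- exact: bfun_integrable.
- move=> x _; rewrite -mulrBl normrM (ger0_norm (bump_ge0 _ _ _)).
  have [xe|xe] := pselect (cube e (x - z)).
    by apply: ler_wpM2r; [exact: bump_ge0|exact: h].
  by rewrite bump_eq0// !mulr0.
Qed.

Lemma le_moll e f z (B : R) : 0 < e -> bfun f -> (forall x, `|f x| <= B) -> `|moll e f z| <= B.
Proof.
move=> e0 bf fB; rewrite -[moll e f z]subr0; apply: moll_dist => // x _.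
by rewrite subr0.
Qed.

Lemma moll_eq0 e f z r : 0 < e -> (forall x, ~ cube r x -> f x = 0) ->
  ~ cube (r + e) z -> moll e f z = 0.
Proof.
move=> e0 fr h; rewrite /moll (_ : (fun x => _) = cst 0); last first.
  apply/funext => x /=; have [xr|xr] := pselect (cube r x); last by rewrite fr// mul0r.
  rewrite bump_eq0 ?mulr0// => xe; apply: h => i.
  rewrite -(subKr (x ord0 i) (z ord0 i)); apply: le_trans (ler_normB _ _) _.
  by apply: lerD => //; have := xe i; rewrite !mxE.
by rewrite Rintegral_cst// mul0r mulr0.
Qed.

Lemma measurable_flat k : measurable_fun setT (flat k : R -> R).
Proof.
apply: continuous_measurable_fun => x; apply/differentiable_continuous.
by apply/derivable1_diffP; case: (is_derive_flat k x).
Qed.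

Lemma measurable_bump2 e :
  measurable_fun setT (fun w : V * V => flat_bump e w.1 w.2).
Proof.
rewrite /flat_bump; elim: (index_enum _) => [|i s IH].
  by under eq_fun do rewrite big_nil; exact: measurable_cst.
under eq_fun do rewrite big_cons; apply: measurable_funM => //.
have md : measurable_fun setT (fun w : V * V => w.2 ord0 i - w.1 ord0 i).
  apply: measurable_funB.
    exact: (measurableT_comp (@measurable_coord R 1 n ord0 i) measurable_snd).
  exact: (measurableT_comp (@measurable_coord R 1 n ord0 i) measurable_fst).
apply: measurable_funM; apply: (measurableT_comp (measurable_flat 0)).
  exact: measurable_funB.
exact: measurable_funD.
Qed.

Let kernel_prop e f g : 0 < e -> bfun f -> bfun g ->
  let k := fun w : V * V => g w.1 * (f w.2 * flat_bump e w.1 w.2) in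
  exists M s r : R, [/\ measurable_fun setT k, 0 <= s, 0 <= r,
    forall w, `|k w| <= M & forall z x, ~ (cube s z /\ cube r x) -> k (z, x) = 0].
Proof.
move=> e0 [mf [B [r [B0 r0 fB fr]]]] [mg [C [s [C0 s0 gC gs]]]] k.
have [mb [M [t [M0 t0 bM _]]]] := bump_bfun 0 (ltW e0).
exists (C * (B * M)), s, r; split => //.
- apply: measurable_funM; first exact: (measurableT_comp mg measurable_fst).
  apply: measurable_funM; first exact: (measurableT_comp mf measurable_snd).
  exact: measurable_bump2.
- move=> -[z x]; rewrite /k/= !normrM; apply: ler_pM => //.
  by apply: ler_pM => //; rewrite bump_translate.
- move=> z x /not_andP[h|h]; first by rewrite /k/= gs// mul0r.
  by rewrite /k/= fr// mul0r mulr0.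
Qed.

Lemma moll_measurable e f : 0 < e -> bfun f -> measurable_fun setT (moll e f).
Proof.
move=> e0 bf; have [mf [B [r [B0 r0 fB fr]]]] := bf.
have re : 0 <= r + e by rewrite addr_ge0// ltW.
have mc : measurable (@cube R n (r + e)) by exact: cube_measurable.
(* By [moll_eq0] multiplying by this indicator changes nothing. It provides the bounded support in
   [z] under which measurability of the parameter integral follows from Fubini. *)
have bg : bfun (\1_(cube (r + e)) : V -> R).
  split; first exact: measurable_indic.
  exists 1, (r + e); split => //.
    by move=> x; rewrite indicE; case: (_ \in _); rewrite /= ?normr0 ?normr1.
  by move=> x xr; rewrite indicE memNset.
have [M [s [t [mk s0 t0 kM k0]]]] := kernel_prop e0 bf bg.
have mI := measurable_Rintegral2 mk s0 t0 kM k0.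
rewrite (_ : moll e f = fun z => (bump_mass e)^-1 * \int[leb n]_x
    (\1_(cube (r + e)) z * (f x * flat_bump e z x))).
  by apply: measurable_funM => //; exact: mI.
apply/funext => z; rewrite RintegralZl//; last first.
  by apply: bfun_integrable; exact: bfunM_bump.
have [zr|zr] := pselect (cube (r + e) z); first by rewrite indicE mem_set// mul1r.
by rewrite indicE memNset// mul0r mulr0 (moll_eq0 e0 fr).
Qed.

Lemma moll_bfun e f : 0 < e -> bfun f -> bfun (moll e f).
Proof.
move=> e0 bf; split; first exact: moll_measurable.
have [mf [B [r [B0 r0 fB fr]]]] := bf.
exists B, (r + e); split => //; first by rewrite addr_ge0// ltW.
  by move=> z; exact: le_moll.
by move=> z; exact: moll_eq0.
Qed.

(** Fubini for the kernel [g z * f x * flat_bump e z x], whose bump is symmetric in [z] and [x]. *)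
Lemma moll_adjoint e f g : 0 < e -> bfun f -> bfun g ->
  \int[leb n]_z (g z * moll e f z) = \int[leb n]_x (f x * moll e g x).
Proof.
move=> e0 bf bg.
have c0 : bump_mass e != 0 by exact: lt0r_neq0 (bump_mass_gt0 e0).
have bgf : bfun (fun z => g z * moll e f z) by exact: (bfunM (moll_bfun e0 bf) bg).
have bfg : bfun (fun z => f z * moll e g z) by exact: (bfunM (moll_bfun e0 bg) bf).
have [M [s [t [mk s0 t0 kM k0]]]] := kernel_prop e0 bf bg.
have := Rintegral_exchange mk s0 t0 kM k0 => E.
have L z : g z * moll e f z =
    (bump_mass e)^-1 * \int[leb n]_x (g z * (f x * flat_bump e z x)).
  by rewrite (RintegralZl (g z) measurableT (bfun_integrable (bfunM_bump z e0 bf))) [RHS]mulrCA.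
have L' x : f x * moll e g x =
    (bump_mass e)^-1 * \int[leb n]_z (g z * (f x * flat_bump e z x)).
  rewrite /moll mulrCA; congr (_ * _).
  rewrite -(RintegralZl (f x) measurableT (bfun_integrable (bfunM_bump x e0 bg))).
  by apply: eq_Rintegral => z _; rewrite [LHS]mulrCA bump_sym.
apply: (mulfI c0).
rewrite -(RintegralZl _ measurableT (bfun_integrable bgf)).
rewrite -(RintegralZl _ measurableT (bfun_integrable bfg)).
transitivity (\int[leb n]_z \int[leb n]_x (g z * (f x * flat_bump e z x))).
  apply: eq_Rintegral => z _; rewrite L; exact: mulVKf.
rewrite [LHS]E; apply: eq_Rintegral => z _; rewrite L'; apply/esym; exact: mulVKf.
Qed.

Lemma moll_cvg f z (e_ : nat -> R) : bfun f -> {for z, continuous f} ->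
  (forall k, 0 < e_ k) -> e_ k @[k --> \oo] --> 0 ->
  moll (e_ k) f z @[k --> \oo] --> f z.
Proof.
move=> bf cf e0 e_0; apply/cvgrPdist_le => /= eta eta0.
have /nbhs_ballP[d /= d0 dh] : \forall x \near z, `|f z - f x| <= eta.
  by move/cvgrPdist_le : cf => /(_ _ eta0).
near=> k; rewrite distrC; apply: moll_dist => // x xe; rewrite distrC; apply: dh.
rewrite -ball_normE /ball_/=.
apply: (@le_lt_trans _ _ (e_ k)).
  by rewrite distrC; apply/cubeP => //; exact: ltW.
by near: k; exact: (cvgr_lt _ e_0).
Unshelve. all: by end_near. Qed.

End mollifier.

(** * Directional derivatives, and derivatives of mollifications *)

Section derivatives.
Context {R : realType}.

Lemma derive_translate (V W : normedModType R) (f : V -> W) (z x v : V) :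
  'D_v (fun y => f (y - z)) x = 'D_v f (x - z).
Proof.
rewrite /derive.
have -> // : (fun h : R => h^-1 *: (((fun y => f (y - z)) \o shift x) (h *: v) - f (x - z))) =
  (fun h : R => h^-1 *: ((f \o shift (x - z)) (h *: v) - f (x - z))).
by apply/funext => h /=; rewrite addrA.
Qed.

Lemma deriveNv (V W : normedModType R) (f : V -> W) (x v : V) :
  differentiable f x -> 'D_(- v) f x = - 'D_v f x.
Proof. by move=> df; rewrite !deriveE// linearN. Qed.

(** [gamma] is derivable along [v] only. Restricted to the line it becomes a function of one real
    variable, where derivability is differentiability, and the chain rule for differentials
    applies. *)
Lemma is_derive_comp (V W Z : normedModType R) (gamma : V -> W) (Phi : W -> Z) x v w :
  is_derive x v gamma w -> differentiable Phi (gamma x) ->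
  is_derive x v (Phi \o gamma) ('D_w Phi (gamma x)).
Proof.
move=> dg dPhi; rewrite deriveE//.
have {}dg : is_derive (0 : R) 1 (fun s : R => gamma (x + s *: v)) w.
  have h := (is_derive_line gamma x v 0 w).1; rewrite scale0r addr0 in h.
  exact: h.
have df : differentiable (fun s : R => gamma (x + s *: v)) 0.
  by apply/derivable1_diffP; case: dg.
have dP : differentiable Phi (gamma (x + 0 *: v)) by rewrite scale0r addr0.
suff H : is_derive (0 : R) 1 (Phi \o (fun s : R => gamma (x + s *: v))) ('d Phi (gamma x) w).
  by have := (@is_derive_line _ _ _ (Phi \o gamma) x v 0 _).2 H; rewrite scale0r addr0.
apply: DeriveDef.
  by apply: diff_derivable; exact: differentiable_comp.
rewrite deriveE; last exact: differentiable_comp.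
rewrite diff_comp//= scale0r addr0; congr ('d Phi (gamma x) _).
by case: dg => _ <-; rewrite deriveE.
Qed.

Lemma derive_pair (V W : normedModType R) (n : nat) (Phi : V * 'rV[R]_n -> W) p
    (v : V) (w : 'rV[R]_n) :
  differentiable Phi p ->
  'D_(v, w) Phi p = 'D_(v, 0 : 'rV[R]_n) Phi p +
    \sum_(l < n) w ord0 l *: 'D_(0 : V, bvec l) Phi p.
Proof.
move=> dP; rewrite deriveE//.
have -> : (v, w) = (v, 0) + \sum_(l < n) w ord0 l *: (0 : V, bvec l).
  rewrite [X in _ + X](_ : _ = (0, w)); first by congr pair; rewrite /= ?addr0 ?add0r.
  rewrite [w in RHS]row_sum_delta.
  elim: (index_enum _) => [|l s IH]; first by rewrite !big_nil.
  by rewrite !big_cons IH; congr pair; rewrite /= ?scaler0 ?addr0.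
rewrite linearD linear_sum -deriveE//; congr (_ + _); apply: eq_bigr => l _.
by rewrite linearZ/= -deriveE.
Qed.

End derivatives.

Section mollifier_derivative.
Context {R : realType} {n : nat}.
Local Notation V := 'rV[R]_n.
Implicit Types (u g : V -> R).

Lemma derive_eq0 (W : normedModType R) (f : W -> R^o) (K : set W) x v : closed K ->
  (forall y, ~ K y -> f y = 0) -> ~ K x -> is_derive x v f 0.
Proof.
move=> cK fK Kx; apply: (@near_eq_is_derive _ _ _ (cst 0)).
have : \forall y \near x, (~` K) y by apply: open_nbhs_nbhs; split => //; exact: closed_openC.
by apply: filterS => y Ky; rewrite fK.
Qed.

Lemma compact_closed_norm (W : normedModType R) (K : set W) : compact K -> closed K.
Proof. by apply: compact_closed; exact: norm_hausdorff. Qed.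

(** Translation reduces to the bump about 0, whose derivative is continuous and vanishes off a cube.
    Uniformity in the centre [z] allows differentiation under the integral that defines [moll]. *)
Lemma bump_derive_bound e (v : V) : 0 <= e -> exists M : R, forall z x : V,
  `|'D_v (flat_bump e z : V -> R^o) x| <= M.
Proof.
move=> e0.
have [df Df] := flat_fun_derive (bump_flat_fun e (0 : V)).
have : bfun (fun x : V => 'D_v (flat_bump e 0 : V -> R^o) x).
  apply: (bfun_continuous e0); first exact: flat_fun_continuous.
  move=> x xe; suff : is_derive x v (flat_bump e (0 : V) : V -> R^o) 0 by case.
  apply: (derive_eq0 _ (compact_closed_norm (@cube_compact R n e))) => // y ye.
  by apply: bump_eq0; rewrite subr0.
move=> [_ [M [r [_ _ h _]]]]; exists M => z x.
rewrite (_ : flat_bump e z = fun y => flat_bump e 0 (y - z)); last first.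
  by apply/funext => y; exact: bump_translate.
by rewrite (derive_translate (flat_bump e (0 : V) : V -> R^o)).
Qed.

(** A variant of [weak_partial] for functions already defined and bounded on the whole space: the
    integrals are global, but the test functions still live in [U]. *)
Definition weak_partialT (U : set V) (m : 'I_n) u g := forall phi, test_function U phi ->
  \int[leb n]_x (u x * 'D_(bvec m) (phi : V -> R^o) x) = - \int[leb n]_x (g x * phi x).

Lemma bump_test_function U e (z : V) : (forall x, cube e (x - z) -> U x) ->
  test_function U (flat_bump e z).
Proof.
move=> eU; split; first exact: bump_smooth.
exists [set x | cube e (x - z)]; split => //.
- have -> : [set x | cube e (x - z)] = (fun y => y + z) @` cube e.
    apply/seteqP; split=> [x /= xe|_ [y ye <-]/=]; last by rewrite addrK.
    by exists (x - z) => //; rewrite subrK.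
  apply: continuous_compact; last exact: cube_compact.
  by apply: continuous_subspaceT; exact: continuous_addr.
- by move=> x; exact: bump_eq0.
Qed.

(** Differentiating in [z] under the integral puts the derivative on the bump. The bump depends on
    [x - z], so this is minus its derivative in [x], and the weak derivative turns [u] into [g]. *)
Lemma is_derive_moll U m u g e (z : V) : 0 < e -> bfun u -> bfun g ->
  (forall x, cube e (x - z) -> U x) -> weak_partialT U m u g ->
  is_derive z (bvec m) (moll e u : V -> R^o) (moll e g z).
Proof.
move=> e0 bu bg eU W; set v := bvec m.
have [M dM] := bump_derive_bound v (ltW e0).
pose F (l : R) (x : V) := u x * flat_bump e (z + l *: v) x.
have dF (l : R) (x : V) : is_derive l 1 (F ^~ x : R -> R^o)
    (- (u x * 'D_v (flat_bump e (z + l *: v) : V -> R^o) x)).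
  rewrite -mulrN; apply: is_deriveZ.
  (* Moving the centre by [l *: v] amounts to moving the point by the opposite vector; hence the
     minus sign in [dF]. *)
  have E : (fun l : R => flat_bump e (z + l *: v) x) =
      (fun l : R => flat_bump e 0 ((x - z) + l *: (- v))).
    by apply/funext => t; rewrite bump_translate scalerN opprD addrA.
  rewrite E; apply/(@is_derive_line _ _ _ (flat_bump e (0 : V) : V -> R^o)).
  have db : differentiable (flat_bump e (0 : V) : V -> R^o) (x - z + l *: - v).
    exact: (flat_fun_derive (bump_flat_fun e 0)).1.
  apply: DeriveDef; first exact: diff_derivable.
  apply: etrans (deriveNv v db) _; congr (- _).
  rewrite (_ : flat_bump e (z + l *: v) = fun y => flat_bump e 0 (y - (z + l *: v))); last first.
    by apply/funext => y; exact: bump_translate.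
  by rewrite (derive_translate (flat_bump e (0 : V) : V -> R^o)) scalerN opprD addrA.
have pF (l : R) (x : V) : partial1of2 F l x = - (u x * 'D_v (flat_bump e (z + l *: v) : V -> R^o) x).
  by rewrite partial1of2E; case: (dF l x).
have M0 : 0 <= M by exact: le_trans (dM 0 0).
have bG : bfun (fun x => M * `|u x|).
  have [mu [B [r [B0 r0 uB ur]]]] := bu.
  split; first by apply: measurable_funM => //; exact: measurableT_comp.
  exists (M * B), r; split => //; first exact: mulr_ge0.
    by move=> x; rewrite normrM normr_id (ger0_norm M0); apply: ler_wpM2l.
  by move=> x xr; rewrite ur// normr0 mulr0.
have := @cvg_differentiation_under_integral R _ _ (leb n) F setT measurableT 0 (-1) 1 _ _ _
  (fun x => M * `|u x|) _ _ _.
have /[swap]/[apply] : `]-1, 1[%classic (0 : R) by rewrite /= in_itv/= ltr01 ltrN10.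
have /[swap]/[apply] : forall x, `]-1, 1[%classic x -> (leb n).-integrable setT (EFin \o F x).
  by move=> l _; apply: bfun_integrable; exact: bfunM_bump.
have /[swap]/[apply] : forall (l : R) (x : V), `]-1, 1[%classic l -> setT x -> derivable (F ^~ x) l 1.
  by move=> l x _ _; case: (dF l x).
have /[swap]/[apply] : forall x : V, 0 <= M * `|u x| by move=> x; rewrite mulr_ge0.
have /[swap]/[apply] := bfun_integrable bG.
have /[swap]/[apply] : forall (l : R) (x : V), `]-1, 1[%classic l -> setT x ->
    `|partial1of2 F l x| <= M * `|u x|.
  by move=> l x _ _; rewrite pF normrN normrM mulrC ler_wpM2r.
(* The cube about [z] lies in [U], so the bump is an admissible test function for the weak
   derivative. *)
have -> : \int[leb n]_x partial1of2 F 0 x = \int[leb n]_x (g x * flat_bump e z x).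
  have t := W _ (bump_test_function eU).
  rewrite -[RHS]opprK -t -mulN1r.
  have bD : bfun (fun x => u x * 'D_v (flat_bump e z : V -> R^o) x).
    under eq_fun do rewrite mulrC; apply: bfunMl => //; last by exists M.
    apply: continuous_measurable_mxR; apply: flat_fun_continuous.
    exact: (flat_fun_derive (bump_flat_fun e z)).2.
  rewrite -(RintegralZl _ measurableT (bfun_integrable bD)).
  by apply: eq_Rintegral => x _; rewrite pF scale0r addr0 mulN1r.
move=> c.
have {}c : is_derive (0 : R) 1 (fun s : R => \int[leb n]_x F s x : R^o)
    (\int[leb n]_x (g x * flat_bump e z x)).
  have E : (fun h : R => h^-1 *: (((fun s : R => \int[leb n]_x F s x : R^o) \o shift 0) (h *: (1 : R)) -
      \int[leb n]_x F 0 x)) =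
    (fun h : R => h^-1 *: ((fun x' : R => \int[leb n]_y F x' y) (h + 0) - \int[leb n]_y F 0 y)).
    by apply/funext => h /=; rewrite [h *: 1](mulr1 h).
  apply: DeriveDef; last by rewrite /derive E; exact/cvg_lim.
  by apply/cvg_ex; exists (\int[leb n]_x (g x * flat_bump e z x)); rewrite E.
have := (@is_derive_line _ _ _ (moll e u : V -> R^o) z v 0 (moll e g z)).
rewrite scale0r addr0 => H; exact: H.2.
Qed.

End mollifier_derivative.

(** * The weak chain rule *)

Section C1_functions.
Context {R : realType}.

Definition C1 (V : normedModType R) (f : V -> R) : Prop :=
  (forall x, differentiable (f : V -> R^o) x) /\
  forall v, continuous (fun x => 'D_v (f : V -> R^o) x).

Lemma smooth_C1 (V : normedModType R) (f : V -> R) : smooth f -> C1 f.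
Proof.
move=> sf; split=> [x|v x]; first exact: (sf [::]).
by apply: differentiable_continuous; exact: (sf [:: v]).
Qed.

Lemma C1_continuous (V : normedModType R) (f : V -> R) : C1 f -> continuous f.
Proof. by move=> [df _] x; exact: (@differentiable_continuous _ _ R^o). Qed.

End C1_functions.

Lemma continuous_near_cst (R : realType) (T : topologicalType) (f : T -> R) x (c : R) :
  (\forall y \near x, f y = c) -> {for x, continuous f}.
Proof.
move=> h; suff : f y @[y --> x] --> f x by [].
by rewrite (nbhs_singleton h); exact: cvg_near_cst.
Qed.

Lemma cvg_bigsum (R : realType) (I : Type) (s : seq I) (F : I -> nat -> R) (a : I -> R) :
  (forall i, F i k @[k --> \oo] --> a i) ->
  \sum_(i <- s) F i k @[k --> \oo] --> \sum_(i <- s) a i.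
Proof.
move=> Fa; elim: s => [|i s IH].
  by rewrite big_nil; under eq_fun do rewrite big_nil; exact: cvg_cst.
rewrite big_cons; under eq_fun do rewrite big_cons.
by apply: cvgD.
Qed.

Section pair_derivative.
Context {R : realType}.

Lemma is_derive_pair (V W Z : normedModType R) (f : V -> W) (g : V -> Z) x v df dg :
  is_derive x v f df -> is_derive x v g dg -> is_derive x v (fun y => (f y, g y)) (df, dg).
Proof.
move=> [cf <-] [cg <-].
have c : h^-1 *: (((fun y => (f y, g y)) \o shift x) (h *: v) - (f x, g x)) @[h --> 0^'] -->
    ('D_v f x, 'D_v g x).
  apply: (@cvg_pair _ _ _ _ (nbhs ('D_v f x)) (nbhs ('D_v g x)) _ _ _
    (fun h : R => h^-1 *: ((f \o shift x) (h *: v) - f x))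
    (fun h : R => h^-1 *: ((g \o shift x) (h *: v) - g x))).
  - exact: cf.
  - exact: cg.
by apply: DeriveDef; [apply/cvg_ex; exists ('D_v f x, 'D_v g x)|exact/cvg_lim].
Qed.

Lemma is_derive_row (V : normedModType R) n (f : 'I_n -> V -> R) x v (df : 'I_n -> R) :
  (forall j, is_derive x v (f j : V -> R^o) (df j)) ->
  is_derive x v (fun y => \row_j f j y) (\row_j df j).
Proof.
move=> h; have E i j : (fun y => (\row_j f j y) i j) = f j by apply/funext => y; rewrite mxE.
have d : derivable (fun y => \row_j f j y) x v.
  by apply/derivable_mxP => i j; rewrite E; case: (h j).
apply: DeriveDef => //; rewrite derive_mx//; apply/rowP => j; rewrite 2!mxE E.
by case: (h j).
Qed.

End pair_derivative.

Section chain_rule.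
Context {R : realType} {n N : nat}.
Local Notation V := 'rV[R]_n.
Local Notation VW := ('rV[R]_n * 'rV[R]_N)%type.

Lemma measurable_fun_comp2 d (T : measurableType d) (D : set T) (Psi : VW -> R)
    (a : T -> 'rV[R]_n) (b : T -> 'rV[R]_N) : continuous Psi ->
  measurable_fun D a -> measurable_fun D b -> measurable_fun D (fun x => Psi (a x, b x)).
Proof.
move=> cPsi ma mb.
rewrite (_ : (fun x => _) = (fun v => Psi (lsubmx v, rsubmx v)) \o (fun x => row_mx (a x) (b x))); last first.
  by apply/funext => x /=; rewrite row_mxKl row_mxKr.
apply: measurableT_comp.
  apply: continuous_measurable_mxR => v.
  apply: (@continuous_comp _ _ _ (fun v => (lsubmx v, rsubmx v)) Psi); last exact: cPsi.
  by apply: continuous_pair; [exact: continuous_lsubmx|exact: continuous_rsubmx].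
apply: measurable_fun_row => j.
case: (split_ordP j) => i ->; under eq_fun do rewrite ?(row_mxEl, row_mxEr).
  exact: (measurableT_comp (@measurable_coord R 1 n ord0 i)).
exact: (measurableT_comp (@measurable_coord R 1 N ord0 i)).
Qed.

Variables (U K : set V) (m : 'I_n) (r0 B : R) (u : V -> 'rV[R]_N) (g : 'I_N -> V -> R).
Hypotheses (oU : open U) (cK : compact K) (KU : K `<=` U)
  (r00 : 0 <= r0) (Kr0 : K `<=` cube r0)
  (bu : forall l, bfun (fun x => u x ord0 l)) (uB : forall x l, `|u x ord0 l| <= B)
  (cu : forall x, U x -> {for x, continuous u})
  (bg : forall l, bfun (g l))
  (W : forall l, weak_partialT U m (fun x => u x ord0 l) (g l)).

Let umoll e x : 'rV[R]_N := \row_l moll e (fun x => u x ord0 l) x.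

Lemma is_derive_umoll e x : 0 < e -> (forall y, cube e (y - x) -> U y) ->
  is_derive x (bvec m : V) (umoll e) (\row_l moll e (g l) x).
Proof.
move=> e0 eU; apply: is_derive_row => l.
exact: (is_derive_moll e0 (bu l) (bg l) eU (@W l)).
Qed.

Section approximation.
Variables (e_ : nat -> R) (Psi : VW -> R) (chi : V -> R).
Hypotheses (e0 : forall k, 0 < e_ k) (e_0 : e_ k @[k --> \oo] --> 0)
  (cPsi : continuous Psi) (cchi : continuous chi) (chiK : forall x, ~ K x -> chi x = 0).

Let F k x := Psi (x, umoll (e_ k) x) * chi x.
Let Foo x := Psi (x, u x) * chi x.

Let chir x : ~ cube r0 x -> chi x = 0.
Proof. by move=> h; apply: chiK; apply: contra_not h; exact: Kr0. Qed.

(** Mollification preserves the bound [B], so [u] and all its mollifications take values in one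
    compact cube. This gives a bound uniform in [k]. *)
Let Psi_bound : exists2 M : R, 0 <= M & forall x y, cube r0 x -> cube B y -> `|Psi (x, y) * chi x| <= M.
Proof.
have c : compact (@cube R n r0 `*` @cube R N B) by apply: compact_setX; exact: cube_compact.
have [M1 h1] := continuous_bounded c (continuous_subspaceT cPsi).
have [M2 h2] := continuous_bounded (@cube_compact R n r0) (continuous_subspaceT cchi).
exists (`|M1| * `|M2|); first by rewrite mulr_ge0.
move=> x y xr yB; rewrite normrM; apply: ler_pM => //.
  by apply: le_trans (ler_norm _); apply: h1.
by apply: le_trans (ler_norm _); exact: h2.
Qed.

Let F_bound : exists2 M : R, 0 <= M & (forall k x, `|F k x| <= M) /\ forall x, `|Foo x| <= M.
Proof.
have [M M0 h] := Psi_bound; exists M => //; split=> [k|] x.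
  have [xr|xr] := pselect (cube r0 x); last by rewrite /F chir// mulr0 normr0.
  by apply: h => // l; rewrite mxE; exact: le_moll.
have [xr|xr] := pselect (cube r0 x); last by rewrite /Foo chir// mulr0 normr0.
by apply: h => // l.
Qed.

Let umoll_measurable k : measurable_fun setT (umoll (e_ k)).
Proof.
apply: measurable_fun_row => l; under eq_fun do rewrite mxE.
exact: moll_measurable.
Qed.

Let mF k : measurable_fun setT (F k).
Proof.
apply: measurable_funM; last exact: continuous_measurable_mxR.
exact: measurable_fun_comp2.
Qed.

Let F_cvg x : F k x @[k --> \oo] --> Foo x.
Proof.
have [Kx|Kx] := pselect (K x); last first.
  rewrite /F /Foo chiK// mulr0; under eq_fun do rewrite mulr0.
  exact: cvg_cst.
apply: cvgM; last exact: cvg_cst.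
suff c : (x, umoll (e_ k) x) @[k --> \oo] --> (x, u x).
  by apply: (@cvg_comp _ _ _ (fun k => (x, umoll (e_ k) x)) Psi _ _ _ c); exact: cPsi.
apply: (@cvg_pair _ _ _ _ (nbhs x) (nbhs (u x)) _ _ _ (cst x) (fun k => umoll (e_ k) x)).
  exact: cvg_cst.
apply: cvg_mx => i l; rewrite (ord1 i); under eq_fun do rewrite mxE.
apply: (moll_cvg (bu l) _ e0 e_0).
apply: (@continuous_comp _ _ _ u (fun y => y ord0 l)); first exact: cu (KU Kx).
exact: coord_continuous.
Qed.

Let bF k : bfun (F k).
Proof.
have [M M0 [h1 h2]] := F_bound; split; first exact: mF.
by exists M, r0; split => // x xr; rewrite /F chir// mulr0.
Qed.

Let bFoo : bfun Foo.
Proof.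
have [M M0 [h1 h2]] := F_bound; split.
  by apply: (@measurable_fun_cvg _ _ _ setT F) => // x _; exact: F_cvg.
by exists M, r0; split => // x xr; rewrite /Foo chir// mulr0.
Qed.

Lemma umoll_comp_bfun k : bfun (fun x => Psi (x, umoll (e_ k) x) * chi x).
Proof. exact: bF. Qed.

Lemma comp_bfun : bfun (fun x => Psi (x, u x) * chi x).
Proof. exact: bFoo. Qed.

Lemma umoll_comp_cvg :
  \int[leb n]_x (Psi (x, umoll (e_ k) x) * chi x) @[k --> \oo] -->
  \int[leb n]_x (Psi (x, u x) * chi x).
Proof.
have [M M0 [h1 h2]] := F_bound.
apply: (@bounded_convergence _ _ F Foo M r0) => //.
by move=> k x xr; rewrite /F chir// mulr0.
Qed.

Let Foo_continuous (x : V) : {for x, continuous Foo}.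
Proof.
have [Kx|Kx] := pselect (K x).
  apply: continuousM; last exact: cchi.
  apply: (@continuous_comp _ _ _ (fun x => (x, u x)) Psi); last exact: cPsi.
  by apply: continuous_pair; [exact: cvg_id|exact: cu (KU Kx)].
apply: (@continuous_near_cst _ _ _ _ 0).
have : \forall y \near x, (~` K) y.
  by apply: open_nbhs_nbhs; split => //; apply: closed_openC; exact: compact_closed_norm.
by apply: filterS => y Ky; rewrite /Foo chiK// mulr0.
Qed.

(* Mollifications of h need not converge pointwise; moll_adjoint moves the mollifier
   to the continuous factor. *)
Lemma moll_umoll_comp_cvg h : bfun h ->
  \int[leb n]_x (moll (e_ k) h x * (Psi (x, umoll (e_ k) x) * chi x)) @[k --> \oo] -->
  \int[leb n]_x (h x * (Psi (x, u x) * chi x)).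
Proof.
move=> bh; have [mh [C [s [C0 s0 hC hs]]]] := bh.
have [M M0 [h1 h2]] := F_bound.
have bmh k : bfun (moll (e_ k) h) by exact: moll_bfun.
have mmh k : measurable_fun setT (moll (e_ k) h) by case: (bmh k).
have mhC k x : `|moll (e_ k) h x| <= C by exact: le_moll.
have bD k : bfun (fun x => F k x - Foo x).
  under eq_fun do rewrite -mulN1r; apply: bfunD; first exact: bF.
  apply: bfunMl; [exact: bFoo|exact: measurable_cst|by exists `|-1|].
(* The integrand is split as in [E] below. Against [F k - Foo], which tends to zero pointwise, a
   uniform bound on the mollified factor suffices; against [Foo] the mollifier is transferred. *)
have A : \int[leb n]_x (moll (e_ k) h x * (F k x - Foo x)) @[k --> \oo] --> (0 : R).
  have -> : 0 = \int[leb n]_(x in [set: V]) (0 : R) by rewrite Rintegral_cst// mul0r.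
  apply: (@bounded_convergence _ _ _ (fun=> 0) (C * (M + M)) r0) => //.
  - by rewrite mulr_ge0// addr_ge0.
  - by move=> k; apply: measurable_funM => //; case: (bD k).
  - move=> k x; rewrite normrM; apply: ler_pM => //.
    by apply: le_trans (ler_normB _ _) _; exact: lerD.
  - by move=> k x xr; rewrite /F /Foo chir// !mulr0 subrr mulr0.
  - move=> x; apply/norm_cvg0P.
    apply: (@squeeze_cvgr _ _ _ _ (cst 0) (fun k => C * `|F k x - Foo x|)).
    + apply: nearW => k; rewrite normr_ge0/= normrM.
      by apply: ler_wpM2r.
    + exact: cvg_cst.
    + rewrite -[X in _ --> X](mulr0 C); apply: cvgMr.
      by apply/norm_cvg0P; apply/subr_cvg0; exact: F_cvg.
have A2 : \int[leb n]_x (h x * moll (e_ k) Foo x) @[k --> \oo] --> \int[leb n]_x (h x * Foo x).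
  apply: (@bounded_convergence _ _ _ _ (C * M) s) => //.
  - exact: mulr_ge0.
  - by move=> k; apply: measurable_funM => //; exact: moll_measurable.
  - move=> k x; rewrite normrM; apply: ler_pM => //; exact: le_moll.
  - by move=> k x xr; rewrite hs// mul0r.
  - move=> x; apply: cvgM; first exact: cvg_cst.
    by apply: moll_cvg => //; exact: Foo_continuous.
have E k : \int[leb n]_x (moll (e_ k) h x * F k x) =
    \int[leb n]_x (moll (e_ k) h x * (F k x - Foo x)) + \int[leb n]_x (h x * moll (e_ k) Foo x).
  have b1 : bfun (fun x => moll (e_ k) h x * (F k x - Foo x)) by exact: (bfunM (bD k) (bmh k)).
  have b2 : bfun (fun x => Foo x * moll (e_ k) h x) by exact: (bfunM (bmh k) bFoo).
  rewrite -(moll_adjoint (e0 k) bh bFoo).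
  rewrite -(RintegralD measurableT (bfun_integrable b1) (bfun_integrable b2)).
  by apply: eq_Rintegral => x _; ring.
have -> : (fun k => \int[leb n]_x (moll (e_ k) h x * (Psi (x, umoll (e_ k) x) * chi x))) =
   (fun k => \int[leb n]_x (moll (e_ k) h x * (F k x - Foo x)) + \int[leb n]_x (h x * moll (e_ k) Foo x)).
  by apply/funext => k; exact: E.
by rewrite -[X in _ --> X]add0r; exact: cvgD.
Qed.

End approximation.

(** A uniform margin between [K] and the complement of [U], from the near-covering form of
    compactness. Halving the local radius leaves room for the triangle inequality. *)
Lemma compact_cube_subset : exists2 e : R, 0 < e & forall x y, K x -> cube e (y - x) -> U y.
Proof.
have nc := (compact_near_coveringP K).1 cK.
pose P (e : R) (x : V) := forall y, cube e (y - x) -> U y.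
have : \forall e \near 0^'+, K `<=` P e.
  apply: nc => x Kx.
  have /nbhs_ballP[d /= d0 dU] : nbhs x U by apply: open_nbhs_nbhs; split => //; exact: KU.
  have d20 : 0 < d / 2 by rewrite divr_gt0.
  exists (ball x (d / 2), [set e : R | 0 < e < d / 2]) => /=.
    split; first exact: nbhsx_ballx.
    near=> e; rewrite /=; apply/andP; split; near: e; [exact: nbhs_right_gt|exact: nbhs_right_lt].
  move=> [x' e]/= [xx' /andP[ee ed]] y ye; apply: dU.
  move: xx'; rewrite -!ball_normE /ball_/= => xx'.
  rewrite -(subrK x' x) -addrA; apply: le_lt_trans (ler_normD _ _) _.
  rewrite [d]splitr; apply: ltrD => //; rewrite distrC.
  by apply: le_lt_trans ed; apply/cubeP => //; exact: ltW.
move=> [/= d d0 dP]; exists (d / 2); first by rewrite divr_gt0.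
move=> x y Kx; apply: (dP (d / 2)) => //=; last by rewrite divr_gt0.
by rewrite sub0r normrN gtr0_norm ?divr_gt0// ltr_pdivrMr// mulr2n mulrDr mulr1 ltrDl.
Unshelve. all: by end_near. Qed.

(** With [u] mollified, [Phi (x, u x) * phi x] has a classical derivative everywhere, and its
    integral vanishes. The terms [T1], [T2], [T3] then converge separately; only [T3] contains
    mollified gradients. *)
Lemma chain_rule_compact (Phi : VW -> R) (phi : V -> R) : C1 Phi -> C1 phi ->
  (forall x, ~ K x -> phi x = 0) ->
  \int[leb n]_x (Phi (x, u x) * 'D_(bvec m) (phi : V -> R^o) x) =
  - \int[leb n]_x (('D_(bvec m, 0 : 'rV[R]_N) (Phi : VW -> R^o) (x, u x) +
      \sum_(l < N) g l x * 'D_(0 : V, bvec l) (Phi : VW -> R^o) (x, u x)) * phi x).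
Proof.
move=> [dPhi cPhi] [dphi cphi] phiK.
have [e e0 eU] := compact_cube_subset.
(* These radii tend to zero and never exceed the margin [e], so every mollification is derivable on
   [K]. *)
pose e_ (k : nat) : R := e * k.+1%:R^-1.
have e_0 k : 0 < e_ k by rewrite mulr_gt0// invr_gt0.
have e_c : e_ k @[k --> \oo] --> 0.
  by rewrite -[X in _ --> X](mulr0 e); apply: cvgMr; exact: cvg_harmonic.
have eUk k x y : K x -> cube (e_ k) (y - x) -> U y.
  move=> Kx h; apply: (eU x) => //; apply: cube_le h.
  by rewrite /e_; apply: ler_piMr; [exact: ltW|rewrite invf_le1// ler1n].
have cKl : closed K by exact: compact_closed_norm.
pose v := bvec m : V.
pose Dphi x := 'D_v (phi : V -> R^o) x.
have DphiK x : ~ K x -> Dphi x = 0.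
  by move=> Kx; case: (derive_eq0 v cKl phiK Kx).
pose Dx := (fun p : VW => 'D_(v, 0 : 'rV[R]_N) (Phi : VW -> R^o) p).
pose Dy l := (fun p : VW => 'D_(0 : V, bvec l) (Phi : VW -> R^o) p).
have cPhi0 : continuous Phi by exact: C1_continuous.
have cphi0 : continuous phi by exact: C1_continuous.
pose uk k x := umoll (e_ k) x.
pose T1 k x := Phi (x, uk k x) * Dphi x.
pose T2 k x := Dx (x, uk k x) * phi x.
pose T3 k l x := moll (e_ k) (g l) x * (Dy l (x, uk k x) * phi x).
pose H k x := Phi (x, uk k x) * phi x.
have bH k : bfun (H k) by exact: umoll_comp_bfun.
have bT1 k : bfun (T1 k) by apply: umoll_comp_bfun => //; exact: cphi.
have bT2 k : bfun (T2 k) by apply: umoll_comp_bfun => //; exact: cPhi.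
have bT3 k l : bfun (T3 k l).
  by apply: bfunM; [apply: umoll_comp_bfun => //; exact: cPhi|exact: moll_bfun].
have bT k : bfun (fun x => T1 k x + (T2 k x + \sum_(l < N) T3 k l x)).
  by apply: bfunD => //; apply: bfunD => //; exact: bfun_sum.
have dH k x : is_derive x v (H k : V -> R^o) (T1 k x + (T2 k x + \sum_(l < N) T3 k l x)).
  (* Off [K] the mollification cube may leave [U], but there [H k] is locally zero. *)
  have [Kx|Kx] := pselect (K x); last first.
    have HK y : ~ K y -> H k y = 0 by move=> Ky; rewrite /H phiK// mulr0.
    have -> : T1 k x + (T2 k x + \sum_(l < N) T3 k l x) = 0.
      rewrite /T1 /T2 DphiK// phiK// !mulr0 !add0r big1// => l _.
      by rewrite /T3 phiK// !mulr0.
    exact: derive_eq0 cKl HK Kx.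
  have du : is_derive x v (fun x => (x, uk k x)) (v, \row_l moll (e_ k) (g l) x).
    apply: is_derive_pair.
    exact: (is_derive_umoll (e_0 k) (fun y => @eUk k x y Kx)).
  have dc := is_derive_comp du (dPhi (x, uk k x)).
  have dp : is_derive x v (phi : V -> R^o) (Dphi x) by apply: DeriveDef => //; exact: diff_derivable.
  apply: (is_derive_eq (is_deriveM dc dp)).
  rewrite /GRing.scale/= -/(T1 k x) derive_pair//; congr (_ + _).
  rewrite mulrDr mulr_sumr; congr (_ + _); first by rewrite mulrC.
  apply: eq_bigr => l _; rewrite mxE /T3 /Dy /GRing.scale/=; ring.
have I0 k : \int[leb n]_x (T1 k x + (T2 k x + \sum_(l < N) T3 k l x)) = 0.
  have [_ [M [r [M0 rr0 h1 h2]]]] := bT k.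
  exact: (Rintegral_directional_derive (bH k) (dH k) h1 rr0 h2).
have S k : \int[leb n]_x T1 k x + (\int[leb n]_x T2 k x + \sum_(l < N) \int[leb n]_x T3 k l x) = 0.
  have b3 : bfun (fun x => \sum_(l < N) T3 k l x) by exact: bfun_sum.
  apply: etrans (I0 k); rewrite (RintegralD measurableT (bfun_integrable (bT1 k))
    (bfun_integrable (bfunD (bT2 k) b3))).
  by rewrite (RintegralD measurableT (bfun_integrable (bT2 k)) (bfun_integrable b3)) Rintegral_bfun_sum.
have L1 : \int[leb n]_x T1 k x @[k --> \oo] --> \int[leb n]_x (Phi (x, u x) * Dphi x).
  by apply: umoll_comp_cvg => //; exact: cphi.
have L2 : \int[leb n]_x T2 k x @[k --> \oo] --> \int[leb n]_x (Dx (x, u x) * phi x).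
  by apply: umoll_comp_cvg => //; exact: cPhi.
have L3 l : \int[leb n]_x T3 k l x @[k --> \oo] --> \int[leb n]_x (g l x * (Dy l (x, u x) * phi x)).
  by apply: moll_umoll_comp_cvg => //; exact: cPhi.
have L : \int[leb n]_x (Phi (x, u x) * Dphi x) + (\int[leb n]_x (Dx (x, u x) * phi x) +
   \sum_(l < N) \int[leb n]_x (g l x * (Dy l (x, u x) * phi x))) = 0.
  have c : (\int[leb n]_x T1 k x + (\int[leb n]_x T2 k x + \sum_(l < N) \int[leb n]_x T3 k l x))
      @[k --> \oo] --> \int[leb n]_x (Phi (x, u x) * Dphi x) + (\int[leb n]_x (Dx (x, u x) * phi x) +
   \sum_(l < N) \int[leb n]_x (g l x * (Dy l (x, u x) * phi x))).
    apply: cvgD => //; apply: cvgD => //; apply: cvg_bigsum => l; exact: L3.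
  rewrite -(cvg_lim _ c)//; apply/cvg_lim => //; apply: cvg_near_cst; exact: nearW.
have c2 : bfun (fun x => Dx (x, u x) * phi x) by apply: (comp_bfun e_0 e_c) => //; exact: cPhi.
have c3 l : bfun (fun x => g l x * (Dy l (x, u x) * phi x)).
  have c : bfun (fun x => Dy l (x, u x) * phi x).
    by apply: (comp_bfun e_0 e_c) => //; exact: cPhi.
  exact: (bfunM c (bg l)).
have cs := bfun_sum (index_enum 'I_N) c3.
apply/eqP; rewrite -addr_eq0; apply/eqP; apply: etrans L; congr (_ + _).
rewrite -Rintegral_bfun_sum// -(RintegralD measurableT (bfun_integrable c2) (bfun_integrable cs)).
apply: eq_Rintegral => x _; rewrite mulrDl mulr_suml; congr (_ + _); apply: eq_bigr => l _.
by rewrite mulrA.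
Qed.

End chain_rule.

(** * Functions of class C^1 and polynomial functions *)

Section C1_theory.
Context {R : realType}.

Lemma C1_cst (V : normedModType R) (c : R) : C1 (fun _ : V => c).
Proof.
split=> [x|v x]; first exact: differentiable_cst.
have -> : 'D_v ((fun=> c) : V -> R^o) = (fun=> 0).
  by apply/funext => y; exact: derive_cst.
exact: cvg_cst.
Qed.

Lemma C1D (V : normedModType R) (f g : V -> R) : C1 f -> C1 g -> C1 (fun x => f x + g x).
Proof.
move=> [df cf] [dg cg]; split=> [x|v]; first exact: differentiableD.
rewrite (_ : (fun y => _) = fun y => 'D_v (f : V -> R^o) y + 'D_v (g : V -> R^o) y).
  by move=> x; apply: cvgD; [exact: cf|exact: cg].
by apply/funext => y; apply: deriveD; exact: diff_derivable.
Qed.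

Lemma C1M (V : normedModType R) (f g : V -> R) : C1 f -> C1 g -> C1 (fun x => f x * g x).
Proof.
move=> f1 g1; have [df cf] := f1; have [dg cg] := g1.
split=> [x|v]; first exact: differentiableM.
 rewrite [X in continuous X](_ : _ =
    fun y => f y * 'D_v (g : V -> R^o) y + g y * 'D_v (f : V -> R^o) y).
  move=> x; apply: cvgD; apply: cvgM;
    [exact: C1_continuous|exact: cg|exact: C1_continuous|exact: cf].
by apply/funext => y; apply: deriveM; exact: diff_derivable.
Qed.

Lemma C1_sum (V : normedModType R) (I : Type) (s : seq I) (F : I -> V -> R) :
  (forall i, C1 (F i)) -> C1 (fun x => \sum_(i <- s) F i x).
Proof.
move=> CF; elim: s => [|i s IH].
  by under eq_fun do rewrite big_nil; exact: C1_cst.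
by under eq_fun do rewrite big_cons; exact: C1D.
Qed.

Lemma continuous_linear_diff (V W : normedModType R) (L : V -> W) x v :
  linear L -> continuous L -> differentiable L x /\ 'D_v L x = L v.
Proof.
move=> lL cL; pose LM := GRing.isLinear.Build _ _ _ _ _ lL.
pose LL : {linear V -> W} := HB.pack L LM.
have dL : differentiable L x by exact: (@linear_differentiable _ _ _ LL).
split=> //; rewrite deriveE//.
by have -> : 'd L x = L :> (V -> W) by exact: (@diff_lin _ _ _ LL).
Qed.

Lemma C1_linear (V : normedModType R) (L : V -> R) :
  linear (L : V -> R^o) -> continuous L -> C1 L.
Proof.
move=> lL cL; split=> [x|v x].
  exact: (@continuous_linear_diff _ R^o L x 0 lL cL).1.
rewrite (_ : (fun y => _) = fun=> L v); first exact: cvg_cst.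
by apply/funext => y; exact: (@continuous_linear_diff _ R^o L y v lL cL).2.
Qed.

Lemma derive_comp_linear (V W Z : normedModType R) (f : W -> Z) (L : V -> W) x v :
  linear L -> continuous L -> differentiable f (L x) ->
  is_derive x v (f \o L) ('D_(L v) f (L x)).
Proof.
move=> lL cL df; apply: is_derive_comp => //.
have [dL DL] := continuous_linear_diff x v lL cL.
by apply: DeriveDef => //; exact: diff_derivable.
Qed.

Lemma C1_comp_linear (V W : normedModType R) (f : W -> R) (L : V -> W) :
  linear L -> continuous L -> C1 f -> C1 (f \o L).
Proof.
move=> lL cL [df cf]; split=> [x|v].
  apply: (@differentiable_comp _ _ _ R^o L f) => //.
  exact: (continuous_linear_diff x 0 lL cL).1.
rewrite (_ : (fun y => _) = (fun y => 'D_(L v) (f : W -> R^o) y) \o L).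
  by move=> x; apply: continuous_comp; [exact: cL|exact: cf].
apply/funext => y.
by case: (@derive_comp_linear _ _ R^o f L y v lL cL (df (L y))).
Qed.

(** An induction principle along the monomial expansion, used for measurability, continuity and C^1
    regularity of polynomial functions alike. *)
Lemma poly_in_ind N (T : Type) (c : T -> 'rV[R]_N) (f : T -> R) (Q : (T -> R) -> Prop) :
  (forall a, Q (fun=> a)) -> (forall g h, Q g -> Q h -> Q (fun t => g t + h t)) ->
  (forall g h, Q g -> Q h -> Q (fun t => g t * h t)) ->
  (forall j, Q (fun t => c t ord0 j)) -> poly_in c f -> Q f.
Proof.
move=> Qc QD QM Qj [p pE].
have -> : f = fun t => \sum_(m <- mpoly.msupp p) mpoly.mcoeff m p * \prod_(i < N) c t ord0 i ^+ mpoly.fun_of_multinom m i.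
  by apply/funext => t; rewrite pE mpoly.mevalE.
elim: (mpoly.msupp p) => [|m s IH]; first by under eq_fun do rewrite big_nil; exact: Qc.
under eq_fun do rewrite big_cons; apply: (QD _ _ _ IH); apply: (QM _ _ (Qc _)).
elim: (index_enum _) => [|i r IHr]; first by under eq_fun do rewrite big_nil; exact: Qc.
under eq_fun do rewrite big_cons; apply: (QM _ _ _ IHr).
elim: (mpoly.fun_of_multinom m i) => [|k IHk]; first by under eq_fun do rewrite expr0; exact: Qc.
by under eq_fun do rewrite exprS; exact: (QM _ _ (Qj i) IHk).
Qed.

End C1_theory.

Lemma continuous_near_eq (T U : topologicalType) (f g : T -> U) x :
  (\forall y \near x, f y = g y) -> {for x, continuous f} -> {for x, continuous g}.
Proof.
move=> fg cf; suff : g y @[y --> x] --> g x by [].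
by rewrite -(nbhs_singleton fg); apply: cvg_trans cf; exact: near_eq_cvg.
Qed.

Lemma within_continuous_comp_continuous (T U W : topologicalType) (A : set T)
    (f : T -> U) (g : U -> W) :
  {within A, continuous f} -> continuous g -> {within A, continuous (fun x => g (f x))}.
Proof. by move=> cf cg x; apply: continuous_comp; [exact: cf|exact: cg]. Qed.

(** * The chain rule on the interior of a compact set *)

Section weak_chain_rule.
Context {R : realType} {n N : nat}.
Local Notation V := 'rV[R]_n.
Local Notation VW := ('rV[R]_n * 'rV[R]_N)%type.

Lemma Rintegral_support d (T : measurableType d) (mu : {measure set T -> \bar R}) (A : set T)
    (f : T -> R) : (forall x, ~ A x -> f x = 0) ->
  \int[mu]_(x in A) f x = \int[mu]_x f x.
Proof.
move=> f0; rewrite Rintegral_mkcond; apply: eq_Rintegral => x _.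
by rewrite patchE; case: ifPn => // /negP h; rewrite f0// => /mem_set.
Qed.

(** Mollification is set up for functions bounded everywhere on the whole space. Setting [f] to zero
    off [U] and wherever the essential bound fails alters it only on a null subset of [U]. *)
Lemma linfty_truncate (U : set V) (f : V -> R) (r : R) : 0 <= r -> measurable U ->
  U `<=` cube r -> Linfty U f ->
  exists2 f0 : V -> R, bfun f0 & {ae leb n, forall x, U x -> f x = f0 x}.
Proof.
move=> r0 mU Ur [mf [M fM]].
have mh : measurable_fun setT (f \_ U) by exact/(measurable_restrictT _ mU).
pose A := (f \_ U) @^-1` `[- M, M].
have mA : measurable A by rewrite -[A]setTI; apply: mh.
exists ((f \_ U) \_ A).
  split; first by apply/(measurable_restrictT _ mA); exact: measurable_funTS.
  exists `|M|, r; split => // x.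
    rewrite patchE; case: ifPn => [|_]; last by rewrite normr0.
    by rewrite inE /A /= in_itv/= -ler_norml => /le_trans; apply; exact: ler_norm.
  move=> xr; rewrite patchE; case: ifP => // _; rewrite patchE; case: ifPn => //.
  by rewrite inE => /Ur.
apply: filterS fM => x h Ux; rewrite patchE ifT.
  by rewrite patchE mem_set.
by rewrite inE /A /= patchE mem_set// in_itv/= -ler_norml; exact: h.
Qed.

Variables (Om : set V) (u : V -> 'rV[R]_N) (du : 'I_N -> 'I_n -> V -> R) (Phi : VW -> R).
Hypotheses (cOm : compact Om) (cu : {within Om, continuous u})
  (Wu : forall l, W1infty Om° (fun x => u x ord0 l) (du l)) (CPhi : C1 Phi).

Let oU : open Om°. Proof. exact: open_interior. Qed.
Let mU : measurable Om°. Proof. exact: open_measurable_mx. Qed.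
Let UOm : Om° `<=` Om. Proof. exact: interior_subset. Qed.

Let cuU x : Om° x -> {for x, continuous u}.
Proof. by move=> Ux; exact: (continuous_within_open oU UOm cu). Qed.

Lemma within_continuous_pair : {within Om, continuous (fun x => (x, u x))}.
Proof.
move=> x; apply: continuous_pair; last exact: cu.
exact: (continuous_subspaceT (fun y => cvg_id)).
Qed.

Lemma within_continuous_comp_pair (Psi : VW -> R) : continuous Psi ->
  {within Om, continuous (fun x => Psi (x, u x))}.
Proof.
move=> cPsi; exact: (within_continuous_comp_continuous within_continuous_pair cPsi).
Qed.

Let mu : measurable_fun Om° u.
Proof. by apply: measurable_fun_row => l; case: (Wu l) => -[]. Qed.

Lemma comp_pair_measurable (Psi : VW -> R) : continuous Psi ->
  measurable_fun Om° (fun x => Psi (x, u x)).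
Proof. by move=> cPsi; apply: measurable_fun_comp2. Qed.

Lemma comp_pair_bounded (Psi : VW -> R) : continuous Psi ->
  exists M : R, forall x, Om x -> `|Psi (x, u x)| <= M.
Proof.
move=> cPsi; apply: continuous_bounded cOm _; exact: within_continuous_comp_pair.
Qed.

Let Om_cube : exists2 r : R, 0 <= r & Om `<=` cube r.
Proof.
have [M [_ h]] := compact_bounded cOm; exists (`|M| + 1); first by rewrite addr_ge0.
move=> x Omx; apply/cubeP; first by rewrite addr_ge0.
by apply: h => //; apply: le_lt_trans (ler_norm _) _; rewrite ltrDl.
Qed.

Let u_bound : exists2 B : R, 0 <= B & forall x l, Om x -> `|u x ord0 l| <= B.
Proof.
have [B h] : exists B : R, forall x, Om x -> `| `|u x| | <= B.
  apply: (continuous_bounded cOm).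
  exact: (within_continuous_comp_continuous cu (@norm_continuous _ _)).
exists `|B| => // x l Omx; apply: le_trans (mx_coord_le _ _ _) _.
by apply: le_trans (ler_norm B); rewrite -[leLHS]normr_id; exact: h.
Qed.

Section partial.
Variable m : 'I_n.

Let truncated : exists g : 'I_N -> V -> R, forall l,
  bfun (g l) /\ {ae leb n, forall x, Om° x -> du l m x = g l x}.
Proof.
have [r r0 Omr] := Om_cube.
suff /choice[g gP] : forall l, exists g : V -> R,
    bfun g /\ {ae leb n, forall x, Om° x -> du l m x = g x} by exists g.
move=> l; have [_ /(_ m)[Ldu _]] := Wu l.
have [g bg h] := linfty_truncate r0 mU (subset_trans UOm Omr) Ldu.
by exists g.
Qed.

Let Dx : VW -> R := (fun p : VW => 'D_(bvec m : V, 0 : 'rV[R]_N) (Phi : VW -> R^o) p).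
Let Dy l : VW -> R := (fun p : VW => 'D_(0 : V, bvec l) (Phi : VW -> R^o) p).

Let cDx : continuous Dx. Proof. exact: CPhi.2. Qed.
Let cDy l : continuous (Dy l). Proof. exact: CPhi.2. Qed.

Let dE x : 'D_(bvec m : V, (\row_l du l m x) : 'rV[R]_N) (Phi : VW -> R^o) (x, u x) =
  Dx (x, u x) + \sum_(l < N) du l m x * Dy l (x, u x).
Proof.
rewrite derive_pair; last exact: CPhi.1.
by congr (_ + _); apply: eq_bigr => l _; rewrite mxE.
Qed.

Let md : measurable_fun Om° (fun x => Dx (x, u x) + \sum_(l < N) du l m x * Dy l (x, u x)).
Proof.
apply: measurable_funD; first exact: (comp_pair_measurable cDx).
apply: measurable_sum => l; apply: measurable_funM.
  by have [_ /(_ m)[[]]] := Wu l.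
exact: (comp_pair_measurable (@cDy l)).
Qed.

Lemma Linfty_comp_derive : Linfty Om° (fun x =>
  'D_(bvec m : V, (\row_l du l m x) : 'rV[R]_N) (Phi : VW -> R^o) (x, u x)).
Proof.
under eq_fun do rewrite dE; split; first exact: md.
have [g gP] := truncated.
have [M0 h0] := comp_pair_bounded cDx.
have /choice[M h] : forall l, exists M : R, forall x, Om x -> `|Dy l (x, u x)| <= M.
  by move=> l; exact: (comp_pair_bounded (@cDy l)).
have /choice[C hC] :
  forall l, exists C : R, forall x, `|g l x| <= C.
  by move=> l; have [[_ [C [r [_ _ hC _]]]] _] := gP l; exists C.
exists (M0 + \sum_(l < N) C l * M l).
have : {ae leb n, forall x, forall l, Om° x -> du l m x = g l x}.
  by apply: filter_forall => l; exact: (gP l).2.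
apply: filterS => x gx Ux; apply: le_trans (ler_normD _ _) _; apply: lerD.
  by apply: h0; exact: UOm.
apply: le_trans (ler_norm_sum _ _ _) _; apply: ler_sum => l _.
by rewrite normrM gx//; apply: ler_pM => //; apply: h; exact: UOm.
Qed.

(** [u] and its weak derivatives are replaced by the globally bounded [u0] and [g], to which
    [chain_rule_compact] applies with [K] the support of the test function. *)
Lemma weak_partial_comp : weak_partial Om° m (fun x => Phi (x, u x))
  (fun x => 'D_(bvec m : V, (\row_l du l m x) : 'rV[R]_N) (Phi : VW -> R^o) (x, u x)).
Proof.
have [r r0 Omr] := Om_cube.
have [B B0 uB] := u_bound.
have [g gP] := truncated.
(* Extension by zero may jump across the boundary, but continuity is asked only at points of the
   open set. *)
pose u0 x : 'rV[R]_N := \row_l ((fun y => u y ord0 l) \_ Om°) x.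
have u0E x : Om° x -> u0 x = u x.
  by move=> Ux; apply/rowP => l; rewrite mxE patchE mem_set.
have u0c l : (fun x => u0 x ord0 l) = (fun y => u y ord0 l) \_ Om°.
  by apply/funext => x; rewrite mxE.
have u0B x l : `|u0 x ord0 l| <= B.
  rewrite mxE patchE; case: ifPn => [|_]; last by rewrite normr0.
  by rewrite inE => /UOm Omx; exact: uB.
have bu0 l : bfun (fun x => u0 x ord0 l).
  split.
    rewrite u0c; apply/(measurable_restrictT _ mU).
    exact: (measurableT_comp (@measurable_coord R 1 N ord0 l)).
  exists B, r; split => // x xr; rewrite mxE patchE; case: ifPn => //.
  by rewrite inE => /UOm/Omr.
have cu0 x : Om° x -> {for x, continuous u0}.
  move=> Ux; apply: continuous_near_eq (cuU Ux).
  have : \forall y \near x, Om° y by apply: open_nbhs_nbhs.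
  by apply: filterS => y Uy; rewrite u0E.
(* The factor [chi] confines the integrand to the interior, so integrals over the interior and over
   the whole space agree. *)
have convert (f1 f2 : V -> R) (chi : V -> R) (K : set V) : K `<=` Om° ->
    (forall x, ~ K x -> chi x = 0) -> (forall x, Om° x -> f1 x = f2 x) ->
    \int[leb n]_(x in Om°) (f1 x * chi x) = \int[leb n]_x (f2 x * chi x).
  move=> KU chiK f12; rewrite -[RHS](@Rintegral_support _ _ _ Om°).
    by apply: eq_Rintegral => x; rewrite inE => Ux; rewrite f12.
  by move=> x Ux; rewrite chiK ?mulr0// => /KU.
have W l : weak_partialT Om° m (fun x => u0 x ord0 l) (g l).
  move=> phi tphi; have [sphi [K [cK KU phiK]]] := tphi.
  have [_ /(_ m)[[mdu _] /(_ _ tphi)]] := Wu l.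
  have cphi : continuous phi by apply: C1_continuous; exact: smooth_C1.
  have DphiK x : ~ K x -> 'D_(bvec m) (phi : V -> R^o) x = 0.
    by move=> Kx; case: (derive_eq0 (bvec m) (compact_closed_norm cK) phiK Kx).
  rewrite (convert _ (fun x => u0 x ord0 l) _ K)//; last by move=> x Ux; rewrite u0E.
  move=> ->; congr (- _); rewrite -[RHS](@Rintegral_support _ _ _ Om°).
    by apply: ae_eq_Rintegral; apply: filterS (gP l).2 => x h Ux; rewrite h.
  by move=> x Ux; rewrite phiK ?mulr0// => /KU.
move=> phi tphi; have [sphi [K [cK KU phiK]]] := tphi.
have c1phi := smooth_C1 sphi; have cphi := C1_continuous c1phi.
have DphiK x : ~ K x -> 'D_(bvec m) (phi : V -> R^o) x = 0.
  by move=> Kx; case: (derive_eq0 (bvec m) (compact_closed_norm cK) phiK Kx).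
rewrite (convert _ (fun x => Phi (x, u0 x)) _ K)//; last by move=> x Ux; rewrite u0E.
have Kr : K `<=` cube r by move=> x /KU/UOm/Omr.
rewrite (chain_rule_compact oU cK KU r0 Kr bu0 u0B cu0 (fun l => (gP l).1) W CPhi c1phi phiK).
congr (- _); under [RHS]eq_Rintegral do rewrite dE.
rewrite -[LHS](@Rintegral_support _ _ _ Om°); last by move=> x Ux; rewrite phiK ?mulr0// => /KU.
apply: ae_eq_Rintegral.
have : {ae leb n, forall x, forall l, Om° x -> du l m x = g l x}.
  by apply: filter_forall => l; exact: (gP l).2.
apply: filterS => x gx Ux; rewrite u0E//; congr (_ * _); congr (_ + _).
by apply: eq_bigr => l _; rewrite gx.
Qed.

End partial.

Lemma W1infty_comp : W1infty Om° (fun x => Phi (x, u x))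
  (fun m x => 'D_(bvec m : V, (\row_l du l m x) : 'rV[R]_N) (Phi : VW -> R^o) (x, u x)).
Proof.
split.
  split; first by apply: comp_pair_measurable; exact: C1_continuous.
  have [M h] := comp_pair_bounded (C1_continuous CPhi).
  by exists M; apply: aeW => x /UOm; exact: h.
by move=> m; split; [exact: Linfty_comp_derive|exact: weak_partial_comp].
Qed.

End weak_chain_rule.

(** * Occupation measures *)

Section ae_bounded.
Context {R : realType} d (T : measurableType d).
Implicit Types (m : {measure set T -> \bar R}) (A : set T) (f g : T -> R).

Lemma ae_bounded_integrable m A f (C : R) : measurable A -> (m A < +oo)%E ->
  measurable_fun A f -> {ae m, forall x, A x -> `|f x| <= C} ->
  m.-integrable A (EFin \o f).
Proof.
move=> mA fA mf [N [mN N0 hN]].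
apply/(negligible_integrable mN mA _ N0); first exact/measurable_EFinP.
have mAN : measurable (A `\` N) by exact: measurableD.
apply: measurable_bounded_integrable => //.
- by apply: le_lt_trans fA; apply: le_measure; rewrite ?inE//; exact: subDsetl.
- by apply: measurable_funS mf => //; exact: subDsetl.
- exists C; split; first exact: num_real.
  move=> M CM x [Ax Nx] /=; apply: le_trans (ltW CM).
  by apply: contrapT => h; apply: Nx; apply: hN => /= /(_ Ax).
Qed.

Lemma integrable_mrestr m A (mA : measurable A) f :
  measurable_fun setT f -> m.-integrable A (EFin \o f) ->
  (mrestr m mA).-integrable setT (EFin \o f) /\
  \int[mrestr m mA]_x f x = \int[m]_(x in A) f x.
Proof.
move=> mf intf.
have mNA : measurable (~` A) by exact: measurableC.
have NA0 : mrestr m mA (~` A) = 0%E by rewrite /mrestr setICl measure0.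
have TA : [set: T] `\` ~` A = A by rewrite setDE setCK setTI.
have E (h : T -> \bar R) : (\int[mrestr m mA]_(x in A) h x = \int[m]_(x in A) h x)%E.
  apply: eq_measure_integral => B mB BA.
  by apply: (congr1 m); exact: setIidl.
have iA : (mrestr m mA).-integrable A (EFin \o f).
  have /integrableP[m1 m2] := intf; apply/integrableP; split => //.
  by rewrite E.
have iT : (mrestr m mA).-integrable setT (EFin \o f).
  apply/(negligible_integrable mNA measurableT _ NA0); first exact/measurable_EFinP.
  by rewrite TA.
split=> //; congr fine; rewrite (negligible_integral mNA)//.
by rewrite TA E.
Qed.

End ae_bounded.

Section pushforward_restriction.
Context {R : realType} d1 d2 (T1 : measurableType d1) (T2 : measurableType d2).
Variables (m : {measure set T1 -> \bar R}) (A : set T1) (g : T1 -> T2) (S : set T2).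
Hypotheses (mA : measurable A) (fA : (m A < +oo)%E) (mg : measurable_fun A g)
  (mS : measurable S) (gS : {ae m, forall x, A x -> S (g x)}).

Lemma measurable_patch : measurable_fun setT (g \_ A).
Proof. exact/(measurable_restrictT _ mA). Qed.

(** [g] is measurable on [A] only, so it is patched by a default value elsewhere; restricting [m] to
    [A] gives that part no mass. *)
Definition push_restr : {measure set T2 -> \bar R} := push (mrestr m mA) measurable_patch.

Lemma push_restr_supported : push_restr (~` S) = 0%E.
Proof.
have [N [mN N0 hN]] := gS.
have mSc : measurable (~` S) by exact: measurableC.
have mP : measurable ((g \_ A) @^-1` (~` S)).
  by rewrite -[X in measurable X]setTI; apply: measurable_patch.
rewrite /push_restr /push /= /pushforward /mrestr.
apply/eqP; rewrite -measure_le0 -N0; apply: le_measure; rewrite ?inE//.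
  exact: measurableI.
move=> x [/= Sx Ax]; apply: hN => /= /(_ Ax); apply: contra_not Sx => ?.
by rewrite patchE mem_set.
Qed.

(** Measurability of [f] is asked on [S] alone because some integrands contain the normal, which is
    measurable only on the boundary. Patching [f] by zero off [S] is harmless, as [g] lands in [S]
    almost everywhere. *)
Lemma push_restr_integral (f : T2 -> R) (C : R) : measurable_fun S f ->
  measurable_fun A (f \o g) -> {ae m, forall x, A x -> `|f (g x)| <= C} ->
  push_restr.-integrable S (EFin \o f) /\
  \int[push_restr]_(t in S) f t = \int[m]_(x in A) f (g x).
Proof.
move=> mf mfg fC.
have mF : measurable_fun setT (f \_ S) by exact/(measurable_restrictT _ mS).
have mFg : measurable_fun setT ((f \_ S) \o (g \_ A)).
  exact: (measurableT_comp mF measurable_patch).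
have FE : {ae m, forall x, A x -> ((f \_ S) \o (g \_ A)) x = f (g x)}.
  by apply: filterS gS => x h Ax /=; rewrite !patchE mem_set//= mem_set//; exact: h.
have iA : m.-integrable A (EFin \o ((f \_ S) \o (g \_ A))).
  apply: (@ae_bounded_integrable _ _ _ _ _ _ C) => //; first exact: measurable_funTS.
  by apply: filterS2 FE fC => x h1 h2 Ax; rewrite h1//; exact: h2.
have [iT IT] := integrable_mrestr mA mFg iA.
have mEF : measurable_fun setT (EFin \o (f \_ S)) by exact/measurable_EFinP.
have ip : push_restr.-integrable setT (EFin \o (f \_ S)).
  exact: (integrable_pushforward measurable_patch mEF iT measurableT).
split.
  by apply/(integrable_mkcond _ mS); rewrite restrict_EFin.
rewrite Rintegral_mkcond.
transitivity (\int[mrestr m mA]_x ((f \_ S) \o (g \_ A)) x).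
  congr fine; exact: (integral_pushforward measurable_patch mEF iT measurableT).
by rewrite IT; exact: ae_eq_Rintegral.
Qed.

End pushforward_restriction.

(** * The boundary and its pieces *)

Section geometry_facts.
Context {R : realType} {n nb : nat} (n_gt0 : (0 < n)%N) (D : geometry R n nb) (hD : geometry_ok D).
Local Notation Om := (Omega D).
Local Notation dOm := (boundary (Omega D)).

Lemma Omega_closed : closed Om.
Proof. by apply: compact_closed_norm; exact: Omega_compact hD. Qed.

Lemma Omega_measurable : measurable Om.
Proof. exact: closed_measurable_mx Omega_closed. Qed.

Lemma interior_measurable : measurable Om°.
Proof. by apply: open_measurable_mx; exact: open_interior. Qed.

Lemma boundaryE : dOm = Om `\` Om°.
Proof. by rewrite /boundary -(closure_id _).1//; exact: Omega_closed. Qed.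

Lemma boundary_sub : dOm `<=` Om.
Proof. by rewrite boundaryE; exact: subDsetl. Qed.

Lemma boundary_measurable : measurable dOm.
Proof. by rewrite boundaryE; apply: measurableD; [exact: Omega_measurable|exact: interior_measurable]. Qed.

Lemma Omega_split x : Om x -> Om° x \/ dOm x.
Proof.
by move=> Omx; rewrite boundaryE; have [|] := pselect (Om° x); [left|right].
Qed.

Lemma leb_Omega_lty : (leb n Om < +oo)%E.
Proof.
have [M [_ h]] := compact_bounded (Omega_compact hD).
have s : Om `<=` cube (`|M| + 1).
  move=> x Omx; apply/cubeP; first by rewrite addr_ge0.
  by apply: h => //; apply: le_lt_trans (ler_norm _) _; rewrite ltrDl.
apply: (@le_lt_trans _ _ (leb n (@cube R n (`|M| + 1)))).
  by apply: le_measure; rewrite ?inE//; [exact: Omega_measurable|exact: cube_measurable].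
by rewrite leb_cube ?addr_ge0// ltry.
Qed.

Lemma weak_partial0 (U : set 'rV[R]_n) m (g : 'rV[R]_n -> R) :
  (forall x, U x -> g x = 0) -> weak_partial U m (fun=> 0) g.
Proof.
move=> g0 phi _.
have E (f : 'rV[R]_n -> R) : (forall x, U x -> f x = 0) -> \int[leb n]_(x in U) f x = 0.
  move=> f0; rewrite (@eq_Rintegral _ _ _ _ _ (fun=> 0)); last first.
    by move=> x; rewrite inE => /f0.
  by rewrite /Rintegral integral0.
rewrite !E ?oppr0// => x Ux; first by rewrite g0// mul0r.
by rewrite mul0r.
Qed.

(* On Omega° the indicator of the boundary is a weak gradient of 0. *)
Lemma leb_boundary0 : leb n dOm = 0%E.
Proof.
pose dh (m : 'I_n) : 'rV[R]_n -> R := \1_dOm.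
have mb := boundary_measurable.
have dh0 m x : Om° x -> dh m x = 0.
  by move=> Ux; rewrite /dh indicE memNset//; rewrite boundaryE => -[_].
have W : W1infty Om° (fun=> 0) dh.
  split; first by split; [exact: measurable_cst|exists 0; apply: aeW => x _; rewrite normr0].
  move=> m; split; last by apply: weak_partial0; exact: dh0.
  split; first by apply: measurable_funTS; exact: measurable_indic.
  by exists 0; apply: aeW => x Ux; rewrite dh0// normr0.
have c0 : {within Om, continuous (fun=> 0 : R)}.
  by apply: continuous_subspaceT => x; exact: cst_continuous.
(* Gauss-Green integrates the gradient over all of Omega, boundary included. With [h = 0] the
   surface side vanishes, and the volume side is the measure of the boundary. *)
have := gauss_green hD c0 W (Ordinal n_gt0).
rewrite (_ : \int[sigma D]_(x in dOm) _ = 0); last first.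
  by rewrite /Rintegral; under eq_integral do rewrite mul0r; rewrite integral0.
rewrite /dh /Rintegral integral_indic ?boundary_measurable//; last exact: Omega_measurable.
rewrite setIidl; last exact: boundary_sub.
move=> /esym/eqP; rewrite fine_eq0 => [/eqP //|].
rewrite ge0_fin_numE//; apply: le_lt_trans leb_Omega_lty.
by apply: le_measure; rewrite ?inE//; [exact: Omega_measurable|exact: boundary_sub].
Qed.

Lemma ae_Omega (Q : 'rV[R]_n -> Prop) :
  {ae leb n, forall x, Om° x -> Q x} -> {ae leb n, forall x, Om x -> Q x}.
Proof.
move=> h; have b : {ae leb n, forall x, ~ dOm x}.
  by exists dOm; split; [exact: boundary_measurable|exact: leb_boundary0|move=> x /= /contrapT].
by apply: filterS2 h b => x h bx /Omega_split[].
Qed.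

Lemma piece_measurable k : measurable (piece D k).
Proof.
have [N [g gE]] := piece_semialgebraic hD k.
suff -> : piece D k = \bigcap_(i in [set: 'I_N]) [set x : 'rV[R]_n | 0 <= mpoly.meval (x ord0) (g i)].
  apply: fin_bigcap_measurable => // i _.
  have mg : measurable_fun setT (fun x : 'rV[R]_n => mpoly.meval (x ord0) (g i)).
    apply: (@poly_in_ind _ _ _ id _ (measurable_fun setT)); last by exists (g i).
    - by move=> a; exact: measurable_cst.
    - by move=> f1 f2 m1 m2; exact: measurable_funD.
    - by move=> f1 f2 m1 m2; exact: measurable_funM.
    - by move=> j; exact: measurable_coord.
  rewrite (_ : [set x | _] = (fun x : 'rV[R]_n => mpoly.meval (x ord0) (g i)) @^-1` `[0, +oo[).
    by rewrite -[X in measurable X]setTI; apply: mg.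
  by apply/seteqP; split=> x /=; rewrite in_itv/= andbT.
by rewrite gE; apply/seteqP; split=> x /= h i; [move=> _; exact: h|exact: (h i Logic.I)].
Qed.

Lemma piece_sub k : piece D k `<=` dOm.
Proof. by rewrite (piece_cover hD) => x ?; exists k. Qed.

End geometry_facts.

Section piecewise_integral.
Context {R : realType} {n nb : nat} (D : geometry R n nb) (hD : geometry_ok D).
Local Notation dOm := (boundary (Omega D)).

(** Each integral over a piece becomes an integral over the whole boundary against an indicator.
    Almost every boundary point lies in exactly one piece, so a single summand survives there. *)
Lemma sum_piecewise_integral (fk : 'I_nb -> 'rV[R]_n -> R) (f : 'rV[R]_n -> R) :
  (forall k, measurable_fun dOm (fk k)) ->
  (forall k, exists C : R, {ae sigma D, forall x, dOm x -> `|fk k x| <= C}) ->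
  (forall k, {ae sigma D, forall x, piece D k x -> fk k x = f x}) ->
  \sum_k \int[sigma D]_(x in piece D k) fk k x = \int[sigma D]_(x in dOm) f x.
Proof.
move=> mf fC fE; have mb := boundary_measurable hD.
have fs : (sigma D dOm < +oo)%E by rewrite ltey_eq fin_num_measure.
have m1 k : measurable_fun dOm (\1_(piece D k) : 'rV[R]_n -> R).
  by apply: measurable_funTS; apply: measurable_indic; exact: piece_measurable hD k.
have mf1 k : measurable_fun dOm (fun x => fk k x * \1_(piece D k) x) by exact: measurable_funM.
have i1 k : (sigma D).-integrable dOm (EFin \o (fun x => fk k x * \1_(piece D k) x)).
  have [C hC] := fC k; apply: (@ae_bounded_integrable _ _ _ _ _ _ C) => //.
  apply: filterS hC => x h dx; rewrite normrM; apply: le_trans (h dx).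
  by rewrite ler_piMr// indicE; case: (_ \in _); rewrite /= ?normr1 ?normr0.
have E k : \int[sigma D]_(x in piece D k) fk k x =
    \int[sigma D]_(x in dOm) (fk k x * \1_(piece D k) x).
  rewrite -[X in \int[_]_(x in X) fk k x](setIidr (@piece_sub _ _ _ D hD k)) Rintegral_mkcondr.
  apply: eq_Rintegral => x _; rewrite patchE indicE.
  by case: (x \in piece D k); rewrite /= ?mulr1 ?mulr0.
rewrite (eq_bigr _ (fun k _ => E k)) -(Rintegral_sum mb _ (fun k _ => i1 k)).2.
apply: ae_eq_Rintegral.
have disj : {ae sigma D, forall x (i : 'I_nb) (j : 'I_nb), i != j -> ~ (piece D i `&` piece D j) x}.
  apply: filter_forall => i; apply: filter_forall => j.
  have [->|ij] := eqVneq i j; first exact: aeW.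
  exists (piece D i `&` piece D j); split; first by apply: measurableI; exact: piece_measurable hD _.
    exact: (piece_disjoint hD ij).
  by move=> x /=; apply: contra_notP.
have fE' : {ae sigma D, forall x k, piece D k x -> fk k x = f x} by exact: filter_forall.
apply: filterS2 disj fE' => x dx fx; rewrite {1}(piece_cover hD) => -[k _ kx].
rewrite (bigD1 k)//= indicE mem_set// mulr1 big1 ?addr0; first exact: fx.
by move=> j jk; rewrite indicE memNset ?mulr0// => jx; apply: (dx j k jk).
Qed.

End piecewise_integral.

(** * Regularity of the integrands of the linear program *)

Section integrand_regularity.
Context {R : realType} {n ny : nat}.
Local Notation XY := ('rV[R]_n * 'rV[R]_ny)%type.
Local Notation XYZ := ('rV[R]_n * 'rV[R]_ny * 'M[R]_(ny, n))%type.

Lemma continuous_bigsum (T : topologicalType) (I : Type) (s : seq I) (F : I -> T -> R) :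
  (forall i, continuous (F i)) -> continuous (fun x => \sum_(i <- s) F i x).
Proof.
move=> Fc; elim: s => [|i s IH].
  by under eq_fun do rewrite big_nil; move=> x; exact: cst_continuous.
under eq_fun do rewrite big_cons; move=> x.
by apply: (@continuousD _ R^o _ (F i)); [exact: Fc|exact: IH].
Qed.

Lemma continuous_mul (T : topologicalType) (f g : T -> R) :
  continuous f -> continuous g -> continuous (fun x => f x * g x).
Proof. by move=> cf cg x; apply: continuousM; [exact: cf|exact: cg]. Qed.

Lemma continuous_comp_fst (f : XY -> R) : continuous f -> continuous (fun t : XYZ => f t.1).
Proof.
by move=> cf t; apply: (@continuous_comp _ _ _ fst f); [exact: cvg_fst|exact: cf].
Qed.

Lemma continuous_snd_coord (l : 'I_ny) (m : 'I_n) : continuous (fun t : XYZ => t.2 l m).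
Proof.
move=> t; apply: (@continuous_comp _ _ _ snd (fun z : 'M[R]_(ny, n) => z l m)).
  exact: cvg_snd.
exact: coord_continuous.
Qed.

Lemma continuous_total_derive (f : XY -> R) m : C1 f ->
  continuous (fun t : XYZ => total_derive (f : XY -> R^o) m t).
Proof.
move=> [_ cf]; rewrite /total_derive => t.
apply: (@continuousD _ R^o _ (fun t : XYZ => 'D_(bvec m, 0 : 'rV[R]_ny) (f : XY -> R^o) t.1)).
  exact: (continuous_comp_fst (@cf _)).
apply: continuous_bigsum => l; apply: continuous_mul; first exact: continuous_snd_coord.
exact: (continuous_comp_fst (@cf _)).
Qed.

(** Identifies the sum written in the linear program with the single directional derivative produced
    by the chain rule. *)
Lemma total_deriveE (W : normedModType R) (f : XY -> W) m x y (z : 'M[R]_(ny, n)) :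
  differentiable f (x, y) ->
  total_derive f m (x, y, z) = 'D_(bvec m, (\row_l z l m) : 'rV[R]_ny) f (x, y).
Proof.
move=> df; rewrite /total_derive [RHS]derive_pair//; congr (_ + _).
by apply: eq_bigr => l _; rewrite mxE.
Qed.

Lemma total_derive_mx p q (B : XY -> 'M[R]_(p, q)) m (t : XYZ) a b :
  (forall a b, C1 (fun w => B w a b)) ->
  total_derive B m t a b = total_derive (fun w => B w a b : R^o) m t.
Proof.
move=> CB; have dB v : 'D_v B t.1 a b = 'D_v (fun w => B w a b : R^o) t.1.
  rewrite derive_mx ?mxE//; apply/derivable_mxP => i j.
  by apply: diff_derivable; exact: (CB i j).1.
rewrite /total_derive mxE dB summxE; congr (_ + _).
by apply: eq_bigr => l _; rewrite mxE dB.
Qed.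

Lemma poly_in_xy_C1 (f : XY -> R) : poly_in xy_coord f -> C1 f.
Proof.
apply: poly_in_ind => [a|g h|g h|j]; [exact: C1_cst|exact: C1D|exact: C1M|].
apply: C1_linear.
  by move=> c [x1 y1] [x2 y2]; rewrite /xy_coord /= -add_row_mx -scale_row_mx !mxE.
rewrite /xy_coord; case: (split_ordP j) => i ->; under eq_fun do rewrite ?(row_mxEl, row_mxEr).
  move=> w; apply: (@continuous_comp _ _ _ fst (fun x : 'rV[R]_n => x ord0 i)); first exact: cvg_fst.
  exact: coord_continuous.
move=> w; apply: (@continuous_comp _ _ _ snd (fun x : 'rV[R]_ny => x ord0 i)); first exact: cvg_snd.
exact: coord_continuous.
Qed.

Lemma poly_in_xyz_continuous (f : XYZ -> R) : poly_in xyz_coord f -> continuous f.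
Proof.
apply: (@poly_in_ind _ _ _ _ f (fun g => continuous g)) => [a x|g h cg ch x|g h|j].
- exact: cst_continuous.
- by apply: (@continuousD _ R^o _ g); [exact: cg|exact: ch].
- exact: continuous_mul.
- case: (split_ordP j) => i -> {j}; last first.
    case/mxvec_indexP: i => a b.
    have -> : (fun t : XYZ => xyz_coord t ord0 (rshift (n + ny) (mxvec_index a b))) = (fun t => t.2 a b).
      by apply/funext => t; rewrite /xyz_coord row_mxEr mxvecE.
    exact: continuous_snd_coord.
  case: (split_ordP i) => k -> {i}.
    have -> : (fun t : XYZ => xyz_coord t ord0 (lshift (ny * n) (lshift ny k))) =
        (fun t => (fun w : XY => w.1 ord0 k) t.1).
      by apply/funext => t; rewrite /xyz_coord !row_mxEl.
    apply: (@continuous_comp_fst (fun w : XY => w.1 ord0 k)) => w.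
    apply: (@continuous_comp _ _ _ fst (fun x : 'rV[R]_n => x ord0 k)); first exact: cvg_fst.
    exact: coord_continuous.
  have -> : (fun t : XYZ => xyz_coord t ord0 (lshift (ny * n) (rshift n k))) =
      (fun t => (fun w : XY => w.2 ord0 k) t.1).
    by apply/funext => t; rewrite /xyz_coord row_mxEl row_mxEr.
  apply: (@continuous_comp_fst (fun w : XY => w.2 ord0 k)) => w.
  apply: (@continuous_comp _ _ _ snd (fun x : 'rV[R]_ny => x ord0 k)); first exact: cvg_snd.
  exact: coord_continuous.
Qed.

End integrand_regularity.

Section lp_integrands.
Context {R : realType} {n ny nF nG nb : nat}.
Context (D : geometry R n nb) (P : bvp R n ny nF nG nb) (hP : bvp_ok D P).
Local Notation XY := ('rV[R]_n * 'rV[R]_ny)%type.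
Local Notation XYZ := ('rV[R]_n * 'rV[R]_ny * 'M[R]_(ny, n))%type.
Variables (phi : XY -> R) (sphi : smooth phi).

Let cphi : C1 phi. Proof. exact: smooth_C1. Qed.
Let phic : continuous (fun t : XYZ => phi t.1).
Proof. exact: (continuous_comp_fst (C1_continuous cphi)). Qed.

Lemma B_C1 (i j : 'I_n) a b : (i <= j)%N -> C1 (fun w => pdeB P i j w a b).
Proof. by move=> ij; apply: poly_in_xy_C1; exact: (B_poly hP _ _ ij). Qed.

Lemma mulmx_colE p (M : 'M[R]_(p, ny)) (z : 'M[R]_(ny, n)) i a :
  (M *m col i z) a ord0 = \sum_b M a b * z b i.
Proof. by rewrite mxE; apply: eq_bigr => b _; rewrite mxE. Qed.

Lemma int_b_dBE a (i j : 'I_n) t : (i <= j)%N -> int_b_dB P phi a i j t =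
  phi t.1 * \sum_b total_derive (fun w => pdeB P i j w a b : R^o) j t * t.2 b i.
Proof.
move=> ij; rewrite /int_b_dB mulmx_colE; congr (_ * _); apply: eq_bigr => b _.
by rewrite total_derive_mx// => a' b'; exact: B_C1.
Qed.

Lemma int_b_dphiE a (i j : 'I_n) t : int_b_dphi P phi a i j t =
  total_derive (phi : XY -> R^o) j t * \sum_b pdeB P i j t.1 a b * t.2 b i.
Proof. by rewrite /int_b_dphi mulmx_colE. Qed.

Lemma int_b_bdE a (i j : 'I_n) t : int_b_bd D P phi a i j t =
  (\sum_b pdeB P i j t.1 a b * t.2 b i) * phi t.1 * Defs.eta D t.1.1 ord0 j.
Proof. by rewrite /int_b_bd mulmx_colE. Qed.

Lemma int_a_continuous m : continuous (int_a (ny := ny) phi m).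
Proof. exact: continuous_total_derive. Qed.

Lemma int_b_F_continuous a : continuous (int_b_F P phi a).
Proof.
apply: continuous_mul; first exact: phic.
by apply: poly_in_xyz_continuous; exact: F_poly hP a.
Qed.

Lemma int_b_dB_continuous a (i j : 'I_n) : (i <= j)%N -> continuous (int_b_dB P phi a i j).
Proof.
move=> ij; rewrite (_ : int_b_dB P phi a i j = fun t => phi t.1 *
  \sum_b total_derive (fun w => pdeB P i j w a b : R^o) j t * t.2 b i); last first.
  by apply/funext => t; exact: int_b_dBE.
apply: continuous_mul; first exact: phic.
apply: continuous_bigsum => b; apply: continuous_mul; last exact: continuous_snd_coord.
by apply: continuous_total_derive; exact: B_C1.
Qed.

Let Bz_continuous a (i j : 'I_n) : (i <= j)%N ->
  continuous (fun t : XYZ => \sum_b pdeB P i j t.1 a b * t.2 b i).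
Proof.
move=> ij; apply: continuous_bigsum => b; apply: continuous_mul; last exact: continuous_snd_coord.
exact: (continuous_comp_fst (C1_continuous (B_C1 a b ij))).
Qed.

Lemma int_b_dphi_continuous a (i j : 'I_n) : (i <= j)%N -> continuous (int_b_dphi P phi a i j).
Proof.
move=> ij; rewrite (_ : int_b_dphi P phi a i j = fun t => total_derive (phi : XY -> R^o) j t *
  \sum_b pdeB P i j t.1 a b * t.2 b i); last by apply/funext => t; exact: int_b_dphiE.
by apply: continuous_mul; [exact: continuous_total_derive|exact: Bz_continuous].
Qed.

(** Isolates the normal, known only to be measurable, from a factor to which the continuity
    arguments apply. *)
Lemma int_b_bd_factor a (i j : 'I_n) : (i <= j)%N -> exists2 f : XYZ -> R, continuous f &
  forall t, int_b_bd D P phi a i j t = f t * Defs.eta D t.1.1 ord0 j.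
Proof.
move=> ij; exists (fun t : XYZ => (\sum_b pdeB P i j t.1 a b * t.2 b i) * phi t.1).
  by apply: continuous_mul; [exact: Bz_continuous|exact: phic].
by move=> t; exact: int_b_bdE.
Qed.

Lemma int_c_continuous k b : continuous (int_c P phi k b).
Proof.
apply: continuous_mul; first exact: phic.
by apply: poly_in_xyz_continuous; exact: Gp_poly hP k b.
Qed.

End lp_integrands.

(** * Occupation measures of a solution; constraints (a), (c), (d) and the objective *)

Section occupation_measures.
Context {R : realType} {n ny nF nG nb : nat} (n_gt0 : (0 < n)%N).
Context (D : geometry R n nb) (P : bvp R n ny nF nG nb)
  (hD : geometry_ok D) (hP : bvp_ok D P)
  (y : 'rV[R]_n -> 'rV[R]_ny) (dy : 'rV[R]_n -> 'M[R]_(ny, n))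
  (sol : is_solution D P y dy).
Local Notation Om := (Omega D).
Local Notation dOm := (boundary (Omega D)).
Local Notation V := 'rV[R]_n.
Local Notation XY := ('rV[R]_n * 'rV[R]_ny)%type.
Local Notation XYZ := ('rV[R]_n * 'rV[R]_ny * 'M[R]_(ny, n))%type.

Let mOm : measurable Om. Proof. exact: Omega_measurable hD. Qed.
Let mU : measurable Om°. Proof. exact: interior_measurable. Qed.
Let mb : measurable dOm. Proof. exact: boundary_measurable hD. Qed.
Let mp k : measurable (piece D k). Proof. exact: piece_measurable hD k. Qed.
Let fOm : (leb n Om < +oo)%E. Proof. exact: leb_Omega_lty hD. Qed.
Let fs A : measurable A -> (sigma D A < +oo)%E.
Proof. by move=> mA; rewrite ltey_eq fin_num_measure. Qed.

Definition jet (x : V) : XYZ := (x, y x, dy x).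

Lemma sol_y_measurable : measurable_fun Om y.
Proof.
apply: measurable_fun_row => l; apply: within_continuous_measurable_mxR => //.
apply: (@within_continuous_comp_continuous _ _ _ _ y (fun v => v ord0 l) (sol_continuous sol)).
exact: coord_continuous.
Qed.

Lemma sol_dy_measurable : measurable_fun Om dy.
Proof.
have -> : Om = Om° `|` dOm.
  apply/seteqP; split=> x; first exact: (Omega_split hD).
  by case=> [/interior_subset|/(boundary_sub hD)].
apply/measurable_funU => //; split; last exact: sol_bd_measurable sol.
by apply: measurable_fun_mx => l m; have [_ /(_ m)[[]]] := sol_W1 sol l.
Qed.

Lemma jet_measurable : measurable_fun Om jet.
Proof.
apply: (measurable_fun_pair_on mOm); last exact: sol_dy_measurable.
by apply: (measurable_fun_pair_on mOm); [exact: measurable_id|exact: sol_y_measurable].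
Qed.

Lemma sol_dy_bounded : exists M : R,
  {ae leb n, forall x, Om x -> `|dy x| <= M} /\ forall x, dOm x -> `|dy x| <= M.
Proof.
have [M1 h1] := sol_bd_bounded sol.
have /choice[C hC] : forall lm : 'I_ny * 'I_n, exists C : R,
    {ae leb n, forall x, Om° x -> `|dy x lm.1 lm.2| <= C}.
  by move=> [l m]; have [_ /(_ m)[[_ [C hC]] _]] := sol_W1 sol l; exists C.
pose M2 := \sum_lm `|C lm|.
have M20 : 0 <= M2 by apply: sumr_ge0.
exists (Num.max M1 M2); split; last by move=> x dx; rewrite le_max h1.
apply: (ae_Omega n_gt0 hD).
have : {ae leb n, forall x, forall lm : 'I_ny * 'I_n, Om° x -> `|dy x lm.1 lm.2| <= C lm}.
  by apply: filter_forall => lm; exact: hC.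
apply: filterS => x h Ux; rewrite le_max; apply/orP; right.
apply: mx_norm_le => // l m; apply: le_trans (h (l, m) Ux) _.
rewrite /M2 (bigD1 (l, m))//=; apply: le_trans (ler_norm _) _.
by rewrite lerDl sumr_ge0.
Qed.

(** The sets Y and Z may be unbounded, but Omega, its image under [y] and the matrices of norm at
    most [M] form a compact product containing the jet. Absolute convergence of the integrals of the
    linear program rests on this. *)
Lemma jet_bounded (f : XYZ -> R) (M : R) : continuous f ->
  exists C : R, forall x, Om x -> `|dy x| <= M -> `|f (jet x)| <= C.
Proof.
move=> cf.
have cM : compact [set z : 'M[R]_(ny, n) | cube M (mxvec z)].
  rewrite (_ : [set z | _] = vec_mx @` cube M).
    apply: continuous_compact; last exact: cube_compact.
    by apply: continuous_subspaceT; exact: continuous_vec_mx.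
  apply/seteqP; split=> [z /= h|_ [v /= h <-]]; last by rewrite /= vec_mxK.
  by exists (mxvec z) => //; rewrite mxvecK.
have cy : compact (y @` Om).
  by apply: continuous_compact; [exact: sol_continuous sol|exact: Omega_compact hD].
have cK := compact_setX (compact_setX (Omega_compact hD) cy) cM.
have [C hC] := continuous_bounded cK (continuous_subspaceT cf).
exists C => x Omx dM; apply: hC; split=> /=.
  by split=> //=; exists x.
by case/mxvec_indexP => i j; rewrite mxvecE; apply: le_trans dM; exact: mx_coord_le.
Qed.

Lemma jet_comp_measurable (f : XYZ -> R) : continuous f -> measurable_fun Om (f \o jet).
Proof.
move=> cf; apply: measurableT_comp; first exact: continuous_measurable_xyz.
exact: jet_measurable.
Qed.

Lemma jet_ae_bounded (f : XYZ -> R) : continuous f -> exists C : R,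
  {ae leb n, forall x, Om x -> `|f (jet x)| <= C} /\ forall x, dOm x -> `|f (jet x)| <= C.
Proof.
move=> cf; have [M [h1 h2]] := sol_dy_bounded.
have [C hC] := jet_bounded M cf; exists C; split.
  by apply: filterS h1 => x h Omx; apply: hC => //; exact: h.
by move=> x dx; apply: hC; [exact: (boundary_sub hD)|exact: h2].
Qed.

Lemma jet_integrable (f : XYZ -> R) : continuous f ->
  (leb n).-integrable Om (EFin \o (f \o jet)).
Proof.
move=> cf; have [C [h1 _]] := jet_ae_bounded cf.
exact: (ae_bounded_integrable mOm fOm (jet_comp_measurable cf) h1).
Qed.

Lemma S0_measurable : measurable (S0 D P).
Proof.
apply: measurableX; last exact: Z_borel hP.
by apply: measurableX => //; exact: Y_borel hP.
Qed.

Lemma Sd_measurable k : measurable (Sd D P k).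
Proof.
apply: measurableX; last exact: Z_borel hP.
by apply: measurableX => //; exact: Y_borel hP.
Qed.

Lemma jet_S0 : {ae leb n, forall x, Om x -> S0 D P (jet x)}.
Proof.
by apply: filterS (sol_Z sol) => x h Omx; split; [split=> //; exact: (sol_Y sol)|exact: h].
Qed.

Lemma jet_Sd k : {ae sigma D, forall x, piece D k x -> Sd D P k (jet x)}.
Proof.
apply: filterS (sol_bd_Z sol) => x h px; have dx := piece_sub hD px.
by split; [split=> //; apply: (sol_Y sol); exact: (boundary_sub hD)|exact: h].
Qed.

Lemma jet_measurable_piece k : measurable_fun (piece D k) jet.
Proof.
apply: measurable_funS jet_measurable => //.
by move=> x /(piece_sub hD)/(boundary_sub hD).
Qed.

Definition occ : {measure set XYZ -> \bar R} :=
  @push_restr _ _ _ _ _ (leb n) _ _ mOm jet_measurable.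
Definition occ_bd k : {measure set XYZ -> \bar R} :=
  @push_restr _ _ _ _ _ (sigma D) _ _ (@mp k) (@jet_measurable_piece k).

Lemma occ_integral (f : XYZ -> R) : continuous f ->
  occ.-integrable (S0 D P) (EFin \o f) /\
  \int[occ]_(t in S0 D P) f t = \int[leb n]_(x in Om) f (jet x).
Proof.
move=> cf; have [C [h1 _]] := jet_ae_bounded cf.
apply: (push_restr_integral mOm fOm jet_measurable S0_measurable jet_S0 _ _ h1).
  by apply: measurable_funTS; exact: continuous_measurable_xyz.
exact: jet_comp_measurable.
Qed.

Lemma occ_bd_integral k (f : XYZ -> R) : continuous f ->
  (occ_bd k).-integrable (Sd D P k) (EFin \o f) /\
  \int[occ_bd k]_(t in Sd D P k) f t = \int[sigma D]_(x in piece D k) f (jet x).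
Proof.
move=> cf; have [C [_ h2]] := jet_ae_bounded cf.
apply: (push_restr_integral (@mp k) (fs (@mp k)) (@jet_measurable_piece k) (Sd_measurable k)
  (jet_Sd k) (C := C)).
- by apply: measurable_funTS; exact: continuous_measurable_xyz.
- apply: measurable_funS (jet_comp_measurable cf) => //.
  by move=> x /(piece_sub hD)/(boundary_sub hD).
- by apply: aeW => x px; apply: h2; exact: (piece_sub hD px).
Qed.

Lemma eta_coord_measurable j : measurable_fun dOm (fun x => Defs.eta D x ord0 j).
Proof. exact: (measurableT_comp (@measurable_coord R 1 n ord0 j) (eta_measurable hD)). Qed.

Lemma eta_le1 j : {ae sigma D, forall x, dOm x -> `|Defs.eta D x ord0 j| <= 1}.
Proof.
apply: filterS (eta_normal hD) => x h dx; have [e1 _] := h dx.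
have d1 : dotp (Defs.eta D x) (Defs.eta D x) = 1.
  have d0 : 0 <= dotp (Defs.eta D x) (Defs.eta D x) by apply: sumr_ge0 => i _; exact: sqr_ge0.
  by rewrite -(sqr_sqrtr d0) -/(enorm _) e1 expr1n.
rewrite -(@ler_pXn2r _ 2)// ?nnegrE// expr1n real_normK ?num_real// -[leRHS]d1.
by rewrite /dotp (bigD1 j)//= expr2 lerDl sumr_ge0// => i _; exact: sqr_ge0.
Qed.

Lemma jet_eta_bounded (f : XYZ -> R) j : continuous f -> exists C : R,
  {ae sigma D, forall x, dOm x -> `|f (jet x) * Defs.eta D x ord0 j| <= C}.
Proof.
move=> cf; have [C [_ h2]] := jet_ae_bounded cf; exists C.
apply: filterS (eta_le1 j) => x h dx; rewrite normrM; apply: le_trans (h2 _ dx).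
by rewrite ler_piMr// h.
Qed.

Lemma jet_eta_measurable (f : XYZ -> R) j : continuous f ->
  measurable_fun dOm (fun x => f (jet x) * Defs.eta D x ord0 j).
Proof.
move=> cf; apply: measurable_funM; last exact: eta_coord_measurable.
by apply: measurable_funS (jet_comp_measurable cf) => //; exact: (boundary_sub hD).
Qed.

Lemma occ_bd_integral_eta k (f F : XYZ -> R) j : continuous f ->
  (forall t, F t = f t * Defs.eta D t.1.1 ord0 j) ->
  (occ_bd k).-integrable (Sd D P k) (EFin \o F) /\
  \int[occ_bd k]_(t in Sd D P k) F t = \int[sigma D]_(x in piece D k) F (jet x).
Proof.
move=> cf /funext ->; have [C hC] := jet_eta_bounded j cf.
apply: (push_restr_integral (@mp k) (fs (@mp k)) (@jet_measurable_piece k) (Sd_measurable k)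
  (jet_Sd k) (C := C)).
- apply: measurable_funM; first by apply: measurable_funTS; exact: continuous_measurable_xyz.
  apply: (measurable_comp mb _ (eta_coord_measurable j)).
    by move=> _ [t [[px _] _] <-]; exact: (piece_sub hD px).
  apply: measurable_funTS; exact: (measurableT_comp measurable_fst measurable_fst).
- by apply: measurable_funS (jet_eta_measurable j cf) => //; exact: (piece_sub hD).
- by apply: filterS hC => x h px; apply: h; exact: (piece_sub hD px).
Qed.

Lemma occ_bd_sum_eta (f F : XYZ -> R) j : continuous f ->
  (forall t, F t = f t * Defs.eta D t.1.1 ord0 j) ->
  \sum_k \int[occ_bd k]_(t in Sd D P k) F t = \int[sigma D]_(x in dOm) F (jet x).
Proof.
move=> cf FE; rewrite (eq_bigr _ (fun k _ => (occ_bd_integral_eta k cf FE).2)).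
have [C hC] := jet_eta_bounded j cf.
have EF : (fun x => F (jet x)) = fun x => f (jet x) * Defs.eta D x ord0 j.
  by apply/funext => x; rewrite FE.
rewrite EF; apply: (sum_piecewise_integral hD).
- by move=> k; exact: jet_eta_measurable.
- by move=> k; exists C.
- by move=> k; exact: aeW.
Qed.

Lemma W1infty_jet (f : XY -> R) : C1 f -> W1infty Om° (fun x => f (x, y x))
  (fun m x => total_derive (f : XY -> R^o) m (jet x)).
Proof.
move=> Cf; have := W1infty_comp (Omega_compact hD) (sol_continuous sol) (sol_W1 sol) Cf.
rewrite (_ : (fun m x => 'D_(bvec m, \row_l dy x l m) (f : XY -> R^o) (x, y x)) =
  (fun m x => total_derive (f : XY -> R^o) m (jet x)))//.
apply/funext => m; apply/funext => x; rewrite /jet total_deriveE//; exact: Cf.1.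
Qed.

Lemma continuous_jet (f : XY -> R) : continuous f -> {within Om, continuous (fun x => f (x, y x))}.
Proof. by move=> cf; exact: (within_continuous_comp_pair (sol_continuous sol) cf). Qed.

Lemma occ_lp_a phi m : smooth phi ->
  \int[occ]_(t in S0 D P) int_a phi m t
    - \sum_k \int[occ_bd k]_(t in Sd D P k) int_a_bd D phi m t = 0.
Proof.
move=> sphi; have Cphi := smooth_C1 sphi.
have ca : continuous (int_a (ny := ny) phi m) by exact: int_a_continuous.
rewrite (occ_integral ca).2.
rewrite (occ_bd_sum_eta (continuous_comp_fst (C1_continuous Cphi)) (j := m))//.
rewrite (gauss_green hD (continuous_jet (C1_continuous Cphi)) (W1infty_jet Cphi) m).
exact: subrr.
Qed.

(** Each piece contributes zero on its own: there [bcGp] agrees almost everywhere with [bcG], which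
    the boundary condition annihilates. *)
Lemma occ_lp_c phi b : smooth phi ->
  \sum_k \int[occ_bd k]_(t in Sd D P k) int_c P phi k b t = 0.
Proof.
move=> sphi; apply: big1 => k _; have cc : continuous (int_c P phi k b) by apply: (int_c_continuous hP).
rewrite (occ_bd_integral k cc).2.
transitivity (\int[sigma D]_(x in piece D k) (0 : R)); last by rewrite Rintegral_cst// mul0r.
apply: ae_eq_Rintegral; apply: filterS2 (G_piecewise hP k) (sol_boundary sol) => x h1 h2 px.
by rewrite /int_c /jet /= -h1// h2 ?mxE ?mulr0//; exact: (piece_sub hD px).
Qed.

Lemma continuous_comp_fst_fst (psi : V -> R) : continuous psi ->
  continuous (fun t : XYZ => psi t.1.1).
Proof.
move=> cpsi; apply: (@continuous_comp_fst _ _ _ (fun w : XY => psi w.1)) => w.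
by apply: (@continuous_comp _ _ _ fst psi); [exact: cvg_fst|exact: cpsi].
Qed.

Lemma occ_lp_d (psi : V -> R) k : smooth psi ->
  \int[occ_bd k]_(t in Sd D P k) psi t.1.1 = \int[sigma D]_(x in piece D k) psi x.
Proof.
move=> spsi; have cpsi := C1_continuous (smooth_C1 spsi).
exact: (occ_bd_integral k (continuous_comp_fst_fst cpsi)).2.
Qed.

Lemma occ_objective : lp_objective D P occ occ_bd = cost D P y dy.
Proof.
rewrite /lp_objective /cost; congr (_ + _).
  exact: (occ_integral (poly_in_xyz_continuous (L_poly hP))).2.
have cL k : continuous (objLdp P k) by exact: poly_in_xyz_continuous (Ldp_poly hP k).
rewrite (eq_bigr _ (fun k _ => (occ_bd_integral k (@cL k)).2)).
apply: (sum_piecewise_integral hD).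
- move=> k; apply: measurable_funS (jet_comp_measurable (@cL k)) => //; exact: (boundary_sub hD).
- by move=> k; have [C [_ hC]] := jet_ae_bounded (@cL k); exists C; exact: aeW.
- by move=> k; apply: filterS (Ld_piecewise hP k) => x h px; rewrite /jet h.
Qed.

End occupation_measures.

(** * Integration by parts and constraint (b) *)

Lemma continuous_within_mx (R : realType) (T : topologicalType) (A : set T) m n
    (f : T -> 'M[R]_(m, n)) :
  (forall i j, {within A, continuous (fun x => f x i j)}) -> {within A, continuous f}.
Proof. by move=> cf; apply: (@continuous_mx R (subspace A)) => i j; exact: cf. Qed.

Section weak_derivatives.
Context {R : realType} {n : nat} (A U : set 'rV[R]_n).
Hypotheses (mA : measurable A) (mU : measurable U) (UA : U `<=` A).

(** Passes from entries of the Jacobian to their continuous representatives. Continuity of [g]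
    supplies the Borel measurability that almost everywhere equality alone would not give. *)
Lemma W1infty_ae_eq (f g : 'rV[R]_n -> R) df : W1infty U f df -> {within A, continuous g} ->
  {ae leb n, forall x, U x -> f x = g x} -> W1infty U g df.
Proof.
move=> [[mf [C hC]] h] cg fg; split.
  split; first by apply: measurable_funS (within_continuous_measurable_mxR mA cg).
  by exists C; apply: filterS2 fg hC => x h1 h2 Ux; rewrite -h1// h2.
move=> k; have [h1 h2] := h k; split=> // phi tphi; rewrite -(h2 _ tphi).
by apply: ae_eq_Rintegral; apply: filterS fg => x E Ux; rewrite E.
Qed.

End weak_derivatives.

Section product_derivative.
Context {R : realType} {n ny : nat}.
Local Notation V := 'rV[R]_n.
Local Notation XY := ('rV[R]_n * 'rV[R]_ny)%type.
Local Notation VW := ('rV[R]_n * 'rV[R]_(ny + ny))%type.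
Variables (phi : XY -> R) (B : 'I_ny -> XY -> R).
Hypotheses (Cphi : C1 phi) (CB : forall b, C1 (B b)).

(* The second component of w is the pair (y, dy/dx_i), so that a single application
   of the chain rule differentiates the whole integrand. *)
Definition flux (w : VW) : R :=
  phi (w.1, lsubmx w.2) * \sum_b B b (w.1, lsubmx w.2) * w.2 ord0 (rshift ny b).

Let L (w : VW) : XY := (w.1, lsubmx w.2).

Let L_linear : linear L.
Proof. by move=> c [x1 p1] [x2 p2]; rewrite /L /= linearP. Qed.

Let L_continuous : continuous L.
Proof.
move=> w; apply: continuous_pair; first exact: cvg_fst.
apply: continuous_mx => i j {}w.
rewrite (_ : (fun w : VW => lsubmx w.2 i j) = fun w => w.2 i (lshift ny j)); last first.
  by apply/funext => v; rewrite mxE.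
apply: (@continuous_comp _ _ _ snd (fun z : 'rV[R]_(ny + ny) => z i (lshift ny j))).
  exact: cvg_snd.
exact: coord_continuous.
Qed.

Let q_linear b : linear ((fun w : VW => w.2 ord0 (rshift ny b)) : VW -> R^o).
Proof. by move=> c [x1 p1] [x2 p2]; rewrite /= !mxE. Qed.

Let q_continuous b : continuous (fun w : VW => w.2 ord0 (rshift ny b)).
Proof.
move=> w; apply: (@continuous_comp _ _ _ snd (fun z : 'rV[R]_(ny + ny) => z ord0 (rshift ny b))).
  exact: cvg_snd.
exact: coord_continuous.
Qed.

Lemma C1_flux : C1 flux.
Proof.
apply: C1M; first exact: (C1_comp_linear L_linear L_continuous Cphi).
apply: C1_sum => b; apply: C1M; first exact: (C1_comp_linear L_linear L_continuous (CB b)).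
exact: C1_linear.
Qed.

(** The three summands become, in this order, the integrand of (b) with the derivative of [phi], the
    one with the derivative of [B], and the second-order term of the equation. *)
Lemma derive_flux (w v : VW) : 'D_v (flux : VW -> R^o) w =
  'D_(v.1, lsubmx v.2) (phi : XY -> R^o) (w.1, lsubmx w.2) *
    (\sum_b B b (w.1, lsubmx w.2) * w.2 ord0 (rshift ny b)) +
  phi (w.1, lsubmx w.2) * (\sum_b 'D_(v.1, lsubmx v.2) (B b : XY -> R^o) (w.1, lsubmx w.2) *
    w.2 ord0 (rshift ny b)) +
  phi (w.1, lsubmx w.2) * (\sum_b B b (w.1, lsubmx w.2) * v.2 ord0 (rshift ny b)).
Proof.
have dphi : is_derive w v (phi \o L : VW -> R^o) ('D_(L v) (phi : XY -> R^o) (L w)).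
  by apply: (@derive_comp_linear _ _ _ R^o) => //; exact: Cphi.1.
have dB b : is_derive w v (B b \o L : VW -> R^o) ('D_(L v) (B b : XY -> R^o) (L w)).
  by apply: (@derive_comp_linear _ _ _ R^o) => //; exact: (CB b).1.
have dq b : is_derive w v ((fun w : VW => w.2 ord0 (rshift ny b)) : VW -> R^o)
    (v.2 ord0 (rshift ny b)).
  have [dL DL] := @continuous_linear_diff _ _ R^o _ w v (@q_linear b) (@q_continuous b).
  by apply: DeriveDef => //; exact: diff_derivable.
have dS : is_derive w v ((fun w => \sum_b (B b \o L) w * w.2 ord0 (rshift ny b)) : VW -> R^o)
    (\sum_b (B b (L w) * v.2 ord0 (rshift ny b) +
             w.2 ord0 (rshift ny b) * 'D_(L v) (B b : XY -> R^o) (L w))).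
  have -> : (fun w => \sum_b (B b \o L) w * w.2 ord0 (rshift ny b)) =
      \sum_b ((B b \o L : VW -> R^o) * (fun w : VW => w.2 ord0 (rshift ny b))).
    by apply/funext => z; rewrite fct_sumE.
  by apply: is_derive_sum => b; exact: (is_deriveM (dB b) (dq b)).
have [_ ->] := is_deriveM dphi dS.
rewrite /L /= big_split /= scalerDr addrC -addrA; congr (_ + _).
  exact: mulrC.
rewrite addrC; congr (_ + _); congr (_ * _).
by apply: eq_bigr => b _; exact: mulrC.
Qed.

End product_derivative.

Section second_order_terms.
Context {R : realType} {n ny nF nG nb : nat} (n_gt0 : (0 < n)%N).
Context (D : geometry R n nb) (P : bvp R n ny nF nG nb)
  (hD : geometry_ok D) (hP : bvp_ok D P)
  (y : 'rV[R]_n -> 'rV[R]_ny) (dy : 'rV[R]_n -> 'M[R]_(ny, n))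
  (sol : is_solution D P y dy).
Local Notation Om := (Omega D).
Local Notation dOm := (boundary (Omega D)).
Local Notation V := 'rV[R]_n.
Local Notation XY := ('rV[R]_n * 'rV[R]_ny)%type.
Local Notation XYZ := ('rV[R]_n * 'rV[R]_ny * 'M[R]_(ny, n))%type.
Local Notation jet := (jet y dy).
Variables (phi : XY -> R) (sphi : smooth phi).

Let mOm : measurable Om. Proof. exact: Omega_measurable hD. Qed.
Let mU : measurable Om°. Proof. exact: interior_measurable. Qed.
Let UOm : Om° `<=` Om. Proof. exact: interior_subset. Qed.
Let fU : (leb n Om° < +oo)%E.
Proof. by apply: le_lt_trans (leb_Omega_lty hD); apply: le_measure; rewrite ?inE. Qed.
Let Cphi : C1 phi. Proof. exact: smooth_C1. Qed.

Lemma Rintegral_Omega_interior (f : V -> R) :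
  \int[leb n]_(x in Om) f x = \int[leb n]_(x in Om°) f x.
Proof.
rewrite Rintegral_mkcond [RHS]Rintegral_mkcond; apply: ae_eq_Rintegral.
exists dOm; split; [exact: boundary_measurable hD|exact: (leb_boundary0 n_gt0 hD)|].
move=> x /=; rewrite (boundaryE hD) => h; apply: contrapT => h'; apply: h => _.
rewrite !patchE; have [Ux|nUx] := pselect (Om° x).
  by rewrite !mem_set//; exact: UOm.
have nOx : ~ Om x by move=> Ox; exact: h'.
by rewrite !memNset.
Qed.

(** Gauss-Green in direction [j] for the flux. [T] represents the second-order term; it is defined
    as the derivative of the flux minus the two first-order integrands, from which it inherits
    integrability. *)
Lemma int_b_parts_second (d2y : 'I_n -> 'I_n -> V -> 'cV[R]_ny) a (i j : 'I_n) : (i <= j)%N -> second_order P ->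
  (forall l i, W1infty Om° (fun x => dy x l i) (fun j x => d2y i j x l ord0)) ->
  exists T : V -> R, [/\ (leb n).-integrable Om° (EFin \o T),
    {ae leb n, forall x, Om° x ->
      T x = phi (x, y x) * (pdeB P i j (x, y x) *m d2y i j x) a ord0}
    & \int[sigma D]_(x in dOm) int_b_bd D P phi a i j (jet x) =
      \int[leb n]_(x in Om°) int_b_dB P phi a i j (jet x) +
      \int[leb n]_(x in Om°) int_b_dphi P phi a i j (jet x) +
      \int[leb n]_(x in Om°) T x].
Proof.
move=> ij so hd2.
(* [w b] agrees with the entry [(b, i)] of the Jacobian almost everywhere inside and, by the trace
   condition, on the boundary. *)
have /choice[w hw] : forall b, exists w : V -> R, [/\ {within Om, continuous w},
    {ae leb n, forall x, Om° x -> dy x b i = w x}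
  & {ae sigma D, forall x, dOm x -> dy x b i = w x}].
  by move=> b; exact: sol_bd_trace sol so b i.
pose u (x : V) : 'rV[R]_(ny + ny) := row_mx (y x) (\row_b w b x).
(* The weak gradient of [u]: first derivatives in the block of [y], second derivatives in the block
   of the [i]-th Jacobian column. *)
pose du (l : 'I_(ny + ny)) (m : 'I_n) (x : V) : R :=
  match fintype.split l with inl k => dy x k m | inr b => d2y i m x b ord0 end.
have uc : {within Om, continuous u}.
  apply: continuous_within_mx => i' l; rewrite (ord1 i').
  case: (split_ordP l) => k ->.
    rewrite (_ : (fun x => _) = fun x => y x ord0 k); last by apply/funext => x; rewrite row_mxEl.
    apply: (@within_continuous_comp_continuous _ _ _ _ y (fun v => v ord0 k) (sol_continuous sol)).
    exact: coord_continuous.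
  rewrite (_ : (fun x => _) = w k); last by apply/funext => x; rewrite row_mxEr mxE.
  by have [] := hw k.
have uW l : W1infty Om° (fun x => u x ord0 l) (du l).
  rewrite /du; case: (split_ordP l) => k ->.
    rewrite (_ : (fun x => u x _ _) = fun x => y x ord0 k); last first.
      by apply/funext => x; rewrite row_mxEl.
    exact: sol_W1 sol k.
  rewrite (_ : (fun x => u x _ _) = w k); last by apply/funext => x; rewrite row_mxEr mxE.
  have [cw aw _] := hw k.
  exact: (W1infty_ae_eq mOm UOm (hd2 k i) cw aw).
pose B b (v : XY) := pdeB P i j v a b.
have CB b : C1 (B b) by exact: (B_C1 hP a b ij).
have CF : C1 (flux phi B) by exact: C1_flux.
have W := W1infty_comp (Omega_compact hD) uc uW CF.
pose dh (m : 'I_n) (x : V) : R :=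
  'D_(bvec m, \row_l du l m x) (flux phi B : _ -> R^o) (x, u x).
have GG := gauss_green hD (within_continuous_comp_pair uc (C1_continuous CF)) W j.
have aw : {ae leb n, forall x b, Om° x -> dy x b i = w b x}.
  by apply: filter_forall => b; have [] := hw b.
have aws : {ae sigma D, forall x b, dOm x -> dy x b i = w b x}.
  by apply: filter_forall => b; have [] := hw b.
have dhE x : dh j x =
    total_derive (phi : XY -> R^o) j (jet x) * (\sum_b B b (x, y x) * w b x) +
    phi (x, y x) * (\sum_b total_derive (B b : XY -> R^o) j (jet x) * w b x) +
    phi (x, y x) * (\sum_b B b (x, y x) * d2y i j x b ord0).
  rewrite /dh (derive_flux Cphi CB) /= /u row_mxKl.
  have -> : lsubmx (\row_l du l j x) = \row_l dy x l j.
    apply/rowP => l; rewrite !mxE /du.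
    by rewrite (_ : fintype.split (lshift ny l) = inl l)//; exact: (unsplitK (inl l)).
  rewrite -(@total_deriveE _ _ _ R^o phi j x (y x) (dy x)); last exact: Cphi.1.
  congr (_ * _ + _ * _ + _ * _); apply: eq_bigr => b _.
  - by rewrite row_mxEr mxE.
  - rewrite row_mxEr mxE; congr (_ * _).
    by rewrite -(@total_deriveE _ _ _ R^o (B b) j x (y x) (dy x))//; exact: (CB b).1.
  - rewrite mxE /du; congr (_ * _).
    by rewrite (_ : fintype.split (rshift ny b) = inr b)//; exact: (unsplitK (inr b)).
have idh : (leb n).-integrable Om° (EFin \o dh j).
  have [_ /(_ j)[[mdh [C hC]] _]] := W.
  exact: (ae_bounded_integrable mU fU mdh hC).
have ijet f : continuous f -> (leb n).-integrable Om° (EFin \o (f \o jet)).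
  by move=> cf; apply: (integrableS mOm mU UOm); exact: (jet_integrable n_gt0 hD sol).
have idB := ijet _ (int_b_dB_continuous hP sphi (a := a) ij).
have idphi := ijet _ (int_b_dphi_continuous hP sphi (a := a) ij).
pose G x := int_b_dB P phi a i j (jet x) + int_b_dphi P phi a i j (jet x).
have iG : (leb n).-integrable Om° (EFin \o G) by exact: (integrableD mU idB idphi).
exists (fun x => dh j x - G x); split.
- exact: (integrableB mU idh iG).
- apply: filterS aw => x E Ux; rewrite dhE /G.
  rewrite (int_b_dBE hP)// int_b_dphiE.
  have E1 (c : 'I_ny -> R) : \sum_b c b * w b x = \sum_b c b * (jet x).2 b i.
    by apply: eq_bigr => b _; rewrite -E.
  rewrite !E1 mxE.
  set p := phi _; set q := \sum_b _; set r := \sum_b _; set s := \sum_b _.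
  by rewrite addrAC [in X in X - _]addrC opprD; ring.
- have -> : \int[sigma D]_(x in dOm) int_b_bd D P phi a i j (jet x) =
      \int[sigma D]_(x in dOm) (flux phi B (x, u x) * Defs.eta D x ord0 j).
    apply: ae_eq_Rintegral; apply: filterS aws => x E dx.
    rewrite int_b_bdE /flux /= /u row_mxKl; congr (_ * _); rewrite mulrC; congr (_ * _).
    by apply: eq_bigr => b _; rewrite row_mxEr mxE E.
  rewrite GG Rintegral_Omega_interior RintegralB// RintegralD//.
  by rewrite addrCA subrr addr0.
Qed.

(** In the first-order case [pdeB P i j] vanishes identically, and so does every term, whatever
    [d2y] is. Asking only for some [T] lets both cases share one statement. *)
Lemma int_b_parts (d2y : 'I_n -> 'I_n -> V -> 'cV[R]_ny) a (i j : 'I_n) : (i <= j)%N ->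
  (second_order P -> forall l i, W1infty Om° (fun x => dy x l i) (fun j x => d2y i j x l ord0)) ->
  exists T : V -> R, [/\ (leb n).-integrable Om° (EFin \o T),
    {ae leb n, forall x, Om° x ->
      T x = phi (x, y x) * (pdeB P i j (x, y x) *m d2y i j x) a ord0}
    & \int[sigma D]_(x in dOm) int_b_bd D P phi a i j (jet x) =
      \int[leb n]_(x in Om°) int_b_dB P phi a i j (jet x) +
      \int[leb n]_(x in Om°) int_b_dphi P phi a i j (jet x) +
      \int[leb n]_(x in Om°) T x].
Proof.
move=> ij hd2; have [so|nso] := pselect (second_order P).
  exact: (int_b_parts_second a ij so (hd2 so)).
have B0 : pdeB P i j = fun=> 0.
  apply/funext => v; apply/eqP; apply: contrapT => /negP h.
  by apply: nso; exists i, j, v.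
have I0 d (T' : measurableType d) (m : {measure set T' -> \bar R}) (A : set T') (f : T' -> R) :
    (forall x, f x = 0) -> \int[m]_(x in A) f x = 0.
  by move=> /funext ->; rewrite /Rintegral integral0.
exists (fun=> 0); split; first exact: integrable0.
  by apply: aeW => x _; rewrite B0 mul0mx mxE mulr0.
rewrite !I0 ?addr0// => x.
- by rewrite int_b_dphiE B0 big1 ?mulr0// => b _; rewrite mxE mul0r.
- rewrite /int_b_dB B0 (_ : total_derive _ _ _ = 0) ?mul0mx ?mxE ?mulr0//.
  rewrite /total_derive derive_cst add0r big1// => l _; by rewrite derive_cst scaler0.
- by rewrite int_b_bdE B0 big1 ?mul0r// => b _; rewrite mxE mul0r.
Qed.

(** By [int_b_parts] the boundary sum equals the two derivative sums plus the integrals of the [T].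
    What remains is the integral of [phi] times row [a] of the equation. *)
Lemma occ_lp_b a :
  \int[occ hD sol]_(t in S0 D P) int_b_F P phi a t
    - \sum_(i < n) \sum_(j < n | (i <= j)%N)
        \int[occ hD sol]_(t in S0 D P) int_b_dB P phi a i j t
    - \sum_(i < n) \sum_(j < n | (i <= j)%N)
        \int[occ hD sol]_(t in S0 D P) int_b_dphi P phi a i j t
    + \sum_(i < n) \sum_(j < n | (i <= j)%N)
        \sum_k \int[occ_bd hD sol k]_(t in Sd D P k) int_b_bd D P phi a i j t = 0.
Proof.
have [d2y [hd2 heq]] := sol_equation sol.
have /choice[T hT] : forall ij : 'I_n * 'I_n, exists T : V -> R, (ij.1 <= ij.2)%N ->
  [/\ (leb n).-integrable Om° (EFin \o T),
    {ae leb n, forall x, Om° x ->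
      T x = phi (x, y x) * (pdeB P ij.1 ij.2 (x, y x) *m d2y ij.1 ij.2 x) a ord0}
    & \int[sigma D]_(x in dOm) int_b_bd D P phi a ij.1 ij.2 (jet x) =
      \int[leb n]_(x in Om°) int_b_dB P phi a ij.1 ij.2 (jet x) +
      \int[leb n]_(x in Om°) int_b_dphi P phi a ij.1 ij.2 (jet x) +
      \int[leb n]_(x in Om°) T x].
  (* Nothing is claimed for [i > j], so zero serves as a filler value. *)
  move=> [i j] /=; have [ij|nij] := boolP (i <= j)%N; last by exists (fun=> 0).
  by have [T hT] := int_b_parts a ij hd2; exists T.
(* Treating the sum over [i <= j] as an additive functional reduces the final identity to ring
   arithmetic in four numbers. *)
pose S (f : 'I_n -> 'I_n -> R) := \sum_(i < n) \sum_(j < n | (i <= j)%N) f i j.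
have SD f g : S (fun i j => f i j + g i j) = S f + S g.
  by rewrite /S -big_split; apply: eq_bigr => i _; rewrite -big_split.
have SE f g : (forall i j : 'I_n, (i <= j)%N -> f i j = g i j) -> S f = S g.
  by move=> fg; apply: eq_bigr => i _; apply: eq_bigr => j; exact: fg.
pose IB i j := \int[leb n]_(x in Om°) int_b_dB P phi a i j (jet x).
pose Ip i j := \int[leb n]_(x in Om°) int_b_dphi P phi a i j (jet x).
pose IT i j := \int[leb n]_(x in Om°) T (i, j) x.
have E1 : S (fun i j => \int[occ hD sol]_(t in S0 D P) int_b_dB P phi a i j t) = S IB.
  apply: SE => i j ij; rewrite (occ_integral n_gt0 hD hP sol (int_b_dB_continuous hP sphi (a := a) ij)).2.
  exact: Rintegral_Omega_interior.
have E2 : S (fun i j => \int[occ hD sol]_(t in S0 D P) int_b_dphi P phi a i j t) = S Ip.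
  apply: SE => i j ij; rewrite (occ_integral n_gt0 hD hP sol (int_b_dphi_continuous hP sphi (a := a) ij)).2.
  exact: Rintegral_Omega_interior.
have E3 : S (fun i j => \sum_k \int[occ_bd hD sol k]_(t in Sd D P k) int_b_bd D P phi a i j t) =
    S IB + S Ip + S IT.
  rewrite -!SD; apply: SE => i j ij; have [f cf fE] := int_b_bd_factor hP sphi a ij.
  by rewrite (occ_bd_sum_eta n_gt0 hD hP sol cf fE); have [_ _] := hT (i, j) ij.
have cF : continuous (int_b_F P phi a) by apply: (int_b_F_continuous hP).
have iF : (leb n).-integrable Om° (EFin \o (int_b_F P phi a \o jet)).
  by apply: (integrableS mOm mU UOm); exact: (jet_integrable n_gt0 hD sol).
have iT (i : 'I_n) := @Rintegral_sum _ _ _ (leb n) _ mU _ (index_enum 'I_n)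
  (fun j : 'I_n => (i <= j)%N) (fun j => T (i, j)) (fun j ij => let: And3 h _ _ := hT (i, j) ij in h).
have iS := @Rintegral_sum _ _ _ (leb n) _ mU _ (index_enum 'I_n) xpredT _ (fun i _ => (iT i).1).
have E4 : S IT = \int[leb n]_(x in Om°) \sum_(i < n) \sum_(j < n | (i <= j)%N) T (i, j) x.
  by rewrite iS.2; apply: eq_bigr => i _; rewrite (iT i).2.
have aT : {ae leb n, forall x (ij : 'I_n * 'I_n), (ij.1 <= ij.2)%N -> Om° x ->
    T ij x = phi (x, y x) * (pdeB P ij.1 ij.2 (x, y x) *m d2y ij.1 ij.2 x) a ord0}.
  apply: filter_forall => ij; have [h|h] := boolP (ij.1 <= ij.2)%N; last exact: aeW.
  by have [_ + _] := hT ij h; apply: filterS => x Hx _.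
(* This is the equation tested against [phi (x, y x)]: the combined integrand vanishes almost
   everywhere. *)
have E5 : \int[leb n]_(x in Om°) int_b_F P phi a (jet x) + S IT = 0.
  rewrite E4 -RintegralD//; last exact: iS.1.
  transitivity (\int[leb n]_(x in Om°) (0 : R)); last by rewrite /Rintegral integral0.
  apply: ae_eq_Rintegral; apply: filterS2 aT heq => x h1 h2 Ux.
  have /matrixP/(_ a ord0) := h2 Ux; rewrite !mxE summxE => h3.
  have h4 := congr1 (fun r => phi (x, y x) * r) h3; rewrite /= mulr0 mulrDr in h4.
  apply: etrans h4; rewrite /int_b_F /=; congr (_ + _).
  rewrite mulr_sumr; apply: eq_bigr => i _; rewrite summxE mulr_sumr.
  by apply: eq_bigr => j ij; rewrite (h1 (i, j)).
rewrite (occ_integral n_gt0 hD hP sol cF).2 Rintegral_Omega_interior.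
have := congr1 (fun r => r) E5; rewrite -/(S _) -/(S _) -/(S _) E1 E2 E3.
by move: (S IB) (S Ip) (S IT) (Rintegral _ _ _) => r1 r2 r3 r4 h; rewrite -h; ring.
Qed.

End second_order_terms.

(** * Feasibility and comparison of the optimal values *)

Section occupation_feasible.
Context {R : realType} {n ny nF nG nb : nat} (n_gt0 : (0 < n)%N).
Context (D : geometry R n nb) (P : bvp R n ny nF nG nb)
  (hD : geometry_ok D) (hP : bvp_ok D P)
  (y : 'rV[R]_n -> 'rV[R]_ny) (dy : 'rV[R]_n -> 'M[R]_(ny, n))
  (sol : is_solution D P y dy).

Lemma occ_convergent : lp_convergent D P (occ hD sol) (occ_bd hD sol).
Proof.
have oi := occ_integral n_gt0 hD hP sol.
have ob := occ_bd_integral n_gt0 hD hP sol.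
split.
- move=> phi m sphi; apply: (oi _ _).1; exact: int_a_continuous.
- move=> phi m k sphi.
  apply: (occ_bd_integral_eta n_gt0 hD hP sol k
    (continuous_comp_fst (C1_continuous (smooth_C1 sphi))) (j := m) _).1.
  by [].
- move=> phi a sphi; apply: (oi _ _).1; exact: (@int_b_F_continuous _ _ _ _ _ _ D P hP phi sphi a).
- move=> phi a i j sphi ij; apply: (oi _ _).1; exact: (int_b_dB_continuous hP sphi ij).
- move=> phi a i j sphi ij; apply: (oi _ _).1; exact: (int_b_dphi_continuous hP sphi ij).
- move=> phi a i j k sphi ij; have [f cf fE] := int_b_bd_factor hP sphi a ij.
  exact: (occ_bd_integral_eta n_gt0 hD hP sol k cf fE).1.
- move=> phi k b sphi; apply: (ob k _ _).1; exact: (@int_c_continuous _ _ _ _ _ _ D P hP phi sphi k b).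
- move=> psi k spsi; apply: (ob k _ _).1.
  exact: (continuous_comp_fst_fst (C1_continuous (smooth_C1 spsi))).
- exact: (oi _ (poly_in_xyz_continuous (L_poly hP))).1.
- by move=> k; exact: (ob k _ (poly_in_xyz_continuous (Ldp_poly hP k))).1.
Qed.

Lemma occ_feasible : lp_feasible D P (occ hD sol) (occ_bd hD sol).
Proof.
split.
- exact: (push_restr_supported _ _ (S0_measurable hD hP) (jet_S0 sol)).
- by move=> k; exact: (push_restr_supported _ _ (Sd_measurable hD hP k) (jet_Sd hD sol k)).
- exact: occ_convergent.
- by move=> phi m sphi; exact: occ_lp_a.
- by move=> phi a sphi; exact: occ_lp_b.
- by move=> phi b sphi; exact: occ_lp_c.
- by move=> psi k spsi; exact: occ_lp_d.
Qed.

End occupation_feasible.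

Theorem theorem2 (R : realType) (n ny nF nG nb : nat) (n_gt0 : (0 < n)%N)
    (D : geometry R n nb) (P : bvp R n ny nF nG nb)
    (hD : geometry_ok D) (hP : bvp_ok D P) :
  (lp_inf D P <= p_inf D P)%E /\ (p_sup D P <= lp_sup D P)%E.
Proof.
(* Enlarging a set of values lowers its infimum and raises its supremum; without solutions the
   conventions for the empty set give both inequalities. *)
have sub : cost_values D P `<=` lp_values D P.
  move=> _ [[y dy] /= sol <-]; exists (occ hD sol), (occ_bd hD sol); split.
    exact: occ_feasible.
  by rewrite occ_objective.
by split; [exact: le_ereal_inf|exact: le_ereal_sup].
Qed.
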